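(* Let $s\in\mathbb{R}$, $0<p<\infty$, $0<q\le\infty$ and $\varphi\in\mathcal{G}_p$. Let $A_{p,q}^{s,\varphi}(\mathbb{R}^d)$ denote either $B_{p,q}^{s,\varphi}(\mathbb{R}^d)$ or $F_{p,q}^{s,\varphi}(\mathbb{R}^d)$; if it denotes $F_{p,q}^{s,\varphi}(\mathbb{R}^d)$ and $0<q<\infty$, assume in addition that there exist $\varepsilon_0>0$ and $c_0>0$ such that $t^{\varepsilon_0-d/p}\varphi(t)\le c_0\,r^{\varepsilon_0-d/p}\varphi(r)$ for all $t\ge r>0$. Then $$A_{p,q}^{s,\varphi}(\mathbb{R}^d)\hookrightarrow B_{\infty,\infty}^{s-\frac dp}(\mathbb{R}^d).$$ In particular, if $s>\frac dp$, then $A_{p,q}^{s,\varphi}(\mathbb{R}^d)\hookrightarrow\mathcal{C}^{s-\frac dp}(\mathbb{R}^d)$.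
   Context: $X\hookrightarrow Y$ means $X\subset Y$ with continuous natural embedding. $\mathcal{F}$ is the Fourier transform on $\mathcal{S}'(\mathbb{R}^d)$. Class $\mathcal{G}_p$: all nondecreasing $\varphi:(0,\infty)\to(0,\infty)$ such that $t^{-d/p}\varphi(t)\ge s^{-d/p}\varphi(s)$ for all $0<t\le s<\infty$. $\mathcal{Q}$ is the set of dyadic cubes $2^{-j}([0,1)^d+k)$, $j\in\mathbb{Z}$, $k\in\mathbb{Z}^d$; $\ell(P)$ is the side length of $P$; $j_P=-\log_2\ell(P)$; $j_P\vee0=\max(j_P,0)$. Resolution of unity: $\theta_0\in\mathcal{S}(\mathbb{R}^d)$ with $\theta_0(x)=1$ for $|x|\le1$ and $\theta_0(x)=0$ for $|x|\ge3/2$; $\theta_k(x)=\theta_0(2^{-k}x)-\theta_0(2^{-k+1}x)$, $k\in\mathbb{N}$. With $f_j=\mathcal{F}^{-1}(\theta_j\mathcal{F}f)$, the spaces consist of all $f\in\mathcal{S}'(\mathbb{R}^d)$ with finite quasi-norm (usual modification for $q=\infty$) $$\|f\mid B_{p,q}^{s,\varphi}(\mathbb{R}^d)\|=\sup_{P\in\mathcal{Q}}\frac1{\varphi(\ell(P))}\Big\{\sum_{j=j_P\vee0}^\infty\Big(\int_P|2^{js}f_j(x)|^p\,dx\Big)^{q/p}\Big\}^{1/q},$$ $$\|f\mid F_{p,q}^{s,\varphi}(\mathbb{R}^d)\|=\sup_{P\in\mathcal{Q}}\frac1{\varphi(\ell(P))}\Big\{\int_P\Big(\sum_{j=j_P\vee0}^\infty|2^{js}f_j(x)|^q\Big)^{p/q}dx\Big\}^{1/p}.$$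 The classical space $B^{\sigma}_{\infty,\infty}(\mathbb{R}^d)$, $\sigma\in\mathbb{R}$, consists of all $f\in\mathcal{S}'(\mathbb{R}^d)$ with $\sup_{j\in\mathbb{N}_0}2^{j\sigma}\|f_j\mid L^\infty(\mathbb{R}^d)\|<\infty$. For $\varkappa>0$, $\mathcal{C}^\varkappa(\mathbb{R}^d)$ denotes the Hölder-Zygmund space, which coincides with $B^\varkappa_{\infty,\infty}(\mathbb{R}^d)$ with equivalent norms. *)

(* Defs.v *)
From HB Require Import structures.
From mathcomp Require Import all_boot all_order all_algebra.
From mathcomp Require Import complex.
From mathcomp Require Import all_classical all_reals all_analysis.

Set Implicit Arguments.
Unset Strict Implicit.
Unset Printing Implicit Defensive.

Import Order.TTheory GRing.Theory Num.Theory.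
Import numFieldNormedType.Exports.

Local Open Scope classical_set_scope.
Local Open Scope ring_scope.
Local Open Scope complex_scope.

(* Vectors of R^d are elements of ['rV[R]_d], where the normed-space structure
   and the directional derivatives of the library live.  The product
   sigma-algebra of the library lives on [d.-tuple R], so Lebesgue measure is
   built there and transported through [row_of_tuple] below. *)

Section LebesgueMeasure.
Context {R : realType}.
Local Notation mR := (measurableTypeR R).

Definition tuple_cons n (x : mR * n.-tuple mR) : n.+1.-tuple mR :=
  [tuple of x.1 :: x.2].

Lemma measurable_tuple_cons n : measurable_fun [set: mR * n.-tuple mR]
  (@tuple_cons n).
Proof. exact: measurable_cons. Qed.

Section step.
Variables (n : nat) (m : {sigma_finite_measure set (n.-tuple mR) -> \bar R}).

Definition lebesgue_step : set (n.+1.-tuple mR) -> \bar R :=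
  pushforward (lebesgue_measure \x m)%E (@tuple_cons n).

Let step0 : lebesgue_step set0 = 0%E.
Proof. by rewrite /lebesgue_step /pushforward preimage_set0 measure0. Qed.

Let step_ge0 A : (0 <= lebesgue_step A)%E.
Proof. by rewrite /lebesgue_step /pushforward measure_ge0. Qed.

Let step_sigma_additive : semi_sigma_additive lebesgue_step.
Proof.
exact: (@measure_semi_sigma_additive _ _ _
  (measure_function_pushforward__canonical__measure_function_Measure
     (lebesgue_measure \x m)%E (@measurable_tuple_cons n))).
Qed.

HB.instance Definition _ := isMeasure.Build _ _ _ lebesgue_step
  step0 step_ge0 step_sigma_additive.

Let step_sigma_finite : sigma_finite setT lebesgue_step.
Proof.
have /sigma_finiteP[F [TF ndF Foo]] := sigma_finiteT (@lebesgue_measure R).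
have /sigma_finiteP[G [TG ndG Goo]] := sigma_finiteT m.
pose u (t : n.+1.-tuple mR) : mR * n.-tuple mR := (thead t, [tuple of behead t]).
have uK : cancel (@tuple_cons n) u.
  by move=> -[a t]; rewrite /u /tuple_cons/=; congr pair; exact: val_inj.
have Ku : cancel u (@tuple_cons n).
  by move=> t; rewrite /u /tuple_cons/= [in RHS](tuple_eta t).
have mu : measurable_fun setT u.
  apply/measurable_fun_pairP; split => /=.
    exact: measurable_tnth.
  exact: measurable_behead.
exists (fun k => u @^-1` (F k `*` G k)).
  rewrite -preimage_bigcup -(preimage_setT u) -setXTT TF TG; congr (u @^-1` _).
  rewrite predeqE => -[x y]; split=> [[/= [i _ Fx] [k _ Gy]]|[i _ []/= ? ?]].
    exists (maxn i k) => //; split => /=.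
    - by move: x Fx; exact/subsetPset/ndF/leq_maxl.
    - by move: y Gy; exact/subsetPset/ndG/leq_maxr.
  by split; exists i.
move=> k; have [mF Fk] := Foo k; have [mG Gk] := Goo k; split.
  by rewrite -[X in measurable X]setTI; apply: mu => //; exact: measurableX.
rewrite /lebesgue_step /pushforward -comp_preimage.
rewrite (_ : u \o _ = idfun); last by apply/funext => x /=; rewrite uK.
by rewrite preimage_id product_measure1E// lte_mul_pinfty// ge0_fin_numE.
Qed.

HB.instance Definition _ := Measure_isSigmaFinite.Build _ _ _ lebesgue_step
  step_sigma_finite.
End step.

Fixpoint lebesgue_tuple (n : nat) :
    {sigma_finite_measure set (n.-tuple mR) -> \bar R} :=
  if n is n'.+1 then lebesgue_step (lebesgue_tuple n')
  else dirac ([tuple] : 0.-tuple mR).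
End LebesgueMeasure.

Section Functions.
Context {R : realType} {d : nat}.
Local Notation Re := (@complex.Re R).
Local Notation Im := (@complex.Im R).
Local Notation normc := (@Normc.normc R).
Implicit Types (x y h : 'rV[R]_d) (g : 'rV[R]_d -> R[i]).

Definition dotv x y : R := \sum_(i < d) x 0 i * y 0 i.

(* The norm [`|x|] of the library on ['rV[R]_d] is the maximum norm. *)
Definition eucl x : R := Num.sqrt (dotv x x).

Definition row_of_tuple (t : d.-tuple (measurableTypeR R)) : 'rV[R]_d :=
  \row_i tnth t i.

Definition integral_rV (A : set 'rV[R]_d) (f : 'rV[R]_d -> \bar R) : \bar R :=
  (\int[lebesgue_tuple d]_(t in row_of_tuple @^-1` A) f (row_of_tuple t))%E.

Definition cintegrable g : Prop :=
  (lebesgue_tuple d).-integrable setT (fun t => (Re (g (row_of_tuple t)))%:E) /\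
  (lebesgue_tuple d).-integrable setT (fun t => (Im (g (row_of_tuple t)))%:E).

Definition cintegral g : R[i] :=
  fine (integral_rV setT (fun x => (Re (g x))%:E)) +i*
  fine (integral_rV setT (fun x => (Im (g x))%:E)).

Definition Linfty_norm g : \bar R :=
  Lnorm (lebesgue_tuple d) +oo%E (fun t => (normc (g (row_of_tuple t)))%:E).

Definition ccontinuous g : Prop :=
  continuous (fun x => Re (g x)) /\ continuous (fun x => Im (g x)).

Definition cderivable g x h : Prop :=
  derivable (fun y => Re (g y)) x h /\ derivable (fun y => Im (g y)) x h.

Definition partial (i : 'I_d) g : 'rV[R]_d -> R[i] := fun x =>
  'D_(delta_mx 0 i) (fun y => Re (g y)) x +i*
  'D_(delta_mx 0 i) (fun y => Im (g y)) x.

Definition partials (l : seq 'I_d) g : 'rV[R]_d -> R[i] := foldr partial g l.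

Definition smooth g : Prop := forall l : seq 'I_d,
  ccontinuous (partials l g) /\
  forall i x, cderivable (partials l g) x (delta_mx 0 i).

Definition schwartz_seminorm (N : nat) g : \bar R :=
  ereal_sup [set ((1 + eucl x) ^+ N * normc (partials l g x))%:E
            | x in setT & l in [set l : seq 'I_d | (size l <= N)%N]].

Definition schwartz g : Prop :=
  smooth g /\ forall N, (schwartz_seminorm N g < +oo)%E.

Definition cis (t : R) : R[i] := cos t +i* sin t.

Definition fourier g : 'rV[R]_d -> R[i] := fun xi =>
  ((2 * pi) `^ (- (d%:R / 2)))%:C * cintegral (fun x => cis (- dotv x xi) * g x).

Definition fourier_inv g : 'rV[R]_d -> R[i] := fun x =>
  ((2 * pi) `^ (- (d%:R / 2)))%:C * cintegral (fun xi => cis (dotv x xi) * g xi).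

(* A tempered distribution is a functional that is only meant to be evaluated
   on Schwartz functions; its values elsewhere are irrelevant. *)
Definition functional := ('rV[R]_d -> R[i]) -> R[i].
Implicit Types T : functional.

Definition tempered T : Prop :=
  (forall (a : R[i]) g1 g2, schwartz g1 -> schwartz g2 ->
     T (fun x => a * g1 x + g2 x) = a * T g1 + T g2) /\
  exists (N : nat) (C : R), forall g, schwartz g ->
    ((normc (T g))%:E <= C%:E * schwartz_seminorm N g)%E.

Definition dist_fourier T : functional := fun g => T (fourier g).
Definition dist_fourier_inv T : functional := fun g => T (fourier_inv g).
Definition dist_mul (m : 'rV[R]_d -> R[i]) T : functional :=
  fun g => T (fun x => m x * g x).

Definition dist_sub T1 T2 : functional := fun g => T1 g - T2 g.

Definition represents T (f : 'rV[R]_d -> R[i]) : Prop :=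
  ccontinuous f /\
  forall g, schwartz g -> cintegrable (fun x => f x * g x) /\
    T g = cintegral (fun x => f x * g x).

(* The continuous function representing [T], which is unique when it exists. *)
Definition dist_fun T : 'rV[R]_d -> R[i] := xget (fun=> 0) (represents T).

Definition resolution (theta0 : 'rV[R]_d -> R[i]) : Prop :=
  [/\ schwartz theta0,
      forall x, eucl x <= 1 -> theta0 x = 1 &
      forall x, 3 / 2 <= eucl x -> theta0 x = 0].

Definition theta (theta0 : 'rV[R]_d -> R[i]) (k : nat) : 'rV[R]_d -> R[i] :=
  if k is k'.+1 then
    fun x => theta0 (2 ^- k'.+1 *: x) - theta0 (2 ^- k' *: x)
  else theta0.

(* By the Paley-Wiener-Schwartz theorem the distribution
   F^-1 (theta_j F T) is a smooth function. *)
Definition block theta0 (j : nat) T : 'rV[R]_d -> R[i] :=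
  dist_fun (dist_fourier_inv (dist_mul (theta theta0 j) (dist_fourier T))).

Definition wblock theta0 (s : R) (j : nat) T x : R :=
  normc ((2 `^ (j%:R * s))%:C * block theta0 j T x).

Definition classG (p : R) (phi : R -> R) : Prop :=
  [/\ forall t, 0 < t -> 0 < phi t,
      forall t u, 0 < t -> t <= u -> phi t <= phi u &
      forall t u, 0 < t -> t <= u ->
        u `^ (- (d%:R / p)) * phi u <= t `^ (- (d%:R / p)) * phi t].

Definition side (j : int) : R := 2 ^ (- j).

Definition dyadic_cube (j : int) (k : 'rV[int]_d) : set 'rV[R]_d :=
  [set x | forall i, side j * (k 0 i)%:~R <= x 0 i < side j * ((k 0 i)%:~R + 1)].

(* [j_P \vee 0] for a cube [P] of side length [side j] *)
Definition start (j : int) : nat := `|Num.max j 0|%N.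

(* The l^q quasi-norm over the indices [j >= n]; only used for [0 < q]. *)
Definition lq_norm (q : \bar R) (n : nat) (a : nat -> \bar R) : \bar R :=
  match q with
  | q'%:E => ((\sum_(n <= j <oo) (a j `^ q')) `^ q'^-1)%E
  | +oo => ereal_sup [set a j | j in [set j | (n <= j)%N]]
  | -oo => 0
  end%E.

Definition Lp_norm (p : R) (A : set 'rV[R]_d) (f : 'rV[R]_d -> \bar R) : \bar R :=
  ((integral_rV A (fun x => `|f x| `^ p)) `^ p^-1)%E.

Definition morrey_sup (phi : R -> R)
    (N : int -> 'rV[int]_d -> \bar R) : \bar R :=
  ereal_sup [set ((phi (side j))^-1%:E * N j k)%E | j in setT & k in setT].

Definition besov_norm theta0 (s p : R) (q : \bar R) (phi : R -> R) T : \bar R :=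
  morrey_sup phi (fun j k =>
    lq_norm q (start j) (fun i =>
      Lp_norm p (dyadic_cube j k) (fun x => (wblock theta0 s i T x)%:E))).

Definition triebel_norm theta0 (s p : R) (q : \bar R) (phi : R -> R) T : \bar R :=
  morrey_sup phi (fun j k =>
    Lp_norm p (dyadic_cube j k) (fun x =>
      lq_norm q (start j) (fun i => (wblock theta0 s i T x)%:E))).

Definition besov_infty_norm theta0 (sigma : R) T : \bar R :=
  ereal_sup (range (fun j : nat =>
    (2 `^ (j%:R * sigma))%:E * Linfty_norm (block theta0 j T)))%E.

Definition diff h g : 'rV[R]_d -> R[i] := fun x => g (x + h) - g x.

(* Hoelder-Zygmund norm by differences; for [0 <= kappa], the order of the
   difference is the least integer greater than [kappa]. *)
Definition zygmund_fun_norm (kappa : R) g : \bar R :=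
  (ereal_sup (range (fun x => (normc (g x))%:E)) +
   ereal_sup [set (eucl h `^ (- kappa) *
                   normc (iter (Num.truncn kappa).+1 (diff h) g x))%:E
             | h in [set h | h != 0%R] & x in setT])%E.

(* The value is [+oo] unless [T] is given by a continuous function, which is
   then unique. *)
Definition zygmund_norm (kappa : R) T : \bar R :=
  ereal_inf [set zygmund_fun_norm kappa g | g in represents T].

(* The space attached to [N] consists of the tempered distributions of finite
   quasi-norm [N], topologised by [N]. *)
Definition in_space (N : functional -> \bar R) T : Prop :=
  tempered T /\ (N T < +oo)%E.

Definition embeds (N1 N2 : functional -> \bar R) : Prop :=
  (forall T, in_space N1 T -> in_space N2 T) /\
  forall T, in_space N1 T -> forall e : R, 0 < e -> exists2 de : R, 0 < de &
    forall S, in_space N1 S ->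
      (N1 (dist_sub S T) < de%:E)%E -> (N2 (dist_sub S T) < e%:E)%E.

End Functions.
Arguments classG {R} d p phi.

Inductive scale := BesovScale | TriebelScale.

Definition morrey_norm {R : realType} {d : nat} (A : scale) :
    ('rV[R]_d -> R[i]) -> R -> R -> \bar R -> (R -> R) -> functional -> \bar R :=
  match A with
  | BesovScale => besov_norm
  | TriebelScale => triebel_norm
  end.

(* Main.v *)
From HB Require Import structures.
Require Import Defs.
From mathcomp Require Import all_boot all_order all_algebra.
From mathcomp Require Import complex.
From mathcomp Require Import all_classical all_reals all_analysis.
From mathcomp Require Import measurable_realfun ess_sup_inf.
From mathcomp Require Import ring lra.

(** Each block of a tempered distribution [T] is a function: [block theta0 j T x]
    is [T] applied to the function [fun y => k (x - y)], where [k] is a multiple of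
    the inverse Fourier transform of [theta theta0 j], because [T] may be moved
    under the integral of a convolution ([pairing_integral],
    [represents_filtered]).  Since [theta0 (2^-(j+1) x)] is 1
    on the support of [theta theta0 j], Fourier inversion shows that the rescaled
    block [u x = block theta0 j T (2^-j x)] satisfies [u = L * u] with one Schwartz
    kernel [L] for all [j] and [T] ([unit_block_reproducing]).

    A continuous function of polynomial growth with [u = L * u] is bounded by a
    constant times the supremum over the unit cubes [Q] of
    [(int_Q |u|^p)^(1/p)], for every [p > 0] and with a constant that depends on
    [L], [p] and [d] only ([reproduced_bounded]).  To allow [p < 1] one writes
    [|u| = |u|^(1-r) |u|^r] under the integral with [r < 1], [r <= p], estimates
    the first factor by the supremum of [|u|] and integrates the second one, and
    then divides by the supremum.  Undoing the dilation turns the unit cubes into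
    the dyadic cubes [P] of side [2^-j].  For these the sums over the blocks in both
    quasi-norms start at the index [j], and keeping this single term gives
    [(int_P |2^(js) f_j|^p)^(1/p) <= phi (2^-j) N(T) <= phi 1 N(T)].  The result is
    [2^(j(s-d/p)) |f_j| <= C N(T)] for all [j] ([block_bounded]), which is the first
    embedding.

    Let [sigma = s - d/p] be positive.  Then the series of the blocks converges
    uniformly.  Its partial sums are [T] convolved with an approximate identity,
    because the resolution of unity telescopes, so its sum represents [T]
    ([tempered_approximation], [sum_represents]).  By Bernstein's inequality the
    [M]-th difference of [f_j] with step [h] is at most
    [(C 2^j |h|)^M sup |f_j|] ([block_bernstein]).  For [M > sigma] the sum of these
    bounds over [2^j |h| <= 1] is of order [|h|^sigma], and so is the sum of
    [sup |f_j|] over the other indices ([zygmund_sum_le]).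

    All estimates are linear in [N(T)] with constants that do not depend on [T];
    applied to differences of distributions they give the continuity of the
    embeddings ([embeds_of_bound]). *)

Set Implicit Arguments.
Unset Strict Implicit.
Unset Printing Implicit Defensive.

Import Order.TTheory GRing.Theory Num.Theory.
Import numFieldNormedType.Exports.

Local Open Scope classical_set_scope.
Local Open Scope ring_scope.
Local Open Scope complex_scope.

Local Notation normc := (@Normc.normc _).
Local Notation Re := (@complex.Re _).
Local Notation Im := (@complex.Im _).

(** * Modulus of complex numbers *)
Section ComplexModulus.
Context {R : realType}.
Implicit Types z : R[i].

Lemma normc_ge0 z : 0 <= normc z.
Proof. by case: z => a b; rewrite /normc sqrtr_ge0. Qed.

Lemma Re_le_normc z : `|Re z| <= normc z.
Proof.
case: z => a b /=; rewrite -sqrtr_sqr ler_wsqrtr// lerDl sqr_ge0//.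
Qed.

Lemma Im_le_normc z : `|Im z| <= normc z.
Proof.
case: z => a b /=; rewrite -sqrtr_sqr ler_wsqrtr// lerDr sqr_ge0//.
Qed.

Lemma normc_le_ReIm z : normc z <= `|Re z| + `|Im z|.
Proof.
case: z => a b /=; rewrite -[leRHS]ger0_norm ?addr_ge0// -sqrtr_sqr ler_wsqrtr//.
rewrite sqrrD !real_normK ?num_real// lerD2r lerDl mulrn_wge0// mulr_ge0//.
Qed.

Lemma normc_real (a : R) : normc a%:C = `|a|.
Proof. by rewrite /normc/= expr0n addr0 sqrtr_sqr. Qed.

Lemma normcB_sym z1 z2 : normc (z1 - z2) = normc (z2 - z1).
Proof. by rewrite -normcN opprB. Qed.

Lemma normc_cis (t : R) : normc (cis t) = 1.
Proof. by rewrite /cis /normc cos2Dsin2 sqrtr1. Qed.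

Lemma cReD z1 z2 : Re (z1 + z2) = Re z1 + Re z2.
Proof. by case: z1 z2 => a b [c e]. Qed.
Lemma cImD z1 z2 : Im (z1 + z2) = Im z1 + Im z2.
Proof. by case: z1 z2 => a b [c e]. Qed.
Lemma cReN z : Re (- z) = - Re z.
Proof. by case: z => a b. Qed.
Lemma cImN z : Im (- z) = - Im z.
Proof. by case: z => a b. Qed.
Lemma cReM z1 z2 : Re (z1 * z2) = Re z1 * Re z2 - Im z1 * Im z2.
Proof. by case: z1 z2 => a b [c e]. Qed.
Lemma cImM z1 z2 : Im (z1 * z2) = Re z1 * Im z2 + Im z1 * Re z2.
Proof. by case: z1 z2 => a b [c e]. Qed.

Lemma complex_ext z1 z2 : Re z1 = Re z2 -> Im z1 = Im z2 -> z1 = z2.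
Proof. by case: z1 z2 => a b [c e] /= -> ->. Qed.

Lemma cisD (a b : R) : cis (a + b) = cis a * cis b.
Proof.
apply: complex_ext; rewrite ?cReM ?cImM /= ?cosD ?sinD//.
by rewrite addrC mulrC [X in _ + X]mulrC addrC mulrC [X in _ + X]mulrC.
Qed.

Lemma cis0 : cis (0 : R) = 1.
Proof. by rewrite /cis cos0 sin0. Qed.

End ComplexModulus.

(** * Integrals of complex-valued functions *)
Section ComplexIntegral.
Context {R : realType} {dX : measure_display} {X : measurableType dX}.
Variable mu : {measure set X -> \bar R}.
Implicit Types (F G : X -> R[i]) (f g : X -> R).

Definition rintble (f : X -> R) := mu.-integrable setT (EFin \o f).
Definition rint (f : X -> R) : R := Rintegral mu setT f.
Definition cmeas F :=
  measurable_fun setT (fun x => Re (F x)) /\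
  measurable_fun setT (fun x => Im (F x)).
Definition cintble F :=
  rintble (fun x => Re (F x)) /\ rintble (fun x => Im (F x)).
Definition cint F : R[i] :=
  rint (fun x => Re (F x)) +i* rint (fun x => Im (F x)).

Lemma rintble_meas f : rintble f -> measurable_fun setT f.
Proof. by move=> /integrableP[/measurable_EFinP]. Qed.

Lemma rintble_le f g : measurable_fun setT f -> (forall x, `|f x| <= g x) ->
  rintble g -> rintble f.
Proof.
move=> mf fg; apply: le_integrable => //; first exact/measurable_EFinP.
by move=> x _; rewrite /= lee_fin (le_trans (fg x))// ler_norm.
Qed.

Lemma rintbleD f g : rintble f -> rintble g -> rintble (fun x => f x + g x).
Proof. by move=> hf hg; have := integrableD measurableT hf hg. Qed.

Lemma rintbleB f g : rintble f -> rintble g -> rintble (fun x => f x - g x).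
Proof. by move=> hf hg; have := integrableB measurableT hf hg. Qed.

Lemma rintbleZ (k : R) f : rintble f -> rintble (fun x => k * f x).
Proof. by move=> hf; have := integrableZl measurableT k hf. Qed.

Lemma rintD f g : rintble f -> rintble g ->
  rint (fun x => f x + g x) = rint f + rint g.
Proof. by move=> hf hg; rewrite /rint -RintegralD. Qed.

Lemma rintB f g : rintble f -> rintble g ->
  rint (fun x => f x - g x) = rint f - rint g.
Proof. by move=> hf hg; rewrite /rint -RintegralB. Qed.

Lemma rintZ (k : R) f : rintble f -> rint (fun x => k * f x) = k * rint f.
Proof. by move=> hf; rewrite /rint RintegralZl. Qed.

Lemma rint0 : rint (fun=> 0) = 0.
Proof. by rewrite /rint /Rintegral integral0. Qed.

Lemma rint_ge0 f : (forall x, 0 <= f x) -> 0 <= rint f.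
Proof. by move=> f0; apply: Rintegral_ge0. Qed.

Lemma rint_le f g : rintble f -> rintble g -> (forall x, f x <= g x) ->
  rint f <= rint g.
Proof. by move=> hf hg fg; apply: le_Rintegral. Qed.

Lemma rintE f : rintble f -> (rint f)%:E = (\int[mu]_x (f x)%:E)%E.
Proof. by move=> hf; rewrite /rint /Rintegral fineK// integrable_fin_num. Qed.

Lemma cmeasM F G : cmeas F -> cmeas G -> cmeas (fun x => F x * G x).
Proof.
move=> [a b] [c e]; split.
  under eq_fun do rewrite cReM.
  by apply: measurable_funB; apply: measurable_funM.
under eq_fun do rewrite cImM.
by apply: measurable_funD; apply: measurable_funM.
Qed.

Lemma cmeas_cst (z : R[i]) : cmeas (fun=> z).
Proof. by split; exact: measurable_cst. Qed.

Lemma cmeas_real (f : X -> R) : measurable_fun setT f -> cmeas (fun x => (f x)%:C).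
Proof. by move=> mf; split => //=; exact: measurable_cst. Qed.

Lemma cmeas_normc F : cmeas F -> measurable_fun setT (fun x => normc (F x)).
Proof.
move=> [mr mi].
have -> : (fun x => normc (F x)) =
    Num.sqrt \o (fun x => Re (F x) ^+ 2 + Im (F x) ^+ 2).
  by apply/funext => x /=; case: (F x).
apply: measurableT_comp.
  by apply: continuous_measurable_fun; exact: sqrt_continuous.
by apply: measurable_funD; apply: measurable_funX.
Qed.

Lemma cintble_meas F : cintble F -> cmeas F.
Proof. by move=> [/rintble_meas mr /rintble_meas mi]. Qed.

Lemma cintble_le F g : cmeas F -> (forall x, normc (F x) <= g x) ->
  rintble g -> cintble F.
Proof.
move=> [mr mi] Fg hg; split; apply: rintble_le hg => // x.
  exact: le_trans (Re_le_normc _) _.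
exact: le_trans (Im_le_normc _) _.
Qed.

Lemma cintble_normc F : cintble F -> rintble (fun x => normc (F x)).
Proof.
move=> hF; have [[mr mi] [hr hi]] := (cintble_meas hF, hF).
apply: (@rintble_le _ (fun x => `|Re (F x)| + `|Im (F x)|)).
- exact/cmeas_normc/cintble_meas.
- by move=> x; rewrite ger0_norm ?normc_ge0// normc_le_ReIm.
- by apply: rintbleD; apply: integrable_norm.
Qed.

Lemma cintbleD F G : cintble F -> cintble G -> cintble (fun x => F x + G x).
Proof.
move=> [a b] [c e]; split.
  under eq_fun do rewrite cReD; exact: rintbleD.
under eq_fun do rewrite cImD; exact: rintbleD.
Qed.

Lemma cintbleZ (z : R[i]) F : cintble F -> cintble (fun x => z * F x).
Proof.
move=> [a b]; split.
  by under eq_fun do rewrite cReM; apply: rintbleB; apply: rintbleZ.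
by under eq_fun do rewrite cImM; apply: rintbleD; apply: rintbleZ.
Qed.

Lemma cintbleB F G : cintble F -> cintble G -> cintble (fun x => F x - G x).
Proof.
move=> hF hG; under eq_fun do rewrite -mulN1r.
by apply: cintbleD => //; exact: cintbleZ.
Qed.

Lemma cintD F G : cintble F -> cintble G ->
  cint (fun x => F x + G x) = cint F + cint G.
Proof.
move=> [a b] [c e]; apply: complex_ext; rewrite ?cReD ?cImD /=.
  by rewrite -rintD//; congr rint; apply/funext => x; rewrite cReD.
by rewrite -rintD//; congr rint; apply/funext => x; rewrite cImD.
Qed.

Lemma cintZ (z : R[i]) F : cintble F -> cint (fun x => z * F x) = z * cint F.
Proof.
move=> [a b]; apply: complex_ext; rewrite ?cReM ?cImM /=.
  rewrite -!rintZ// -rintB; [|exact: rintbleZ..].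
  by congr rint; apply/funext => x; rewrite cReM.
rewrite -!rintZ// -rintD; [|exact: rintbleZ..].
by congr rint; apply/funext => x; rewrite cImM.
Qed.

Lemma cintB F G : cintble F -> cintble G ->
  cint (fun x => F x - G x) = cint F - cint G.
Proof.
move=> hF hG; under [in LHS]eq_fun do rewrite -mulN1r.
by rewrite cintD ?cintZ ?mulN1r//; exact: cintbleZ.
Qed.

(** Multiplying by the conjugate of the integral makes it a nonnegative real,
    so the real inequality applies. *)
Lemma normc_cint_le F g : cintble F -> rintble g ->
  (forall x, normc (F x) <= g x) -> normc (cint F) <= rint g.
Proof.
move=> hF hg Fg.
have g0 : 0 <= rint g by apply: rint_ge0 => x; exact: le_trans (normc_ge0 _) (Fg x).
set z := cint F.
have [->|z0] := eqVneq (normc z) 0; first exact: g0.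
have zp : 0 < normc z by rewrite lt_neqAle eq_sym z0 normc_ge0.
have e1 : Re (z^* * z) = normc z ^+ 2.
  rewrite /z; case: (cint F) => a b; rewrite cReM /= sqr_sqrtr ?addr_ge0 ?sqr_ge0//.
  by rewrite !expr2 mulNr opprK.
have nJ : normc (z^*) = normc z.
  by case: (z) => a b /=; rewrite sqrrN.
have e2 : Re (z^* * z) = rint (fun x => Re (z^* * F x)).
  by rewrite -cintZ.
have : normc z ^+ 2 <= rint (fun x => normc z * g x).
  rewrite -e1 e2; apply: rint_le.
  - by have [] := cintbleZ (z^*) hF.
  - exact: rintbleZ.
  - move=> x; rewrite (le_trans (ler_norm _))// (le_trans (Re_le_normc _))//.
    by rewrite Normc.normcM nJ ler_wpM2l// normc_ge0.
by rewrite rintZ// expr2 ler_pM2l.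
Qed.

Lemma eq_cint F G : F =1 G -> cint F = cint G.
Proof. by move=> /funext ->. Qed.

End ComplexIntegral.
Arguments cmeas {R dX X} F.

Section ComplexFubini.
Context {R : realType} {d1 d2 : measure_display}.
Context {X : measurableType d1} {Y : measurableType d2}.
Variables (mu : {sigma_finite_measure set X -> \bar R}).
Variables (nu : {sigma_finite_measure set Y -> \bar R}).

Lemma rintble_prod (f : X * Y -> R) (a : X -> R) (b : Y -> R) :
  measurable_fun setT f -> rintble mu a -> rintble nu b ->
  (forall x, 0 <= a x) -> (forall y, 0 <= b y) ->
  (forall x y, `|f (x, y)| <= a x * b y) ->
  rintble (mu \x nu)%E f.
Proof.
move=> mf ha hb a0 b0 fab.
have mfE : measurable_fun setT (EFin \o f) by exact/measurable_EFinP.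
have mfA : measurable_fun setT (fun z => `|(f z)%:E|%E).
  by apply: (measurableT_comp _ mfE); exact: abse_measurable.
apply/integrableP; split => //.
rewrite fubini_tonelli1//=.
rewrite /fubini_F /=.
apply: (@le_lt_trans _ _ (\int[mu]_x ((rint nu b)%:E * (a x)%:E))%E).
  apply: ge0_le_integral => //.
  - by move=> x _; apply: integral_ge0 => y _.
  - by have := @measurable_fun_fubini_tonelli_F _ _ _ _ _ nu (fun z => `|(f z)%:E|%E); exact.
  - by apply: measurable_funeM; apply/measurable_EFinP; exact: rintble_meas ha.
  - move=> x _; rewrite rintE// muleC -ge0_integralZl//=.
    + apply: ge0_le_integral => //.
      * apply/measurable_EFinP; apply: measurableT_comp => //.
        exact: (measurableT_comp mf (@pair1_measurable _ _ X Y x)).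
      * by apply: measurable_funeM; apply/measurable_EFinP; exact: rintble_meas hb.
      * by move=> y _; rewrite -EFinM lee_fin.
    + by apply/measurable_EFinP; exact: rintble_meas hb.
    + by move=> y _; rewrite lee_fin.
    + by rewrite lee_fin.
have h : rintble mu (fun x => rint nu b * a x) by exact: rintbleZ.
by have := ltry (rint mu (fun x => rint nu b * a x)); rewrite (rintE h).
Qed.

Lemma rFubini (f : X * Y -> R) : rintble (mu \x nu)%E f ->
  (forall x, rintble nu (fun y => f (x, y))) ->
  (forall y, rintble mu (fun x => f (x, y))) ->
  rint mu (fun x => rint nu (fun y => f (x, y))) =
  rint nu (fun y => rint mu (fun x => f (x, y))).
Proof.
move=> hf hx hy; have := Fubini hf; rewrite /rint /Rintegral => e.
congr fine; transitivity (\int[mu]_x \int[nu]_y (f (x, y))%:E)%E.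
  by apply: eq_integral => x _; rewrite fineK// integrable_fin_num//; exact: hx.
rewrite e; apply: eq_integral => y _.
by rewrite fineK// integrable_fin_num//; exact: hy.
Qed.

Lemma rint_prod (f : X * Y -> R) : rintble (mu \x nu)%E f ->
  (forall x, rintble nu (fun y => f (x, y))) ->
  rint (mu \x nu)%E f = rint mu (fun x => rint nu (fun y => f (x, y))).
Proof.
move=> hf hx; rewrite /rint /Rintegral; congr fine.
rewrite -(integral12_prod_meas1 hf); apply: eq_integral => x _.
by rewrite fineK// integrable_fin_num//; exact: hx.
Qed.

(** The majorant is bounded by a tensor product at every point, so that all
    iterated integrals exist everywhere and no null sets have to be carried
    along. *)
Section dominated.
Variables (F : X * Y -> R[i]) (a : X -> R) (b : Y -> R).
Hypotheses (mF : cmeas F) (ha : rintble mu a) (hb : rintble nu b).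
Hypothesis Fab : forall x y, normc (F (x, y)) <= a x * b y.
Hypotheses (a0 : forall x, 0 <= a x) (b0 : forall y, 0 <= b y).

Lemma cintble_dom : cintble (mu \x nu)%E F.
Proof.
split; apply: (@rintble_prod _ a b); rewrite ?(proj1 mF) ?(proj2 mF)//.
- by have [] := mF.
- by move=> x y; exact: le_trans (Re_le_normc _) _.
- by have [] := mF.
- by move=> x y; exact: le_trans (Im_le_normc _) _.
Qed.

Lemma cintble_dom1 x : cintble nu (fun y => F (x, y)).
Proof.
apply: (@cintble_le _ _ _ nu _ (fun y => a x * b y)) => //;
  last exact: (rintbleZ (a x) hb).
have [mr mi] := mF; split.
  exact: (measurableT_comp mr (@pair1_measurable _ _ X Y x)).
exact: (measurableT_comp mi (@pair1_measurable _ _ X Y x)).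
Qed.

Lemma cintble_dom2 y : cintble mu (fun x => F (x, y)).
Proof.
apply: (@cintble_le _ _ _ mu _ (fun x => b y * a x)) => //;
  last exact: (rintbleZ (b y) ha).
  have [mr mi] := mF; split.
    exact: (measurableT_comp mr (@pair2_measurable _ _ X Y y)).
  exact: (measurableT_comp mi (@pair2_measurable _ _ X Y y)).
by move=> x; rewrite mulrC.
Qed.

Lemma cFubini : cint mu (fun x => cint nu (fun y => F (x, y))) =
                cint nu (fun y => cint mu (fun x => F (x, y))).
Proof.
have [hr hi] := cintble_dom; apply: complex_ext;
  [apply: (@rFubini (fun z => Re (F z)))|apply: (@rFubini (fun z => Im (F z)))] => //.
- by move=> x; have [] := cintble_dom1 x.
- by move=> y; have [] := cintble_dom2 y.
- by move=> x; have [] := cintble_dom1 x.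
- by move=> y; have [] := cintble_dom2 y.
Qed.

Lemma cint_prod :
  cint (mu \x nu)%E F = cint mu (fun x => cint nu (fun y => F (x, y))).
Proof.
have [hr hi] := cintble_dom; apply: complex_ext;
  [apply: (@rint_prod (fun z => Re (F z)))|apply: (@rint_prod (fun z => Im (F z)))] => //.
- by move=> x; have [] := cintble_dom1 x.
- by move=> x; have [] := cintble_dom1 x.
Qed.
End dominated.

End ComplexFubini.

(** * Measurability on R^d *)
Section CountableMeasurability.
Context {R : realType} {d : nat}.
Context {dX : measure_display} {X : measurableType dX}.

Definition floorv (e : R) (x : 'rV[R]_d) : 'rV[int]_d :=
  \row_i Num.floor (x 0 i / e).

(** A map into [R^d] is treated as measurable when its coordinates are. *)
Definition coordmeas (v : X -> 'rV[R]_d) :=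
  forall i, measurable_fun setT (fun x => v x 0 i : R).

Lemma measurable_floorv e v k : coordmeas v ->
  measurable [set x | floorv e (v x) = k].
Proof.
move=> mv.
have -> : [set x | floorv e (v x) = k] = \bigcap_(i in [set: 'I_d])
    [set x | (k 0 i)%:~R <= v x 0 i / e < (k 0 i + 1)%:~R].
  apply/seteqP; split => x /=.
    by move=> <- i _ /=; rewrite mxE; exact: floor_itv.
  move=> h; apply/rowP => i; rewrite mxE; apply/eqP.
  by rewrite floor_eq; exact: (h i I).
apply: fin_bigcap_measurable => // i _.
have mi : measurable_fun setT (fun x => v x 0 i / e : R).
  by apply: measurable_funM => //; exact: mv.
have -> : [set x | (k 0 i)%:~R <= v x 0 i / e < (k 0 i + 1)%:~R] =
   setT `&` (fun x => v x 0 i / e : R) @^-1`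
     [set` `[((k 0 i)%:~R : R), (k 0 i + 1)%:~R[].
  by rewrite setTI; apply/seteqP; split => x /=; rewrite in_itv.
exact: mi.
Qed.

(** A function of the cube containing a point takes countably many values, each
    on a measurable set. *)
Lemma measurable_fun_floorv e v dY (Y : measurableType dY)
    (G : 'rV[int]_d -> Y) : coordmeas v ->
  measurable_fun setT (fun x => G (floorv e (v x))).
Proof.
move=> mv _ A mA; rewrite setTI.
have -> : (fun x => G (floorv e (v x))) @^-1` A =
   \bigcup_n [set x | exists2 k, unpickle n = Some k /\ A (G k)
                               & floorv e (v x) = k].
  apply/seteqP; split => x /=.
    move=> Ax; exists (pickle (floorv e (v x))) => //=.
    by exists (floorv e (v x)) => //; rewrite pickleK.
  by move=> [n _] /= [k [_ Ak] ->].
apply: bigcup_measurable => n _.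
case un : (@unpickle 'rV[int]_d n) => [k|]; last first.
  rewrite (_ : [set x | _] = set0)//.
  by apply/seteqP; split => x //= [k []].
have [Ak|nAk] := pselect (A (G k)).
  rewrite (_ : [set x | _] = [set x | floorv e (v x) = k]).
    exact: measurable_floorv.
  apply/seteqP; split => x /=; first by move=> [_ [[<-] _]].
  by move=> kx; exists k.
rewrite (_ : [set x | _] = set0)//.
by apply/seteqP; split => x //= [k' [[<-] //]].
Qed.

Lemma floorv_cvg (y : 'rV[R]_d) :
  (n.+1%:R^-1 *: (map_mx (fun z => z%:~R) (floorv n.+1%:R^-1 y)))
    @[n --> \oo] --> y.
Proof.
apply/cvgrPdist_le => e e0.
near=> n.
rewrite [leLHS]/Num.norm/= mx_normrE; apply: bigmax_le => [|[i j] _]; first exact: ltW.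
rewrite !ord1 !mxE invrK.
have n0 : 0 < n.+1%:R :> R by rewrite ltr0n.
have /andP[h1 h2] := floor_itv (y 0 j * n.+1%:R).
have -> : y 0 j - n.+1%:R^-1 * (Num.floor (y 0 j * n.+1%:R))%:~R =
  (y 0 j * n.+1%:R - (Num.floor (y 0 j * n.+1%:R))%:~R) / n.+1%:R.
  by rewrite mulrBl mulfK ?gt_eqF// mulrC.
rewrite ger0_norm; last by rewrite divr_ge0 ?subr_ge0// ltW.
apply: ltW; rewrite ltr_pdivrMr//.
rewrite (@lt_le_trans _ _ 1)//; first by move: h2; rewrite intrD; lra.
rewrite mulrC -ler_pdivrMr// div1r.
have : e^-1 <= n%:R by near: n; exact: nbhs_infty_ger.
by move=> /le_trans; apply; rewrite ler_nat.
Unshelve. all: by end_near. Qed.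

(** A continuous function is the pointwise limit of the functions obtained by
    moving the argument to the corner of its cube of side [1 / n.+1], which take
    countably many values. *)
Lemma measurable_continuous v (f : 'rV[R]_d -> R) : coordmeas v ->
  continuous f -> measurable_fun setT (fun x => f (v x)).
Proof.
move=> mv cf.
apply: (@measurable_fun_cvg _ _ _ setT (fun n x =>
   f (n.+1%:R^-1 *: (map_mx (fun z => z%:~R) (floorv n.+1%:R^-1 (v x)))))).
  move=> m; exact: (@measurable_fun_floorv m.+1%:R^-1 v _ _
    (fun k => f (m.+1%:R^-1 *: (map_mx (fun z => z%:~R) k)))).
move=> x _; apply: (@cvg_comp _ _ _ _ f _ (nbhs (v x))).
  exact: floorv_cvg.
exact: cf.
Qed.

Lemma cmeas_ccontinuous v (g : 'rV[R]_d -> R[i]) : coordmeas v ->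
  ccontinuous g -> cmeas (fun x => g (v x)).
Proof.
move=> mv [cr ci]; split.
  exact: (@measurable_continuous v (fun y => Re (g y))).
exact: (@measurable_continuous v (fun y => Im (g y))).
Qed.

End CountableMeasurability.

(** * Affine changes of variables *)
Section AffineChange.
Context {R : realType}.
Local Notation mR := (measurableTypeR R).
Local Notation leb := (@lebesgue_measure R).

Definition aff1 (a b : R) : mR -> mR := fun x => a * x + b.

Lemma measurable_aff1 a b : measurable_fun [set: mR] (aff1 a b).
Proof.
apply: measurable_funD => //; apply: measurable_funM => //.
Qed.

(** Both sides are measures in [A]; they agree on half-open intervals. *)
Lemma lebesgue_aff1 a b (A : set mR) : a != 0 -> measurable A ->
  leb A = (`|a|%:E * leb (aff1 a b @^-1` A))%E.
Proof.
move=> a0 mA.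
have na : 0 <= `|a| by [].
have mph : measurable_fun [set: mR] (aff1 a b) by exact: measurable_aff1.
pose k : {nonneg R} := NngNum na.
pose m := mscale k (measure_function_pushforward__canonical__measure_function_Measure
  leb mph).
apply: (@lebesgue_measure_unique R m) mA => _ [[c e]] _ <-.
change (leb `]c, e]%classic = `|a|%:E * leb (aff1 a b @^-1` `]c, e]%classic))%E.
have pre : aff1 a b @^-1` `]c, e] = if 0 < a then `](c - b) / a, (e - b) / a]%classic
     else `[(e - b) / a, (c - b) / a[%classic.
  apply/seteqP; case: ltP => ap; split => x /=; rewrite /aff1 !in_itv/=.
  - by rewrite ltr_pdivrMr// ler_pdivlMr// => /andP[? ?]; apply/andP; split; lra.
  - by rewrite ltr_pdivrMr// ler_pdivlMr// => /andP[? ?]; apply/andP; split; lra.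
  - rewrite ltr_ndivlMr ?ler_ndivrMr ?lt_neqAle ?a0//.
    by move=> /andP[? ?]; apply/andP; split; lra.
  - rewrite ltr_ndivlMr ?ler_ndivrMr ?lt_neqAle ?a0//.
    by move=> /andP[? ?]; apply/andP; split; lra.
rewrite pre; case: ltP => ap; rewrite !lebesgue_measure_itv/= !lte_fin.
  rewrite ltr_pM2r ?invr_gt0// ltrD2r gtr0_norm//; case: ifPn => _.
    by rewrite -EFinM; congr (_%:E); field.
  by rewrite mule0.
have an : a < 0 by rewrite lt_neqAle a0.
rewrite ltr_nM2r ?invr_lt0// ltrD2r ltr0_norm//; case: ifPn => _.
  by rewrite -EFinM; congr (_%:E); field.
by rewrite mule0.
Qed.

Local Open Scope ereal_scope.

Lemma ge0_integral_aff1 a b (f : mR -> \bar R) : a != 0%R ->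
  measurable_fun setT f -> (forall x, 0 <= f x) ->
  \int[leb]_x f x = `|a|%:E * \int[leb]_x f (aff1 a b x).
Proof.
move=> a0 mf f0; have na : (0 <= `|a|)%R by [].
have mph : measurable_fun [set: mR] (aff1 a b) by exact: measurable_aff1.
pose k : {nonneg R} := NngNum na.
pose m := measure_function_pushforward__canonical__measure_function_Measure
  leb mph.
transitivity (\int[mscale k m]_x f x).
  by apply: eq_measure_integral => A mA _; exact: lebesgue_aff1.
rewrite ge0_integral_mscale//; congr (_ * _).
by rewrite ge0_integral_pushforward.
Qed.

Lemma ge0_integral_lebesgue_step n (m : {sigma_finite_measure set (n.-tuple mR) -> \bar R})
   (f : n.+1.-tuple mR -> \bar R) :
  measurable_fun setT f -> (forall t, 0 <= f t) ->
  \int[lebesgue_step m]_t f t = \int[leb]_x \int[m]_t f (tuple_cons (x, t)).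
Proof.
move=> mf f0; rewrite ge0_integral_pushforward//; last exact: measurable_tuple_cons.
rewrite preimage_setT fubini_tonelli1//.
  exact: (measurableT_comp mf (@measurable_tuple_cons R n)).
by move=> z /=.
Qed.

Definition aff n (a : R) (b : 'I_n -> R) (t : n.-tuple mR) : n.-tuple mR :=
  [tuple (a * tnth t i + b i)%R | i < n].

Lemma measurable_aff n a (b : 'I_n -> R) : measurable_fun setT (aff a b).
Proof.
apply/measurable_fun_tnthP => i.
rewrite (_ : _ \o _ = aff1 a (b i) \o (@tnth n mR ^~ i)); last first.
  by apply/funext => t /=; rewrite tnth_mktuple.
exact: (measurableT_comp (measurable_aff1 _ _) (measurable_tnth _)).
Qed.

(** Induction on the dimension, by the one-dimensional case and Tonelli. *)
Lemma ge0_integral_aff n a (b : 'I_n -> R) (f : n.-tuple mR -> \bar R) : a != 0%R ->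
  measurable_fun setT f -> (forall t, 0 <= f t) ->
  \int[lebesgue_tuple n]_t f t =
  (`|a| ^+ n)%:E * \int[lebesgue_tuple n]_t f (aff a b t).
Proof.
move=> a0; elim: n b f => [|n IH] b f mf f0.
  rewrite expr0 mul1e; apply: eq_integral => t _; congr f.
  by apply/val_inj => /=; case: t => -[]//= ?; rewrite enum_ord0.
have mg : measurable_fun setT (f \o aff a b).
  exact: (measurableT_comp mf (measurable_aff _ _)).
rewrite /= ge0_integral_lebesgue_step// ge0_integral_lebesgue_step//.
pose b' i := b (lift ord0 i).
have consE x t : aff a b (tuple_cons (x, t)) = tuple_cons (aff1 a (b ord0) x, aff a b' t).
  apply: eq_from_tnth => i; rewrite tnth_mktuple.
  by case: (unliftP ord0 i) => [j|] ->; rewrite ?tnth0 // !tnthS tnth_mktuple.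
have msec x : measurable_fun setT (fun t => f (tuple_cons (x, t))).
  exact: (measurableT_comp mf (measurableT_comp (@measurable_tuple_cons R n)
     (@pair1_measurable _ _ mR _ x))).
transitivity (\int[leb]_x ((`|a| ^+ n)%:E * \int[lebesgue_tuple n]_t
    f (tuple_cons (x, aff a b' t)))).
  by apply: eq_integral => x _; rewrite -(IH b' (fun t => f (tuple_cons (x, t)))).
pose H (x : mR) := \int[lebesgue_tuple n]_t f (tuple_cons (x, aff a b' t)).
have mH : measurable_fun setT H.
  apply: (@measurable_fun_fubini_tonelli_F _ _ mR _ _ (lebesgue_tuple n)
     (fun z => f (tuple_cons (z.1, aff a b' z.2)))) => //.
  pose ph (z : mR * n.-tuple mR) := (z.1, aff a b' z.2).
  have mph : measurable_fun setT ph.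
    apply/measurable_fun_pairP; split => //=.
      exact: (@measurable_fst _ _ mR (n.-tuple mR)).
    exact: (measurableT_comp (measurable_aff a b')
      (@measurable_snd _ _ mR (n.-tuple mR))).
  exact: (measurableT_comp mf (measurableT_comp (@measurable_tuple_cons R n) mph)).
have H0 x : 0 <= H x by apply: integral_ge0.
rewrite ge0_integralZl ?lee_fin ?exprn_ge0//.
rewrite (@ge0_integral_aff1 a (b ord0) H)// exprS EFinM muleA [X in X * _ = _]muleC.
congr (_ * _); apply: eq_integral => x _; rewrite /H.
by apply: eq_integral => t _; rewrite consE.
by move=> x _; exact: H0.
Qed.

End AffineChange.

(** * Integrals of tensor products *)
Section ProductIntegral.
Context {R : realType}.
Local Notation mR := (measurableTypeR R).
Local Notation leb := (@lebesgue_measure R).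

Lemma cint_lebesgue_step n
    (m : {sigma_finite_measure set (n.-tuple mR) -> \bar R})
    (F : n.+1.-tuple mR -> R[i]) : cmeas F ->
  cintble (leb \x m)%E (F \o @tuple_cons R n) ->
  cintble (lebesgue_step m) F /\
  cint (lebesgue_step m) F = cint (leb \x m)%E (F \o @tuple_cons R n).
Proof.
move=> [mr mi] [hr hi]; have mc := @measurable_tuple_cons R n.
have mrE : measurable_fun setT (EFin \o (fun x => Re (F x))) by apply/measurable_EFinP.
have miE : measurable_fun setT (EFin \o (fun x => Im (F x))) by apply/measurable_EFinP.
split; first by split; apply: integrable_pushforward.
by apply: complex_ext; rewrite /cint/= /rint /Rintegral; congr fine;
  rewrite integral_pushforward.
Qed.

Lemma cmeas_prod dX (X : measurableType dX) (I : Type) (s : seq I)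
  (F : I -> X -> R[i]) :
  (forall i, cmeas (F i)) -> cmeas (fun x => \prod_(i <- s) F i x).
Proof.
move=> mF; elim: s => [|i s IH].
  by under eq_fun do rewrite big_nil; exact: cmeas_cst.
by under eq_fun do rewrite big_cons; exact: cmeasM.
Qed.

Lemma cmeas_comp dX (X : measurableType dX) dY (Y : measurableType dY)
  (F : Y -> R[i]) (h : X -> Y) :
  cmeas F -> measurable_fun setT h -> cmeas (F \o h).
Proof.
by move=> [mr mi] mh; split; [exact: (measurableT_comp mr mh)|
  exact: (measurableT_comp mi mh)].
Qed.

(** Fubini, one coordinate at a time. *)
Lemma cint_prodE n (g : 'I_n -> R -> R[i]) :
  (forall i, cintble leb (g i)) ->
  cintble (lebesgue_tuple n) (fun t => \prod_i g i (tnth t i)) /\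
  cint (lebesgue_tuple n) (fun t => \prod_i g i (tnth t i)) =
    \prod_i cint leb (g i).
Proof.
elim: n g => [|n IH] g hg.
  have -> : (fun t : 0.-tuple mR => \prod_(i < 0) g i (tnth t i)) = cst 1.
    by apply/funext => t; rewrite big_ord0.
  rewrite big_ord0; split.
    by split; apply: finite_measure_integrable_cst => //=; rewrite diracT ltry.
  apply: complex_ext; rewrite /cint /= /rint Rintegral_cst//= ?diracT ?mul1r ?mul0r//.
  by rewrite indicT.
pose g' i := g (lift ord0 i).
have [hI eI] := IH g' (fun i => hg _).
pose P (t : n.-tuple mR) := \prod_i g' i (tnth t i).
pose F (z : mR * n.-tuple mR) := g ord0 z.1 * P z.2.
have FE : (fun t : n.+1.-tuple mR => \prod_i g i (tnth t i)) \o @tuple_cons R n = F.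
  apply/funext => -[x t] /=; rewrite big_ord_recl tnth0/=; congr (_ * _).
  by apply: eq_bigr => i _; rewrite tnthS.
have mg i : cmeas (g i) by exact: cintble_meas (hg i).
have mt : cmeas (fun t : n.+1.-tuple mR => \prod_i g i (tnth t i)).
  by apply: cmeas_prod => i; exact: (cmeas_comp (mg i) (measurable_tnth i)).
have mP : cmeas P.
  by apply: cmeas_prod => i; exact: (cmeas_comp (mg _) (measurable_tnth i)).
have mF : cmeas F by rewrite -FE; exact: cmeas_comp mt (@measurable_tuple_cons R n).
have i1 := cintble_normc (hg ord0); have i2 := cintble_normc hI.
have Fab x t : normc (F (x, t)) <= normc (g ord0 x) * normc (P t).
  by rewrite /F /= Normc.normcM.
have hF : cintble (leb \x lebesgue_tuple n)%E F.
  by apply: (cintble_dom mF i1 i2 Fab) => ?; exact: normc_ge0.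
have [h1 h2] := @cint_lebesgue_step n (lebesgue_tuple n) _ mt
  (eq_ind_r (fun G => cintble _ G) hF FE).
split; first exact: h1.
rewrite [LHS]h2 FE (cint_prod mF i1 i2 Fab); do ?by move=> ?; exact: normc_ge0.
rewrite big_ord_recl -eI /=.
transitivity (cint leb (fun x => cint (lebesgue_tuple n) P * g ord0 x)).
  by apply: eq_cint => x; rewrite /F /= cintZ// mulrC.
by rewrite cintZ// mulrC.
Qed.

Lemma rint_prodE n (g : 'I_n -> R -> R) :
  (forall i, rintble leb (g i)) ->
  rintble (lebesgue_tuple n) (fun t => \prod_i g i (tnth t i)) /\
  rint (lebesgue_tuple n) (fun t => \prod_i g i (tnth t i)) =
    \prod_i rint leb (g i).
Proof.
move=> hg.
have hc i : cintble leb (fun x => (g i x)%:C).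
  by split; [exact: hg|exact: integrable0].
have ec i : cint leb (fun x => (g i x)%:C) = (rint leb (g i))%:C.
  by apply: complex_ext => //=; rewrite rint0.
have e (t : n.-tuple mR) : \prod_i (g i (tnth t i))%:C = (\prod_i g i (tnth t i))%:C.
  by rewrite rmorph_prod.
have [h1 h2] := cint_prodE hc.
have eF : (fun t : n.-tuple mR => \prod_i (g i (tnth t i))%:C) =
  fun t => (\prod_i g i (tnth t i))%:C by apply/funext.
move: h1 h2; rewrite eF => -[h1 _] h2; split; first exact: h1.
have := congr1 (@complex.Re R) h2; rewrite /= => ->.
by under eq_bigr do rewrite ec; rewrite -rmorph_prod.
Qed.

End ProductIntegral.

(** * Weights on R^d *)
Section Bracket.
Context {R : realType} {d : nat}.
Implicit Types x y : 'rV[R]_d.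

(** The l1 version of [1 + eucl x], which is submultiplicative by the triangle
    inequality. *)
Definition br x : R := 1 + \sum_i `|x 0 i|.

Lemma br_ge1 x : 1 <= br x.
Proof. by rewrite lerDl sumr_ge0. Qed.

Lemma br_gt0 x : 0 < br x.
Proof. exact: lt_le_trans ltr01 (br_ge1 x). Qed.

Lemma br_ge0 x : 0 <= br x.
Proof. exact/ltW/br_gt0. Qed.

Lemma brX_ge1 x n : 1 <= br x ^+ n.
Proof. by rewrite exprn_ege1// br_ge1. Qed.

Lemma brX_gt0 x n : 0 < br x ^+ n.
Proof. by rewrite exprn_gt0// br_gt0. Qed.

Lemma brX_ge0 x n : 0 <= br x ^+ n.
Proof. exact/ltW/brX_gt0. Qed.

Lemma brN x : br (- x) = br x.
Proof. by rewrite /br; under eq_bigr do rewrite mxE normrN. Qed.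

Lemma brD x y : br (x + y) <= br x * br y.
Proof.
have h : \sum_i `|(x + y) 0 i| <= \sum_i `|x 0 i| + \sum_i `|y 0 i|.
  by rewrite -big_split /=; apply: ler_sum => i _; rewrite mxE ler_normD.
have a0 : 0 <= \sum_i `|x 0 i| by rewrite sumr_ge0.
have b0 : 0 <= \sum_i `|y 0 i| by rewrite sumr_ge0.
by rewrite /br; nra.
Qed.

Lemma brB x y : br (x - y) <= br x * br y.
Proof. by rewrite -(brN y) brD. Qed.

Lemma brZ a x : br (a *: x) <= (1 + `|a|) * br x.
Proof.
rewrite /br; under eq_bigr do rewrite mxE normrM.
rewrite -mulr_sumr; have : 0 <= \sum_i `|x 0 i| by rewrite sumr_ge0.
by have : 0 <= `|a| by []; set s := \sum_i _; nra.
Qed.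

Lemma coord_le_eucl x i : `|x 0 i| <= eucl x.
Proof.
rewrite /eucl -sqrtr_sqr ler_wsqrtr// /dotv (bigD1 i)//= -expr2 lerDl.
by rewrite sumr_ge0// => j _; rewrite -expr2 sqr_ge0.
Qed.

Lemma eucl_ge0 x : 0 <= eucl x.
Proof. exact: sqrtr_ge0. Qed.

Lemma eucl_le_sum x : eucl x <= \sum_i `|x 0 i|.
Proof.
have s0 : 0 <= \sum_i `|x 0 i| by rewrite sumr_ge0.
rewrite -[leRHS]ger0_norm// -sqrtr_sqr ler_wsqrtr// expr2 mulr_suml.
apply: ler_sum => i _; rewrite -expr2 -real_normK ?num_real// expr2 ler_wpM2l//.
by rewrite (bigD1 i)//= lerDl sumr_ge0.
Qed.

Lemma eucl_le_br x : 1 + eucl x <= br x.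
Proof. by rewrite lerD2l eucl_le_sum. Qed.

Lemma sum_le_eucl x : \sum_i `|x 0 i| <= d%:R * eucl x.
Proof.
have -> : d%:R * eucl x = \sum_(i < d) eucl x.
  by rewrite sumr_const card_ord mulr_natl.
by apply: ler_sum => i _; exact: coord_le_eucl.
Qed.

Lemma br_le_eucl x : br x <= d.+1%:R * (1 + eucl x).
Proof.
have := sum_le_eucl x; have := eucl_ge0 x; have : 0 <= d%:R :> R by [].
by rewrite /br -natr1; set s := \sum_i _; nra.
Qed.

Lemma euclZ a x : eucl (a *: x) = `|a| * eucl x.
Proof.
rewrite /eucl /dotv; under eq_bigr do rewrite !mxE mulrACA -expr2.
by rewrite -mulr_sumr sqrtrM ?sqr_ge0// sqrtr_sqr.
Qed.

End Bracket.

Section EuclideanIntegral.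
Context {R : realType} {d : nat}.
Local Notation mR := (measurableTypeR R).
Local Notation mu := (@lebesgue_tuple R d).
Local Notation row := (@row_of_tuple R d).
Implicit Types (f : 'rV[R]_d -> R) (g : 'rV[R]_d -> R[i]) (a : R) (b : 'rV[R]_d).

Definition vintble f := rintble mu (fun t => f (row t)).
Definition vint f := rint mu (fun t => f (row t)).
Definition vmeas f := measurable_fun setT (fun t => f (row t)).
Definition cvmeas g := cmeas (fun t => g (row t)).

Lemma cintegralE g : cintegral g = cint mu (fun t => g (row t)).
Proof. by []. Qed.

Lemma cintegrableE g : cintegrable g = cintble mu (fun t => g (row t)).
Proof. by []. Qed.

Lemma coordmeas_row : coordmeas row.
Proof.
move=> i; under eq_fun do rewrite mxE; exact: measurable_tnth.
Qed.

Lemma coordmeas_comp dX (X : measurableType dX) dY (Y : measurableType dY)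
   (v : Y -> 'rV[R]_d) (h : X -> Y) :
  coordmeas v -> measurable_fun setT h -> coordmeas (v \o h).
Proof. by move=> mv mh i; exact: (measurableT_comp (mv i) mh). Qed.

Lemma coordmeasD dX (X : measurableType dX) (v w : X -> 'rV[R]_d) :
  coordmeas v -> coordmeas w -> coordmeas (fun x => v x + w x).
Proof.
by move=> mv mw i; under eq_fun do rewrite mxE; exact: measurable_funD.
Qed.

Lemma coordmeasZ dX (X : measurableType dX) a (v : X -> 'rV[R]_d) :
  coordmeas v -> coordmeas (fun x => a *: v x).
Proof.
by move=> mv i; under eq_fun do rewrite mxE; exact: measurable_funM.
Qed.

Lemma coordmeasN dX (X : measurableType dX) (v : X -> 'rV[R]_d) :
  coordmeas v -> coordmeas (fun x => - v x).
Proof.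
by move=> mv i; under eq_fun do rewrite mxE; exact: measurable_funN.
Qed.

Lemma coordmeas_cst dX (X : measurableType dX) b : coordmeas (fun=> b : 'rV[R]_d) (X := X).
Proof. by move=> i; exact: measurable_cst. Qed.

Lemma row_aff a b t : row (aff a (fun i => b 0 i) t) = a *: row t + b.
Proof. by apply/rowP => i; rewrite !mxE tnth_mktuple. Qed.

Lemma vmeas_aff a b f : vmeas f -> vmeas (fun x => f (a *: x + b)).
Proof.
move=> mf; rewrite /vmeas; under eq_fun do rewrite -row_aff.
exact: (measurableT_comp mf (measurable_aff _ _)).
Qed.

Lemma ge0_vint_aff a b (f : 'rV[R]_d -> \bar R) : a != 0 ->
  measurable_fun setT (fun t => f (row t)) -> (forall x, (0 <= f x)%E) ->
  (\int[mu]_t f (row t) = (`|a| ^+ d)%:E * \int[mu]_t f (a *: row t + b)%R)%E.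
Proof.
move=> a0 mf f0; rewrite (ge0_integral_aff (fun i => b 0 i) a0 mf)//.
by congr (_ * _)%E; apply: eq_integral => t _; rewrite row_aff.
Qed.

Lemma vintble_aff a b f : a != 0 -> vintble f -> vintble (fun x => f (a *: x + b)).
Proof.
move=> a0 /integrableP[mf lf]; apply/integrableP; split.
  have mf' : vmeas f by move/measurable_EFinP : mf.
  by apply/measurable_EFinP; exact: (vmeas_aff a b mf').
have ad : 0 < `|a| ^+ d by rewrite exprn_gt0// normr_gt0.
move: lf; rewrite (@ge0_vint_aff a b (fun x => `|(f x)%:E|%E))//; last first.
  by apply: (measurableT_comp _ mf); exact: abse_measurable.
suff h (I : \bar R) : ((`|a| ^+ d)%:E * I < +oo -> I < +oo)%E by exact: h.
by case: I => [r|//|//]; rewrite ?ltry// mulry gtr0_sg// mul1e.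
Qed.

Lemma ge0_vint_affR a b f : a != 0 -> vintble f -> (forall x, 0 <= f x) ->
  vint f = `|a| ^+ d * vint (fun x => f (a *: x + b)).
Proof.
move=> a0 hf f0; apply: EFin_inj; rewrite EFinM !rintE//; last exact: vintble_aff.
rewrite (@ge0_vint_aff a b (fun x => (f x)%:E))//.
by apply/measurable_EFinP; exact: rintble_meas hf.
Qed.

Lemma vint_aff a b f : a != 0 -> vintble f ->
  vint f = `|a| ^+ d * vint (fun x => f (a *: x + b)).
Proof.
move=> a0 hf; pose f1 x := `|f x|; pose f2 x := `|f x| - f x.
have h1 : vintble f1 by exact: integrable_norm.
have h2 : vintble f2 by exact: rintbleB.
have fE x : f x = f1 x - f2 x by rewrite /f1 /f2 opprB addrC subrK.
have h3 := vintble_aff b a0 h1; have h4 := vintble_aff b a0 h2.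
transitivity (vint f1 - vint f2).
  by rewrite -rintB//; congr rint; apply/funext => t; exact: fE.
rewrite (ge0_vint_affR b a0 h1)//; last by move=> x; exact: normr_ge0.
rewrite (ge0_vint_affR b a0 h2); last by move=> x; rewrite subr_ge0 ler_norm.
rewrite -mulrBr -rintB//; congr (_ * rint _ _).
by apply/funext => t; rewrite fE.
Qed.

Lemma cintegrable_aff a b g : a != 0 -> cintegrable g ->
  cintegrable (fun x => g (a *: x + b)).
Proof.
move=> a0 [hr hi]; split.
  exact: (@vintble_aff a b (fun x => Re (g x))).
exact: (@vintble_aff a b (fun x => Im (g x))).
Qed.

Lemma cintegral_aff a b g : a != 0 -> cintegrable g ->
  cintegral g = (`|a| ^+ d)%:C * cintegral (fun x => g (a *: x + b)).
Proof.
move=> a0 [hr hi]; apply: complex_ext; rewrite ?cReM ?cImM /= mul0r ?subr0 ?addr0.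
  exact: (@vint_aff a b (fun x => Re (g x))).
exact: (@vint_aff a b (fun x => Im (g x))).
Qed.

End EuclideanIntegral.

Section Weight.
Context {R : realType}.
Local Notation mR := (measurableTypeR R).

Lemma integral_cauchy1 :
  (\int[@lebesgue_measure R]_x ((1 + x ^+ 2)^-1)%:E = pi%:E)%E.
Proof.
have e x : (1 + x ^+ 2)^-1 = (oneDsqr x)^-1 :> R by [].
rewrite (ge0_symfun_integralT (f := fun x => (oneDsqr x)^-1)).
- by rewrite -set_itvcy integral0y_oneDsqr -EFinM; congr _%:E; field.
- by move=> x; rewrite invr_ge0 (le_trans ler01)// oneDsqr_ge1.
- exact: continuous_oneDsqrV.
- by move=> x; rewrite /= /oneDsqr sqrrN.
Qed.

Lemma rintble_cauchy1 :
  rintble (@lebesgue_measure R) (fun x : mR => (1 + x ^+ 2)^-1).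
Proof.
have m : measurable_fun setT (fun x : mR => (1 + x ^+ 2)^-1).
  by apply: continuous_measurable_fun; exact: continuous_oneDsqrV.
apply/integrableP; split; first exact/measurable_EFinP.
under eq_integral => x _ do
  rewrite /= ger0_norm ?invr_ge0 ?addr_ge0 ?sqr_ge0//.
by rewrite integral_cauchy1 ltry.
Qed.

Lemma rint_cauchy1 : rint (@lebesgue_measure R) (fun x : mR => (1 + x ^+ 2)^-1) = pi.
Proof. by apply: EFin_inj; rewrite rintE ?integral_cauchy1//; exact: rintble_cauchy1. Qed.

Context {d : nat}.
Implicit Types x y : 'rV[R]_d.

(** A product of Cauchy densities up to the factor [pi ^+ d]; up to [2 ^+ d] it is
    also the Fourier integral of a product of exponentials. *)
Definition wt x : R := \prod_i (1 + x 0 i ^+ 2)^-1.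

Lemma wt_gt0 x : 0 < wt x.
Proof. by rewrite prodr_gt0// => i _; rewrite invr_gt0 ltr_pwDl ?sqr_ge0. Qed.

Lemma wt_ge0 x : 0 <= wt x. Proof. exact/ltW/wt_gt0. Qed.

Lemma vintble_wt : vintble wt.
Proof.
have [h _] := @rint_prodE R d (fun _ (z : R) => (1 + z ^+ 2)^-1) (fun=> rintble_cauchy1).
by rewrite /vintble /wt; under eq_fun do under eq_bigr do rewrite mxE.
Qed.

Lemma vint_wt : vint wt = pi ^+ d.
Proof.
have [_] := @rint_prodE R d (fun _ (z : R) => (1 + z ^+ 2)^-1) (fun=> rintble_cauchy1).
rewrite rint_cauchy1 prodr_const card_ord => <-.
by rewrite /vint /wt; under [in LHS]eq_fun do under eq_bigr do rewrite mxE.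
Qed.

Lemma vintble_wtB x : vintble (fun y => wt (x - y)).
Proof.
have e y : wt (x - y) = wt ((-1) *: y + x) by rewrite scaleN1r addrC.
rewrite /vintble; under eq_fun do rewrite e.
by apply: (@vintble_aff _ _ (-1) x wt) vintble_wt; rewrite oppr_eq0 oner_eq0.
Qed.

Lemma vint_wtB x : vint (fun y => wt (x - y)) = pi ^+ d.
Proof.
rewrite -vint_wt (@vint_aff _ _ (-1) x wt) ?oppr_eq0 ?oner_eq0//; last exact: vintble_wt.
rewrite normrN1 expr1n mul1r; congr rint; apply/funext => t.
by rewrite scaleN1r addrC.
Qed.

Lemma brX_wt x : 1 <= br x ^+ (2 * d) * wt x.
Proof.
have -> : br x ^+ (2 * d) = \prod_(i < d) br x ^+ 2.
  by rewrite prodr_const card_ord exprM.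
rewrite -big_split/=; elim/big_rec : _ => // i u _ u1.
rewrite -[leLHS]mulr1 ler_pM// ler_pdivlMr ?ltr_pwDl ?sqr_ge0// mul1r.
rewrite (@le_trans _ _ ((1 + `|x 0 i|) ^+ 2))//.
  rewrite -[x 0 i ^+ 2]real_normK ?num_real//.
  by have : 0 <= `|x 0 i| by []; set u' := `|_|; nra.
rewrite ler_sqr ?nnegrE ?addr_ge0// ?(ltW (br_gt0 x))//.
  by rewrite lerD2l (bigD1 i)//= lerDl sumr_ge0.
by rewrite sumr_ge0.
Qed.

(** [wt] is nearly constant on unit cubes. *)
Lemma wt_shift x y : (forall i, `|y 0 i| <= 1) -> wt (x + y) <= 3 ^+ d * wt x.
Proof.
move=> y1; have -> : 3 ^+ d = \prod_(i < d) (3 : R) by rewrite prodr_const card_ord.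
rewrite -big_split/=; apply: ler_prod => i _; apply/andP; split.
  by rewrite invr_ge0 addr_ge0 ?sqr_ge0.
have h1 : 0 < 1 + (x + y) 0 i ^+ 2 by rewrite ltr_pwDl ?sqr_ge0.
have h2 : 0 < 1 + x 0 i ^+ 2 by rewrite ltr_pwDl ?sqr_ge0.
rewrite -ler_pdivrMr ?invr_gt0// invrK mulrC ler_pdivrMr// mxE.
have yy : y 0 i ^+ 2 <= 1 by rewrite -real_normK ?num_real// expr_le1.
by have := sqr_ge0 (x 0 i + 2 * y 0 i); have := sqr_ge0 (x 0 i + y 0 i); nra.
Qed.

End Weight.

(** * Partial derivatives and increments *)
Section DirectionalDerivative.
Context {R : realType} {d : nat}.
Implicit Types (x y v : 'rV[R]_d) (f : 'rV[R]_d -> R).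

Lemma is_derive_line f x v (t df : R) :
  is_derive (t *: v + x) v f df <->
  is_derive t (1 : R) (fun h : R => f (h *: v + x)) df.
Proof.
have e : (fun h : R => h^-1 *: ((f \o shift (t *: v + x)) (h *: v) - f (t *: v + x)))
  = (fun h : R => h^-1 *: (((fun h : R => f (h *: v + x)) \o shift t) (h *: 1) -
       f (t *: v + x))).
  apply/funext => h /=; congr (_ *: (f _ - _)).
  by rewrite scalerDl addrA [_ *: 1]mulr1.
by split=> -[h1 h2]; apply: DeriveDef; move: h1 h2; rewrite /derivable /derive e.
Qed.

Lemma is_derive_line0 f x v (df : R) :
  is_derive x v f df <-> is_derive (0 : R) (1 : R) (fun h : R => f (h *: v + x)) df.
Proof. by rewrite -is_derive_line scale0r add0r. Qed.

Lemma is_derive_affine f x v (a df : R) (b : 'rV[R]_d) :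
  is_derive (a *: x + b) v f df ->
  is_derive x v (fun x => f (a *: x + b)) (a * df).
Proof.
move=> /is_derive_line0 h; apply/is_derive_line0.
have e : (fun h : R => f (a *: (h *: v + x) + b)) =
   (fun h : R => f (h *: v + (a *: x + b))) \o (fun h : R => a * h).
  by apply/funext => t /=; rewrite scalerDr scalerA addrA.
rewrite e mulrC; apply: is_derive1_comp; first by rewrite mulr0.
by apply: is_derive_eq; rewrite [_ *: _]mulr1.
Qed.

(** Only the derivatives along the coordinate axes are assumed to exist, so
    the segment from [x] to [x + h] is replaced by a path of [d] axis-parallel
    segments. *)
Lemma lipschitz_box f (df : 'I_d -> 'rV[R]_d -> R) x (h : 'rV[R]_d) (B : R) :
  (forall i z, is_derive z (delta_mx 0 i : 'rV[R]_d) f (df i z)) ->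
  (forall i z, (forall j, `|(z - x) 0 j| <= `|h 0 j|) -> `|df i z| <= B) ->
  `|f (x + h) - f x| <= B * \sum_i `|h 0 i|.
Proof.
move=> fd dfB.
pose p (k : nat) : 'rV[R]_d := \row_i (x 0 i + (if (i < k)%N then h 0 i else 0)).
have p0 : p 0%N = x by apply/rowP => i; rewrite mxE addr0.
have pd : p d = x + h by apply/rowP => i; rewrite !mxE ltn_ord.
have -> : f (x + h) - f x = \sum_(0 <= k < d) (f (p k.+1) - f (p k)).
  by rewrite (telescope_sumr (f \o p)) //= pd p0.
rewrite big_mkord mulr_sumr (le_trans (ler_norm_sum _ _ _))//.
apply: ler_sum => k _.
have pS : p k.+1 = h 0 k *: delta_mx 0 k + p k.
  apply/rowP => i; rewrite !mxE eqxx /= ltnS leq_eqVlt.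
  have [->|/eqP ne] := eqVneq i k; first by rewrite eqxx ltnn/= addr0 mulr1 addrC.
  have /negPf -> : (i : nat) != k by apply: contra_not_neq ne => /val_inj.
  by rewrite /= mulr0 add0r.
pose g (t : R) := f (t *: delta_mx 0 k + p k).
have gd (t : R) : is_derive t (1 : R) g (df k (t *: delta_mx 0 k + p k)).
  by apply/is_derive_line; exact: fd.
have gB (t : R) : `|t| <= `|h 0 k| -> `|df k (t *: delta_mx 0 k + p k)| <= B.
  move=> th; apply: dfB => j; rewrite !mxE eqxx/=.
  have [->|ne] := eqVneq j k; first by rewrite ltnn mulr1 addr0 addrK.
  by rewrite mulr0 add0r addrC addKr; case: ifP => _; rewrite ?normr0.
have gc (a b : R) : {within `[a, b], continuous g}.
  by apply: derivable_within_continuous => t _; case: (gd t).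
have -> : f (p k.+1) - f (p k) = g (h 0 k) - g 0.
  by rewrite /g pS scale0r add0r.
have [h0|h0] := leP 0 (h 0 k).
  have [c] := MVT_segment h0 (fun t _ => gd t) (@gc _ _).
  rewrite in_itv /= => /andP[c1 c2] ->; rewrite subr0 normrM ler_wpM2r// gB//.
  by rewrite !ger0_norm// (le_trans c1).
have [c] := MVT_segment (ltW h0) (fun t _ => gd t) (@gc _ _).
rewrite in_itv /= => /andP[c1 c2]; rewrite distrC => ->.
rewrite sub0r normrM normrN ler_wpM2r// gB//.
by rewrite !ler0_norm// ?lerN2// (le_trans c1)// ltW.
Qed.

End DirectionalDerivative.

Section ComplexPartial.
Context {R : realType} {d : nat}.
Implicit Types (x y : 'rV[R]_d) (g : 'rV[R]_d -> R[i]) (i j : 'I_d).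

(** [partial i g = g'], together with the existence of the derivative. *)
Definition cder i g g' := forall x,
  is_derive x (delta_mx 0 i : 'rV[R]_d) (fun y => Re (g y)) (Re (g' x)) /\
  is_derive x (delta_mx 0 i : 'rV[R]_d) (fun y => Im (g y)) (Im (g' x)).

Lemma cder_partial i g g' : cder i g g' -> partial i g = g'.
Proof.
move=> h; apply/funext => x; have [h1 h2] := h x.
by apply: complex_ext; rewrite /partial /= derive_val.
Qed.

Lemma cder_cderivable i g g' x : cder i g g' -> cderivable g x (delta_mx 0 i).
Proof. by move=> h; have [[h1 _] [h2 _]] := h x. Qed.

Lemma cderivable_cder i g :
  (forall x, cderivable g x (delta_mx 0 i)) -> cder i g (partial i g).
Proof. by move=> h x; have [h1 h2] := h x; split; exact: derivableP. Qed.

Lemma cder_eq i g g' g'' : cder i g g' -> g' =1 g'' -> cder i g g''.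
Proof. by move=> h /funext <-. Qed.

Lemma cder_cst i z : cder i (fun=> z) (fun=> 0).
Proof. by move=> x; split; exact: is_derive_cst. Qed.

Lemma cderD i g1 g2 g1' g2' : cder i g1 g1' -> cder i g2 g2' ->
  cder i (fun x => g1 x + g2 x) (fun x => g1' x + g2' x).
Proof.
move=> h1 h2 x; have [a1 b1] := h1 x; have [a2 b2] := h2 x; split.
  by under eq_fun do rewrite cReD; rewrite cReD; exact: is_deriveD.
by under eq_fun do rewrite cImD; rewrite cImD; exact: is_deriveD.
Qed.

Lemma cderM i g1 g2 g1' g2' : cder i g1 g1' -> cder i g2 g2' ->
  cder i (fun x => g1 x * g2 x) (fun x => g1' x * g2 x + g1 x * g2' x).
Proof.
move=> h1 h2 x; have [a1 b1] := h1 x; have [a2 b2] := h2 x; split.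
  under eq_fun do rewrite cReM.
  apply: (is_derive_eq (is_deriveB (is_deriveM a1 a2) (is_deriveM b1 b2))).
  by rewrite /GRing.scale /= cReD !cReM; ring.
under eq_fun do rewrite cImM.
apply: (is_derive_eq (is_deriveD (is_deriveM a1 b2) (is_deriveM b1 a2))).
by rewrite /GRing.scale /= cImD !cImM; ring.
Qed.

Lemma cderZ i g g' (z : R[i]) : cder i g g' ->
  cder i (fun x => z * g x) (fun x => z * g' x).
Proof.
move=> h; apply: cder_eq (cderM (cder_cst i z) h) _ => x.
by rewrite mul0r add0r.
Qed.

Lemma cder_aff i g g' (a : R) b : cder i g g' ->
  cder i (fun x => g (a *: x + b)) (fun x => a%:C * g' (a *: x + b)).
Proof.
move=> h x; have [h1 h2] := h (a *: x + b); split.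
  rewrite cReM /= mul0r subr0.
  exact: (@is_derive_affine _ _ (fun x => Re (g x))).
rewrite cImM /= mul0r addr0.
exact: (@is_derive_affine _ _ (fun x => Im (g x))).
Qed.

Lemma is_derive_coord i j x :
  is_derive x (delta_mx 0 i : 'rV[R]_d) (fun y => y 0 j) (i == j)%:R.
Proof.
apply/is_derive_line0.
have e : (fun h : R => (h *: (delta_mx 0 i : 'rV[R]_d) + x) 0 j) =
   (fun h : R => (i == j)%:R * h) + cst (x 0 j).
  by apply/funext => h /=; rewrite !fctE !mxE eqxx /= mulrC eq_sym.
by rewrite e; apply: is_derive_eq; rewrite addr0 [_ *: _]mulr1.
Qed.

Lemma cder_coord i j : cder i (fun x => (x 0 j)%:C) (fun=> (i == j)%:R%:C).
Proof. by move=> x; split => /=; [exact: is_derive_coord|exact: is_derive_cst]. Qed.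

Lemma is_derive_dotv i x xi :
  is_derive x (delta_mx 0 i : 'rV[R]_d) (fun y => dotv y xi) (xi 0 i).
Proof.
apply/is_derive_line0.
have e : (fun h : R => dotv (h *: (delta_mx 0 i : 'rV[R]_d) + x) xi) =
   (fun h : R => xi 0 i * h) + cst (dotv x xi).
  apply/funext => h /=; rewrite !fctE /dotv.
  under eq_bigr do rewrite !mxE eqxx/= mulrDl.
  rewrite big_split/= (bigD1 i)//= eqxx mulr1 big1 ?addr0 1?mulrC//.
  by move=> j /negPf ->; rewrite mulr0 mul0r.
by rewrite e; apply: is_derive_eq; rewrite addr0 [_ *: _]mulr1.
Qed.

Lemma cder_cis i xi :
  cder i (fun x => cis (dotv x xi)) (fun x => 'i * (xi 0 i)%:C * cis (dotv x xi)).
Proof.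
have comp (f f' : R -> R) x : (forall t : R, is_derive t (1 : R) f (f' t)) ->
   is_derive x (delta_mx 0 i : 'rV[R]_d) (fun y => f (dotv y xi))
     (xi 0 i * f' (dotv x xi)).
  move=> fd; apply/is_derive_line0.
  have h1 := (is_derive_line0 _ _ _ _).1 (is_derive_dotv i x xi).
  rewrite mulrC; apply: (@is_derive1_comp R f (fun h : R => dotv (h *: delta_mx 0 i + x) xi)).
  by rewrite scale0r add0r.
move=> x; split; rewrite ?cReM ?cImM /= ?(mul0r, mul1r, mulr0, subr0, add0r, sub0r, addr0).
  apply: (is_derive_eq (@comp cos (fun t => - sin t) x _)).
  by rewrite oppr0 mul0r sub0r mulrN.
by rewrite oppr0 mul0r add0r; exact: (@comp sin cos x _).
Qed.

Lemma cder_conj i g g' : cder i g g' ->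
  cder i (fun x => (g x)^*) (fun x => (g' x)^*).
Proof.
move=> h x; have [h1 h2] := h x.
have e1 z : Re z^* = Re z :> R by case: z.
have e2 z : Im z^* = - Im z :> R by case: z.
split; first by under eq_fun do rewrite e1; rewrite e1.
by under eq_fun do rewrite e2; rewrite e2; exact: is_deriveN.
Qed.

Lemma clipschitz_box g (dg : 'I_d -> 'rV[R]_d -> R[i]) x (h : 'rV[R]_d) (B : R) :
  (forall i, cder i g (dg i)) ->
  (forall i z, (forall j, `|(z - x) 0 j| <= `|h 0 j|) -> normc (dg i z) <= B) ->
  normc (g (x + h) - g x) <= 2 * B * \sum_i `|h 0 i|.
Proof.
move=> gd gB; apply: le_trans (normc_le_ReIm _) _.
rewrite -mulrA mulr_natl mulr2n cReD cImD cReN cImN lerD//.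
  apply: (@lipschitz_box _ _ (fun y => Re (g y)) (fun i y => Re (dg i y))).
    by move=> i z; have [] := gd i z.
  by move=> i z hz; exact: le_trans (Re_le_normc _) (gB i z hz).
apply: (@lipschitz_box _ _ (fun y => Im (g y)) (fun i y => Im (dg i y))).
  by move=> i z; have [] := gd i z.
by move=> i z hz; exact: le_trans (Im_le_normc _) (gB i z hz).
Qed.

Lemma sum_le_mxnorm x : \sum_i `|x 0 i| <= d%:R * `|x|.
Proof.
have -> : d%:R * `|x| = \sum_(i < d) `|x| by rewrite sumr_const card_ord mulr_natl.
apply: ler_sum => i _; rewrite [leRHS]/Num.norm/= mx_normrE.
by rewrite (le_trans _ (le_bigmax _ _ (0, i)))//.
Qed.

(** The l1 norm of an increment is at most [d] times its max norm. *)
Lemma lipschitz_continuous (f : 'rV[R]_d -> R) :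
  (forall x, exists C, forall h : 'rV[R]_d, \sum_i `|h 0 i| <= 1 ->
     `|f (x + h) - f x| <= C * \sum_i `|h 0 i|) -> continuous f.
Proof.
move=> fC x; have [C hC] := fC x.
have FF : Filter (nbhs x) by exact: nbhs_filter.
apply/(@cvgrPdist_le _ _ _ (nbhs x) FF f (f x)) => e e0.
have k0 : 0 < `|C| * d%:R + 1 by rewrite ltr_wpDl// mulr_ge0.
have d1 : 0 < d%:R + 1 :> R by rewrite ltr_wpDl.
pose de := Num.min (1 / (d%:R + 1)) (e / (`|C| * d%:R + 1)).
have de0 : 0 < de by rewrite lt_min !divr_gt0.
near=> y.
have : `|x - y| <= de.
  by near: y; apply: (@cvgr_dist_le _ _ _ _ _ id x cvg_id).
rewrite distrC le_min !ler_pdivlMr// => /andP[y1 y2].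
have yE : f y = f (x + (y - x)) by rewrite addrC subrK.
have s1 : \sum_i `|(y - x) 0 i| <= 1.
  rewrite (le_trans (sum_le_mxnorm _))// (le_trans _ y1)// mulrC ler_wpM2l//.
  by rewrite lerDl.
rewrite distrC yE (le_trans (hC _ s1))//.
rewrite (@le_trans _ _ (`|C| * (d%:R * `|y - x|)))//.
  rewrite (le_trans (ler_norm _))// normrM ler_wpM2l//.
  by rewrite ger0_norm ?sumr_ge0// sum_le_mxnorm.
by rewrite (le_trans _ y2)// mulrA mulrC ler_wpM2l// lerDl.
Unshelve. all: by end_near. Qed.

Lemma clipschitz_continuous g :
  (forall x, exists C, forall h : 'rV[R]_d, \sum_i `|h 0 i| <= 1 ->
     normc (g (x + h) - g x) <= C * \sum_i `|h 0 i|) -> ccontinuous g.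
Proof.
move=> gC; split; apply: lipschitz_continuous => x; have [C hC] := gC x; exists C => h h1.
  by rewrite -cReN -cReD (le_trans (Re_le_normc _))// hC.
by rewrite -cImN -cImD (le_trans (Im_le_normc _))// hC.
Qed.

End ComplexPartial.

(** * Schwartz functions *)
Section SchwartzClass.
Context {R : realType} {d : nat}.
Implicit Types (x y : 'rV[R]_d) (g : 'rV[R]_d -> R[i]) (i j : 'I_d).
Implicit Types (l : seq 'I_d) (B : R) (N : nat).

Definition rapid g := forall N, exists B, forall x, br x ^+ N * normc (g x) <= B.

(** [schwartz_seminorm N g <= B] up to the choice of the weight, which is [br]
    in place of [1 + eucl]. *)
Definition sbound N g B := forall l x, (size l <= N)%N ->
  br x ^+ N * normc (partials l g x) <= B.

Lemma sbound_ge0 N g B : sbound N g B -> 0 <= B.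
Proof.
move=> h; apply: le_trans (h [::] 0 isT).
by rewrite mulr_ge0 ?brX_ge0 ?normc_ge0.
Qed.

Lemma seminorm_ub N g l x : (size l <= N)%N ->
  (((1 + eucl x) ^+ N * normc (partials l g x))%:E <= schwartz_seminorm N g)%E.
Proof. by move=> lN; apply: ereal_sup_ubound; exists x => //; exists l. Qed.

Lemma seminorm_le N g B : sbound N g B -> (schwartz_seminorm N g <= B%:E)%E.
Proof.
move=> h; apply: ge_ereal_sup => _ [x _ [l /= lN <-]].
rewrite lee_fin (le_trans _ (h l x lN))// ler_wpM2r ?normc_ge0//.
by rewrite lerXn2r ?nnegrE ?eucl_le_br ?br_ge0// addr_ge0// eucl_ge0.
Qed.

Lemma schwartz_sbound g N : schwartz g -> exists B, sbound N g B.
Proof.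
move=> [_ /(_ N) sN].
have s0 : (0 <= schwartz_seminorm N g)%E.
  apply: le_trans (@seminorm_ub N g [::] 0 isT).
  by rewrite lee_fin mulr_ge0 ?normc_ge0// exprn_ge0// addr_ge0// eucl_ge0.
have sf : schwartz_seminorm N g \is a fin_num by rewrite ge0_fin_numE.
exists (d.+1%:R ^+ N * fine (schwartz_seminorm N g)) => l x lN.
have := @seminorm_ub N g l x lN; rewrite -(fineK sf) lee_fin => h.
apply: le_trans (ler_wpM2l (exprn_ge0 _ (ler0n _ _)) h).
rewrite mulrA ler_wpM2r ?normc_ge0// -exprMn lerXn2r ?br_le_eucl//.
  by rewrite nnegrE ltW// br_gt0.
by rewrite nnegrE mulr_ge0// addr_ge0// eucl_ge0.
Qed.

Lemma tempered_bound (T : functional) : tempered T -> exists N C, 0 <= C /\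
  forall g B, schwartz g -> sbound N g B -> normc (T g) <= C * B.
Proof.
move=> [_ [N [C h]]]; exists N, `|C|; split => // g B sg sB.
have B0 := sbound_ge0 sB.
have s0 : (0 <= schwartz_seminorm N g)%E.
  apply: le_trans (@seminorm_ub N g [::] 0 isT).
  by rewrite lee_fin mulr_ge0 ?normc_ge0// exprn_ge0// addr_ge0// eucl_ge0.
rewrite -lee_fin (le_trans (h g sg))// EFinM.
rewrite (@le_trans _ _ (`|C|%:E * schwartz_seminorm N g)%E)//.
  by rewrite lee_wpmul2r// lee_fin ler_norm.
by rewrite lee_wpmul2l// seminorm_le.
Qed.

Lemma tempered_lin (T : functional) (a : R[i]) g1 g2 : tempered T ->
  schwartz g1 -> schwartz g2 -> T (fun x => a * g1 x + g2 x) = a * T g1 + T g2.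
Proof. by move=> [h _]; exact: h. Qed.

Lemma partials_rcons l i g : partials (rcons l i) g = partials l (partial i g).
Proof. by rewrite /partials foldr_rcons. Qed.

Lemma sbound_partial N g B i : sbound N.+1 g B -> sbound N (partial i g) B.
Proof.
move=> h l x lN; rewrite -partials_rcons.
apply: le_trans (h (rcons l i) x _); last by rewrite size_rcons.
by rewrite ler_wpM2r ?normc_ge0// exprSr ler_peMr ?brX_ge0// br_ge1.
Qed.

Lemma schwartz_partial g i : schwartz g -> schwartz (partial i g).
Proof.
move=> sg; have [sm _] := sg; split.
  by move=> l; rewrite -partials_rcons; exact: sm.
move=> N; have [B sB] := schwartz_sbound N.+1 sg.
exact: le_lt_trans (seminorm_le (sbound_partial i sB)) (ltry _).
Qed.

Lemma schwartz_partials g l : schwartz g -> schwartz (partials l g).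
Proof. by elim: l => //= i l IH /IH; exact: schwartz_partial. Qed.

Lemma schwartz_cder g i : schwartz g -> cder i g (partial i g).
Proof. by move=> [sm _]; apply: cderivable_cder => x; have [_] := sm [::]; exact. Qed.

Lemma schwartz_ccontinuous g : schwartz g -> ccontinuous g.
Proof. by move=> [sm _]; have [] := sm [::]. Qed.

Lemma schwartz_rapid g : schwartz g -> rapid g.
Proof.
move=> sg N; have [B sB] := schwartz_sbound N sg.
by exists B => x; exact: (sB [::]).
Qed.

Lemma finite_bounds (Q : 'I_d -> R -> Prop) :
  (forall i B B', B <= B' -> Q i B -> Q i B') ->
  (forall i, exists B, Q i B) -> exists B, 0 <= B /\ forall i, Q i B.
Proof.
move=> Qmono /choice[f fQ]; exists (\sum_i `|f i|); split; first by rewrite sumr_ge0.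
move=> i; apply: Qmono (fQ i); rewrite (bigD1 i)//= (le_trans (ler_norm _))//.
by rewrite lerDl sumr_ge0.
Qed.

(** Schwartz functions form the largest class of rapidly decreasing functions
    closed under partial differentiation; this avoids computing the iterated
    derivatives of products, convolutions and Fourier transforms. *)
Lemma schwartz_coind (P : ('rV[R]_d -> R[i]) -> Prop) :
  (forall g, P g -> rapid g) ->
  (forall g i, P g -> exists2 g', cder i g g' & P g') ->
  forall g, P g -> schwartz g.
Proof.
move=> Pr Pd g Pg.
have Ppart f i : P f -> P (partial i f).
  by move=> Pf; have [f' /cder_partial ->] := Pd f i Pf.
have Pcder f i : P f -> cder i f (partial i f).
  by move=> Pf; have [f' h _] := Pd f i Pf; rewrite (cder_partial h).
have Pparts l f : P f -> P (partials l f).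
  by elim: l => //= i l IH /IH; exact: Ppart.
split.
  move=> l; have Pl := Pparts l _ Pg; split; last first.
    by move=> i x; exact: cder_cderivable (Pcder _ i Pl).
  have [B [B0 hB]] : exists B, 0 <= B /\
     forall i x, normc (partial i (partials l g) x) <= B.
    apply: (@finite_bounds (fun i B => forall x, normc (partial i (partials l g) x) <= B)).
      by move=> i B B' BB' h x; exact: le_trans (h x) BB'.
    move=> i; have [B h] := Pr _ (Ppart _ i Pl) 0%N; exists B => x.
    by have := h x; rewrite expr0 mul1r.
  apply: clipschitz_continuous => x.
  exists (2 * B) => h _.
  by apply: (clipschitz_box (fun i => Pcder _ i Pl)) => i z _.
have key N n f : P f -> exists B, forall l x, (size l <= n)%N ->
    br x ^+ N * normc (partials l f x) <= B.
  elim: n f => [|n IH] f Pf.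
    have [B h] := Pr _ Pf N; exists B => l x.
    by rewrite leqn0 size_eq0 => /eqP ->; exact: h.
  have [B [B0 hB]] : exists B, 0 <= B /\ forall i l x, (size l <= n)%N ->
      br x ^+ N * normc (partials l (partial i f) x) <= B.
    apply: (@finite_bounds (fun i B => forall l x, (size l <= n)%N ->
      br x ^+ N * normc (partials l (partial i f) x) <= B)).
      by move=> i B B' BB' h l x ln; exact: le_trans (h l x ln) BB'.
    by move=> i; exact: IH (Ppart _ i Pf).
  have [B1 h1] := Pr _ Pf N; exists (`|B1| + B) => l x.
  case/lastP: l => [_|l i].
    by rewrite (le_trans (h1 x))// (le_trans (ler_norm _))// lerDl.
  by rewrite size_rcons ltnS partials_rcons => /(hB i l x)/le_trans; apply; rewrite lerDr.
move=> N; have [B hB] := key N N g Pg.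
by apply: le_lt_trans (@seminorm_le N g B _) (ltry _) => l x; exact: hB.
Qed.

Lemma rapidD g1 g2 : rapid g1 -> rapid g2 -> rapid (fun x => g1 x + g2 x).
Proof.
move=> h1 h2 N; have [B1 b1] := h1 N; have [B2 b2] := h2 N.
exists (B1 + B2) => x; apply: le_trans (lerD (b1 x) (b2 x)).
by rewrite -mulrDr ler_wpM2l ?brX_ge0// le_normcD.
Qed.

Lemma rapidM_bounded g1 g2 C : rapid g1 -> (forall x, normc (g2 x) <= C) ->
  rapid (fun x => g1 x * g2 x).
Proof.
move=> h1 h2 N; have [B1 b1] := h1 N.
have C0 : 0 <= C by exact: le_trans (normc_ge0 _) (h2 0).
exists (B1 * C) => x; rewrite Normc.normcM mulrA.
by rewrite ler_pM// ?normc_ge0// mulr_ge0 ?brX_ge0 ?normc_ge0.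
Qed.

Lemma rapid_bounded g : rapid g -> exists C, forall x, normc (g x) <= C.
Proof. by move=> /(_ 0%N)[B h]; exists B => x; have := h x; rewrite expr0 mul1r. Qed.

Lemma rapidM g1 g2 : rapid g1 -> rapid g2 -> rapid (fun x => g1 x * g2 x).
Proof. by move=> h1 /rapid_bounded[C]; exact: rapidM_bounded. Qed.

Lemma rapidZ (z : R[i]) g : rapid g -> rapid (fun x => z * g x).
Proof.
move=> h; under eq_fun do rewrite mulrC.
exact: (@rapidM_bounded _ _ (normc z)).
Qed.

Lemma br_affine_le (a : R) b x : a != 0 ->
  br x <= (1 + `|a^-1|) * br b * br (a *: x + b).
Proof.
move=> a0; have e : x = a^-1 *: ((a *: x + b) - b).
  by rewrite addrK scalerA mulVf// scale1r.
rewrite {1}e (le_trans (brZ _ _))// -mulrA ler_wpM2l ?addr_ge0//.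
by rewrite mulrC brB.
Qed.

Lemma rapid_aff (a : R) b g : a != 0 -> rapid g -> rapid (fun x => g (a *: x + b)).
Proof.
move=> a0 h N; have [B hB] := h N.
exists (((1 + `|a^-1|) * br b) ^+ N * B) => x.
have c0 : 0 <= (1 + `|a^-1|) * br b by apply: mulr_ge0; [exact: addr_ge0|exact: br_ge0].
apply: le_trans (ler_wpM2l (exprn_ge0 N c0) (hB (a *: x + b))).
rewrite mulrA ler_wpM2r ?normc_ge0// -exprMn lerXn2r ?br_affine_le//.
  by rewrite nnegrE ltW// br_gt0.
by rewrite nnegrE mulr_ge0// ltW// br_gt0.
Qed.

Lemma schwartz_cderZD (a : R[i]) g1 g2 i : schwartz g1 -> schwartz g2 ->
  cder i (fun x => a * g1 x + g2 x) (fun x => a * partial i g1 x + partial i g2 x).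
Proof. by move=> s1 s2; apply: cderD; [apply: cderZ|]; exact: schwartz_cder. Qed.

Lemma schwartzZD (a : R[i]) g1 g2 : schwartz g1 -> schwartz g2 ->
  schwartz (fun x => a * g1 x + g2 x).
Proof.
move=> s1 s2; apply: (@schwartz_coind (fun f => exists g1 g2,
   [/\ schwartz g1, schwartz g2 & f = fun x => a * g1 x + g2 x])); last by exists g1, g2.
  move=> _ [f1 [f2 [h1 h2 ->]]].
  by apply: rapidD; [apply: rapidZ|]; exact: schwartz_rapid.
move=> _ i [f1 [f2 [h1 h2 ->]]].
exists (fun x => a * partial i f1 x + partial i f2 x); first exact: schwartz_cderZD.
by exists (partial i f1), (partial i f2); split => //; exact: schwartz_partial.
Qed.

Lemma partialsZD (a : R[i]) g1 g2 l : schwartz g1 -> schwartz g2 ->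
  partials l (fun x => a * g1 x + g2 x) =
  fun x => a * partials l g1 x + partials l g2 x.
Proof.
move=> s1 s2; elim: l => //= i l ->.
by apply: cder_partial; apply: schwartz_cderZD; exact: schwartz_partials.
Qed.

Lemma schwartzB g1 g2 : schwartz g1 -> schwartz g2 -> schwartz (fun x => g1 x - g2 x).
Proof.
move=> s1 s2; have -> : (fun x => g1 x - g2 x) = (fun x => (-1) * g2 x + g1 x).
  by apply/funext => x; rewrite mulN1r addrC.
exact: schwartzZD.
Qed.

Lemma partialsB g1 g2 l : schwartz g1 -> schwartz g2 ->
  partials l (fun x => g1 x - g2 x) = fun x => partials l g1 x - partials l g2 x.
Proof.
move=> s1 s2; have -> : (fun x => g1 x - g2 x) = (fun x => (-1) * g2 x + g1 x).
  by apply/funext => x; rewrite mulN1r addrC.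
by rewrite partialsZD//; apply/funext => x; rewrite mulN1r addrC.
Qed.

Lemma schwartz0 : schwartz (fun=> 0 : R[i]) (d := d).
Proof.
apply: (@schwartz_coind (fun f => f = fun=> 0)) => //.
  move=> _ -> N; exists 0 => x.
  by rewrite Normc.normc0 mulr0.
by move=> _ i ->; exists (fun=> 0) => //; exact: cder_cst.
Qed.

Lemma schwartzZ (a : R[i]) g : schwartz g -> schwartz (fun x => a * g x).
Proof.
move=> sg; have := schwartzZD a sg schwartz0.
by under eq_fun do rewrite addr0.
Qed.

Lemma partialsZ (a : R[i]) g l : schwartz g ->
  partials l (fun x => a * g x) = fun x => a * partials l g x.
Proof.
move=> sg; elim: l => //= i l ->.
by apply: cder_partial; apply: cderZ; apply: schwartz_cder; exact: schwartz_partials.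
Qed.

Lemma schwartz_aff (a : R) b g : a != 0 -> schwartz g ->
  schwartz (fun x => g (a *: x + b)).
Proof.
move=> a0 sg; apply: (@schwartz_coind (fun f => exists c g,
   schwartz g /\ f = fun x => c * g (a *: x + b))).
- move=> _ [c [f [h ->]]].
  by apply: rapidZ; apply: rapid_aff => //; exact: schwartz_rapid.
- move=> _ i [c [f [h ->]]].
  exists (fun x => (c * a%:C) * partial i f (a *: x + b)).
    apply: cder_eq (cderZ _ (cder_aff _ _ (schwartz_cder i h))) _ => x.
    by rewrite mulrA.
  by exists (c * a%:C), (partial i f); split => //; exact: schwartz_partial.
- by exists 1, g; split => //; under [in RHS]eq_fun do rewrite mul1r.
Qed.

Lemma partials_aff (a : R) b g l : schwartz g ->
  partials l (fun x => g (a *: x + b)) =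
  fun x => a%:C ^+ size l * partials l g (a *: x + b).
Proof.
move=> sg; elim: l => [|i l IH] /=; first by under [in RHS]eq_fun do rewrite mul1r.
rewrite IH; apply: cder_partial.
apply: cder_eq (cderZ _ (cder_aff _ _ (schwartz_cder i (schwartz_partials l sg)))) _ => x.
by rewrite exprSr mulrA.
Qed.

(** The smallest class that contains the products and is closed under
    differentiation by the product rule. *)
Inductive sum_of_products : ('rV[R]_d -> R[i]) -> Prop :=
| sop_prod g1 g2 : schwartz g1 -> schwartz g2 ->
    sum_of_products (fun x => g1 x * g2 x)
| sop_add g1 g2 : sum_of_products g1 -> sum_of_products g2 ->
    sum_of_products (fun x => g1 x + g2 x).

Lemma schwartzM g1 g2 : schwartz g1 -> schwartz g2 -> schwartz (fun x => g1 x * g2 x).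
Proof.
move=> s1 s2; apply: (@schwartz_coind sum_of_products); last exact: sop_prod.
  move=> f; elim=> [f1 f2 h1 h2|f1 f2 _ h1 _ h2]; last exact: rapidD.
  by apply: rapidM; exact: schwartz_rapid.
move=> f i; elim=> [f1 f2 h1 h2|f1 f2 _ [f1' h1 k1] _ [f2' h2 k2]].
  exists (fun x => partial i f1 x * f2 x + f1 x * partial i f2 x).
    by apply: cderM; exact: schwartz_cder.
  by apply: sop_add; apply: sop_prod => //; exact: schwartz_partial.
by exists (fun x => f1' x + f2' x); [exact: cderD|exact: sop_add].
Qed.

Lemma rapid_coordM g j : rapid g -> rapid (fun x => (x 0 j)%:C * g x).
Proof.
move=> h N; have [B hB] := h N.+1; exists B => x.
apply: le_trans (hB x); rewrite Normc.normcM normc_real exprSr -!mulrA.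
rewrite ler_wpM2l ?brX_ge0// ler_wpM2r ?normc_ge0//.
rewrite /br (bigD1 j)//= addrCA lerDl addr_ge0// sumr_ge0//.
Qed.

Lemma schwartz_coordM g j : schwartz g -> schwartz (fun x => (x 0 j)%:C * g x).
Proof.
move=> sg; apply: (@schwartz_coind (fun f => exists g1 g2,
   [/\ schwartz g1, schwartz g2 & f = fun x => (x 0 j)%:C * g1 x + g2 x])).
- move=> _ [f1 [f2 [h1 h2 ->]]].
  by apply: rapidD; [apply: rapid_coordM|]; exact: schwartz_rapid.
- move=> _ i [f1 [f2 [h1 h2 ->]]].
  exists (fun x => (x 0 j)%:C * partial i f1 x + ((i == j)%:R%:C * f1 x + partial i f2 x)).
    have := cderD (cderM (cder_coord i j) (schwartz_cder i h1)) (schwartz_cder i h2).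
    by move=> /cder_eq; apply => x; rewrite addrA; congr (_ + _); rewrite addrC.
  exists (partial i f1), (fun x => (i == j)%:R%:C * f1 x + partial i f2 x).
  split => //; first exact: schwartz_partial.
  by apply: schwartzZD => //; exact: schwartz_partial.
- by exists g, (fun=> 0); split => //; [exact: schwartz0|under [in RHS]eq_fun do rewrite addr0].
Qed.

Lemma schwartz_conj g : schwartz g -> schwartz (fun x => (g x)^*).
Proof.
move=> sg; apply: (@schwartz_coind (fun f => exists2 g, schwartz g &
   f = fun x => (g x)^*)); last by exists g.
  move=> _ [f h ->] N; have [B hB] := schwartz_rapid h N; exists B => x.
  suff -> : normc (f x)^* = normc (f x) by exact: hB.
  by case: (f x) => a b /=; rewrite sqrrN.
move=> _ i [f h ->]; exists (fun x => (partial i f x)^*).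
  by apply: cder_conj; exact: schwartz_cder.
by exists (partial i f) => //; exact: schwartz_partial.
Qed.

End SchwartzClass.

(** * Differentiation under the integral and convolution *)
Section RapidIntegral.
Context {R : realType} {d : nat}.
Implicit Types (x y : 'rV[R]_d) (g : 'rV[R]_d -> R[i]) (i j : 'I_d).
Local Notation mu := (@lebesgue_tuple R d).
Local Notation row := (@row_of_tuple R d).

Lemma measurable_br dX (X : measurableType dX) (v : X -> 'rV[R]_d) :
  coordmeas v -> measurable_fun setT (fun t => br (v t)).
Proof.
move=> mv; apply: measurable_funD => //.
apply: measurable_sum => i.
exact: (measurableT_comp (@normr_measurable R setT) (mv i)).
Qed.

Lemma rapid_le_wt g N : rapid g ->
  exists B, 0 <= B /\ forall x, br x ^+ N * normc (g x) <= B * wt x.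
Proof.
move=> /(_ (N + 2 * d)%N)[B hB].
have B0 : 0 <= B by apply: le_trans (hB 0); rewrite mulr_ge0 ?brX_ge0 ?normc_ge0.
exists B; split => // x.
apply: le_trans (ler_wpM2r (wt_ge0 x) (hB x)).
rewrite exprD -!mulrA (mulrCA (br x ^+ (2 * d))) ler_wpM2l ?brX_ge0//.
by rewrite ler_peMr ?brX_wt ?normc_ge0.
Qed.

Lemma rapid_vintble g N : cvmeas g -> rapid g ->
  vintble (fun x => br x ^+ N * normc (g x)).
Proof.
move=> mg /(@rapid_le_wt _ N)[B [B0 hB]].
apply: (@rintble_le _ _ _ mu _ (fun t => B * wt (row t))).
- apply: measurable_funM; last exact: cmeas_normc.
  by apply: measurable_funX; apply: measurable_br; exact: coordmeas_row.
- by move=> t; rewrite ger0_norm ?mulr_ge0 ?brX_ge0 ?normc_ge0.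
- exact: (rintbleZ B vintble_wt).
Qed.

Lemma rapid_cintegrable g : cvmeas g -> rapid g -> cintegrable g.
Proof.
move=> mg rg; have := rapid_vintble 0 mg rg.
apply: cintble_le => // t; by rewrite expr0 mul1r.
Qed.

Lemma schwartz_cvmeas g : schwartz g -> cvmeas g.
Proof.
by move=> /schwartz_ccontinuous; apply: cmeas_ccontinuous; exact: coordmeas_row.
Qed.

Lemma schwartz_cintegrable g : schwartz g -> cintegrable g.
Proof.
by move=> sg; apply: rapid_cintegrable; [exact: schwartz_cvmeas|exact: schwartz_rapid].
Qed.

End RapidIntegral.

Section DifferentiationUnderIntegral.
Context {R : realType} {d : nat}.
Context {dX : measure_display} {X : measurableType dX}.
Variable mu : {measure set X -> \bar R}.

Lemma is_derive_rint (F F' : 'rV[R]_d -> X -> R) (v : 'rV[R]_d) y (G : X -> R) :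
  (forall y, rintble mu (F y)) ->
  (forall y x, is_derive y v (F ^~ x) (F' y x)) ->
  rintble mu G -> (forall x, 0 <= G x) ->
  (forall (s : R) x, -1 < s -> s < 1 -> `|F' (s *: v + y) x| <= G x) ->
  is_derive y v (fun y => rint mu (F y)) (rint mu (F' y)).
Proof.
move=> hF dF hG G0 FG; apply/is_derive_line0.
pose f (s : R) (x : X) := F (s *: v + y) x.
have df (s : R) x : is_derive s (1 : R) (f ^~ x) (F' (s *: v + y) x).
  by apply/is_derive_line.
have I0 : `](-1 : R), 1[%classic 0 by rewrite /= in_itv /= ltrN10 ltr01.
have intf (s : R) : `]-1, 1[%classic s -> mu.-integrable setT (EFin \o f s).
  by move=> _; exact: hF.
have derf (s : R) x : `]-1, 1[%classic s -> setT x -> derivable (f ^~ x) s 1.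
  by move=> _ _; case: (df s x).
have dE s x : partial1of2 f s x = F' (s *: v + y) x.
  by rewrite partial1of2E; exact: derive_val.
have fG (s : R) x : `]-1, 1[%classic s -> setT x -> `|partial1of2 f s x| <= G x.
  by rewrite /= in_itv /= => /andP[s1 s2] _; rewrite dE; exact: FG.
apply: DeriveDef.
  exact: (derivable_under_integral measurableT I0 intf derf G0 hG fG).
rewrite -derive1E (differentiation_under_integral measurableT I0 intf derf G0 hG fG).
by congr Rintegral; apply/funext => x; rewrite dE scale0r add0r.
Qed.

Lemma cder_cint (F F' : 'rV[R]_d -> X -> R[i]) (i : 'I_d) :
  (forall y, cintble mu (F y)) ->
  (forall x, cder i (F ^~ x) (F' ^~ x)) ->
  (forall y, exists G, rintble mu G /\ forall (s : R) x, -1 < s -> s < 1 ->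
     normc (F' (s *: delta_mx 0 i + y) x) <= G x) ->
  cder i (fun y => cint mu (F y)) (fun y => cint mu (F' y)).
Proof.
move=> hF dF hG y; have [G [iG FG]] := hG y.
have G0 x : 0 <= G x by apply: le_trans (FG 0 x _ _); rewrite ?normc_ge0 ?ltrN10 ?ltr01.
split => /=.
  apply: (@is_derive_rint (fun y x => Re (F y x)) (fun y x => Re (F' y x)) _ _ G) => //.
  - by move=> z; have [] := hF z.
  - by move=> z x; have [] := dF x z.
  - by move=> s x s1 s2; exact: le_trans (Re_le_normc _) (FG s x s1 s2).
apply: (@is_derive_rint (fun y x => Im (F y x)) (fun y x => Im (F' y x)) _ _ G) => //.
- by move=> z; have [] := hF z.
- by move=> z x; have [] := dF x z.
- by move=> s x s1 s2; exact: le_trans (Im_le_normc _) (FG s x s1 s2).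
Qed.

End DifferentiationUnderIntegral.

Section Convolution.
Context {R : realType} {d : nat}.
Implicit Types (x y : 'rV[R]_d) (g k : 'rV[R]_d -> R[i]) (i j : 'I_d).
Implicit Types (l : seq 'I_d).
Local Notation mu := (@lebesgue_tuple R d).
Local Notation row := (@row_of_tuple R d).

Definition convol k g : 'rV[R]_d -> R[i] :=
  fun y => cintegral (fun x => g x * k (y - x)).

Lemma cvmeas_shift k y : schwartz k -> cvmeas (fun x => k (y - x)).
Proof.
move=> sk; apply: cmeas_ccontinuous (schwartz_ccontinuous sk).
by apply: coordmeasD; [exact: coordmeas_cst|apply: coordmeasN; exact: coordmeas_row].
Qed.

Lemma convol_integrable k g y : schwartz k -> cvmeas g -> rapid g ->
  cintegrable (fun x => g x * k (y - x)).
Proof.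
move=> sk mg rg; have [C hC] := rapid_bounded (schwartz_rapid sk).
apply: rapid_cintegrable; last exact: (rapidM_bounded rg).
by apply: cmeasM => //; exact: cvmeas_shift.
Qed.

Lemma cder_shift i k k' b : cder i k k' ->
  cder i (fun y => k (y + b)) (fun y => k' (y + b)).
Proof.
move=> h; have := cder_aff 1 b h; under eq_fun do rewrite scale1r.
by move=> /cder_eq; apply => x; rewrite mul1r scale1r.
Qed.

Lemma schwartz_shift k b : schwartz k -> schwartz (fun y => k (y + b)).
Proof.
move=> sk; have := schwartz_aff b (oner_neq0 R) sk.
by under eq_fun do rewrite scale1r.
Qed.

Lemma schwartz_opp k : schwartz k -> schwartz (fun y => k (- y)).
Proof.
move=> sk; have := @schwartz_aff R d (-1) 0 _ _ sk.
rewrite oppr_eq0 oner_eq0 => /(_ isT); congr schwartz; apply/funext => x.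
by rewrite scaleN1r addr0.
Qed.

Lemma partials_shift k b l : schwartz k ->
  partials l (fun y => k (y + b)) = fun y => partials l k (y + b).
Proof.
move=> sk; have := partials_aff 1 b l sk; under eq_fun do rewrite scale1r.
by move=> ->; apply/funext => x; rewrite scale1r expr1n mul1r.
Qed.

(** The derivative falls on the kernel; [g] is only measurable. *)
Lemma convol_cder k g i : schwartz k -> cvmeas g -> rapid g ->
  cder i (convol k g) (convol (partial i k) g).
Proof.
move=> sk mg rg; have sk' := schwartz_partial i sk.
apply: cder_cint.
- by move=> y; exact: convol_integrable.
- by move=> t; apply: cderZ; apply: cder_shift; exact: schwartz_cder.
- move=> y; have [C hC] := rapid_bounded (schwartz_rapid sk').
  exists (fun t => C * normc (g (row t))); split.
    by apply: rintbleZ; apply: cintble_normc; exact: rapid_cintegrable.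
  move=> s t _ _; rewrite Normc.normcM mulrC ler_wpM2r ?normc_ge0//.
Qed.

Lemma normc_convol_le k g N B y : schwartz k -> cvmeas g -> rapid g ->
  (forall z, br z ^+ N * normc (k z) <= B) ->
  br y ^+ N * normc (convol k g y) <= B * vint (fun x => br x ^+ N * normc (g x)).
Proof.
move=> sk mg rg kB.
have ig := rapid_vintble N mg rg.
rewrite -rintZ// -{1}[br y ^+ N]ger0_norm ?brX_ge0// -normc_real -Normc.normcM.
have ic := convol_integrable y sk mg rg.
rewrite -cintZ//; apply: normc_cint_le; [exact: cintbleZ|exact: rintbleZ|].
move=> t /=; rewrite !Normc.normcM normc_real ger0_norm ?brX_ge0//.
set x := row t.
have h : br y ^+ N <= br x ^+ N * br (y - x) ^+ N.
  rewrite -exprMn lerXn2r ?nnegrE ?mulr_ge0 ?br_ge0//.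
  by rewrite -{1}(subrK x y) mulrC brD.
rewrite (le_trans (ler_wpM2r _ h)) ?mulr_ge0 ?normc_ge0//.
rewrite mulrACA mulrC ler_wpM2r// ?mulr_ge0 ?brX_ge0 ?normc_ge0//.
Qed.

Lemma schwartz_convol k g : schwartz k -> cvmeas g -> rapid g -> schwartz (convol k g).
Proof.
move=> sk mg rg; apply: (@schwartz_coind _ _ (fun f => exists2 k, schwartz k & f = convol k g)).
- move=> _ [f h ->] N; have [B hB] := schwartz_rapid h N.
  by eexists => y; exact: normc_convol_le.
- move=> _ i [f h ->]; exists (convol (partial i f) g); first exact: convol_cder.
  by exists (partial i f) => //; exact: schwartz_partial.
- by exists k.
Qed.

Lemma partials_convol k g l : schwartz k -> cvmeas g -> rapid g ->
  partials l (convol k g) = convol (partials l k) g.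
Proof.
move=> sk mg rg; elim: l => //= i l ->; apply: cder_partial.
by apply: convol_cder => //; exact: schwartz_partials.
Qed.

End Convolution.

(** * The Fourier transform of Schwartz functions *)
Section FourierInverse.
Context {R : realType} {d : nat}.
Implicit Types (x y xi : 'rV[R]_d) (g k : 'rV[R]_d -> R[i]) (i j : 'I_d).
Local Notation mu := (@lebesgue_tuple R d).
Local Notation row := (@row_of_tuple R d).

Lemma dotvC x y : dotv x y = dotv y x.
Proof. by apply: eq_bigr => i _; rewrite mulrC. Qed.

Lemma dotvDl x y xi : dotv (x + y) xi = dotv x xi + dotv y xi.
Proof. by rewrite /dotv -big_split/=; apply: eq_bigr => i _; rewrite mxE mulrDl. Qed.

Lemma dotvZl (a : R) x xi : dotv (a *: x) xi = a * dotv x xi.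
Proof. by rewrite /dotv mulr_sumr; apply: eq_bigr => i _; rewrite mxE mulrA. Qed.

Lemma dotvNl x xi : dotv (- x) xi = - dotv x xi.
Proof. by rewrite -scaleN1r dotvZl mulN1r. Qed.

(** The integral of a translate does not depend on the translation. *)
Lemma cintegral_partial g i : schwartz g -> cintegral (partial i g) = 0.
Proof.
move=> sg; have sg' := schwartz_partial i sg.
have h1 : cder i (fun y => cintegral (fun x => g (x + y)))
                 (fun y => cintegral (fun x => partial i g (x + y))).
  apply: cder_cint.
  - by move=> y; exact: (schwartz_cintegrable (schwartz_shift y sg)).
  - move=> t; have := cder_shift (row t) (schwartz_cder i sg).
    under eq_fun do rewrite addrC.
    by move=> /cder_eq; apply => x; rewrite addrC.
  - move=> y.
    have [B [B0 hB]] := rapid_le_wt 0 (schwartz_rapid sg').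
    exists (fun t => B * 3 ^+ d * wt (row t + y)); split.
      have := @vintble_aff R d 1 y wt (oner_neq0 R) vintble_wt.
      by move=> /(rintbleZ (B * 3 ^+ d)); under eq_fun do rewrite scale1r.
    move=> s t s1 s2; have := hB (row t + (s *: delta_mx 0 i + y)).
    rewrite expr0 mul1r => /le_trans; apply; rewrite -mulrA ler_wpM2l//.
    rewrite (addrC (s *: _)) addrA wt_shift// => j; rewrite !mxE eqxx /=.
    rewrite normrM; have -> : `|(j == i)%:R| = (j == i)%:R :> R.
      by rewrite ger0_norm.
    rewrite (@le_trans _ _ `|s|)//; last by rewrite ler_norml !ltW.
    by rewrite ler_piMr// lern1; case: (j == i).
have h2 : cder i (fun y => cintegral (fun x => g (x + y))) (fun=> 0).
  have -> : (fun y => cintegral (fun x => g (x + y))) = fun=> cintegral g.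
    apply/funext => y; rewrite (@cintegral_aff _ _ 1 y g) ?oner_neq0//.
      by rewrite normr1 expr1n mul1r; congr cintegral; apply/funext => x; rewrite scale1r.
    exact: schwartz_cintegrable.
  exact: cder_cst.
have := cder_partial h1; rewrite (cder_partial h2) => /(congr1 (fun f => f 0)) ->.
by congr cintegral; apply/funext => x; rewrite addr0.
Qed.

Lemma cis_bounded x xi : normc (cis (dotv x xi)) <= 1.
Proof. by rewrite normc_cis. Qed.

Lemma schwartz_cisM xi g : schwartz g -> schwartz (fun x => g x * cis (dotv x xi)).
Proof.
move=> sg; apply: (@schwartz_coind _ _ (fun f => exists2 g, schwartz g &
  f = fun x => g x * cis (dotv x xi))); last by exists g.
  move=> _ [f h ->]; apply: rapidM_bounded; first exact: schwartz_rapid.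
  by move=> x; exact: cis_bounded.
move=> _ i [f h ->].
pose f' x := ('i * (xi 0 i)%:C) * f x + partial i f x.
exists (fun x => f' x * cis (dotv x xi)).
  apply: cder_eq (cderM (schwartz_cder i h) (cder_cis i xi)) _ => x.
  by rewrite /f' mulrDl addrC [f x * _]mulrCA mulrA.
by exists f' => //; apply: schwartzZD => //; exact: schwartz_partial.
Qed.

(** The factor in front of the Fourier integrals. *)
Definition fc : R := (2 * pi) `^ (- (d%:R / 2)).

Lemma fc_ge0 : 0 <= fc. Proof. exact: powR_ge0. Qed.

Lemma cis_integrable x g : schwartz g -> cintegrable (fun xi => cis (dotv x xi) * g xi).
Proof.
move=> /(schwartz_cisM x)/schwartz_cintegrable.
by congr cintegrable; apply/funext => xi; rewrite mulrC dotvC.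
Qed.

Lemma fourier_inv_le g x : schwartz g ->
  normc (fourier_inv g x) <= fc * vint (fun xi => normc (g xi)).
Proof.
move=> sg; rewrite /fourier_inv Normc.normcM normc_real ger0_norm ?fc_ge0//.
rewrite ler_wpM2l ?fc_ge0//; apply: normc_cint_le.
- exact: cis_integrable.
- by apply: cintble_normc; exact: schwartz_cintegrable.
- by move=> t; rewrite Normc.normcM normc_cis mul1r.
Qed.

Lemma fourier_inv_cder g i : schwartz g ->
  cder i (fourier_inv g) (fourier_inv (fun xi => 'i * ((xi 0 i)%:C * g xi))).
Proof.
move=> sg; have sg' := schwartz_coordM i sg; apply: cderZ; apply: cder_cint.
- by move=> y; exact: cis_integrable.
- move=> t; under eq_fun do rewrite mulrC.
  apply: cder_eq (cderZ _ (cder_cis i (row t))) _ => x.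
  by ring.
- move=> y; exists (fun t => normc ((row t 0 i)%:C * g (row t))); split.
    by apply: cintble_normc; exact: (schwartz_cintegrable sg').
  move=> s t _ _; rewrite !Normc.normcM normc_cis mul1r.
  by rewrite (_ : normc 'i = 1) ?mul1r//= expr0n expr1n add0r sqrtr1.
Qed.

(** The integral of [partial i (g * cis)] vanishes; the product rule gives the
    two sides. *)
Lemma fourier_inv_coordM g i x : schwartz g ->
  (x 0 i)%:C * fourier_inv g x = 'i * fourier_inv (partial i g) x.
Proof.
move=> sg; have sg' := schwartz_partial i sg.
have h := cder_partial (cderM (schwartz_cder i sg) (cder_cis i x)).
have := cintegral_partial i (schwartz_cisM x sg); rewrite h.
have h1 := cis_integrable x sg; have h2 := cis_integrable x sg'.
have -> : (fun y => partial i g y * cis (dotv y x) +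
     g y * ('i * (x 0 i)%:C * cis (dotv y x))) =
   (fun y => ('i * (x 0 i)%:C) * (cis (dotv x y) * g y) +
     cis (dotv x y) * partial i g y).
  by apply/funext => y; rewrite (dotvC y); ring.
rewrite cintegralE cintD//; last exact: cintbleZ.
rewrite cintZ// /fourier_inv => e.
set I1 := cintegral (fun xi => cis (dotv x xi) * g xi).
set I2 := cintegral (fun xi => _ * partial i g xi).
have {}e : 'i * (x 0 i)%:C * I1 + I2 = 0 by exact: e.
have -> : I2 = - ('i * (x 0 i)%:C * I1) by apply/eqP; rewrite -addr_eq0 addrC e.
have ii : 'i * 'i = -1 :> R[i] by rewrite -expr2 sqr_i.
have -> : forall c : R[i], 'i * (c * - ('i * (x 0 i)%:C * I1)) = - ('i * 'i) * (c * (x 0 i)%:C * I1).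
  by move=> c; ring.
by rewrite ii opprK mul1r mulrA; congr (_ * _); rewrite mulrC.
Qed.

(** Each factor [x_i] is traded for a derivative of [g]. *)
Lemma fourier_inv_rapid g : schwartz g -> rapid (fourier_inv g).
Proof.
move=> sg N; elim: N g sg => [|N IH] g sg.
  by eexists => x; rewrite expr0 mul1r; exact: fourier_inv_le.
have [B0 h0] := IH g sg.
have [B [_ hB]] : exists B, 0 <= B /\ forall i x,
    br x ^+ N * normc (fourier_inv (partial i g) x) <= B.
  apply: (@finite_bounds _ _ (fun i B => forall x,
    br x ^+ N * normc (fourier_inv (partial i g) x) <= B)).
    by move=> i B B' BB' h x; exact: le_trans (h x) BB'.
  by move=> i; exact: IH (schwartz_partial i sg).
exists (B0 + \sum_(i < d) B) => x.
rewrite exprSr -mulrA mulrCA {1}/br mulrDl mul1r lerD//.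
rewrite mulr_suml; apply: ler_sum => i _; apply: le_trans (hB i x).
rewrite mulrCA ler_wpM2l ?brX_ge0//.
rewrite -[`|x 0 i|]normc_real -Normc.normcM fourier_inv_coordM// Normc.normcM.
by rewrite (_ : normc 'i = 1) ?mul1r//= expr0n expr1n add0r sqrtr1.
Qed.

Lemma schwartz_fourier_inv g : schwartz g -> schwartz (fourier_inv g).
Proof.
move=> sg; apply: (@schwartz_coind _ _ (fun f => exists2 g, schwartz g &
  f = fourier_inv g)); last by exists g.
  by move=> _ [f h ->]; exact: fourier_inv_rapid.
move=> _ i [f h ->]; eexists; first exact: fourier_inv_cder.
by eexists => //; apply: schwartzZ; exact: schwartz_coordM.
Qed.

End FourierInverse.

(** * Dominated convergence *)
Section DominatedConvergence.
Context {R : realType}.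

Definition ccvg (u : nat -> R[i]) (z : R[i]) :=
  (fun n => normc (u n - z)) @ \oo --> (0 : R).

Lemma cvg_ge_cst (u : nat -> R) l c : u @ \oo --> l -> (forall n, c <= u n) -> c <= l.
Proof.
move=> ul cu; rewrite -(cvg_lim (@Rhausdorff R) ul).
by apply: limr_ge; [exact: cvgP ul|exact: nearW].
Qed.

Lemma ccvg_unique u z z' : ccvg u z -> ccvg u z' -> z = z'.
Proof.
move=> h1 h2; apply/eqP; rewrite -subr_eq0; apply/eqP/Normc.eq0_normc/eqP.
rewrite eq_le normc_ge0 andbT.
have h : (fun n => normc (u n - z) + normc (u n - z')) @ \oo --> (0 : R).
  by rewrite -(addr0 0); exact: cvgD.
apply: (cvg_ge_cst h) => n; rewrite normcB_sym.
by rewrite -(subrKA (u n)) (le_trans (le_normcD _ _))// addrC lerD2l normcB_sym.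
Qed.

Context {dX : measure_display} {X : measurableType dX}.
Variable mu : {measure set X -> \bar R}.

Lemma rint_cvg0 (f : nat -> X -> R) (G : X -> R) :
  (forall n, measurable_fun setT (f n)) -> rintble mu G ->
  (forall n x, `|f n x| <= G x) ->
  (forall x, (fun n => f n x) @ \oo --> (0 : R)) ->
  (fun n => rint mu (f n)) @ \oo --> (0 : R).
Proof.
move=> mf iG fG f0.
have h := @dominated_cvg _ _ _ mu setT measurableT (fun n x => (f n x)%:E) (cst 0%E)
  (EFin \o G).
have -> : (0 : R) = fine (\int[mu]_x (cst 0%E x))%E by rewrite integral0.
apply: fine_cvg; rewrite integral0.
have {h} := h _ _ _ _ _; rewrite integral0; apply => //.
- by move=> n; exact/measurable_EFinP.
- by move=> x _; apply: cvg_EFin; [exact: nearW|exact: f0].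
- by move=> n x _; rewrite /= lee_fin.
Qed.


Lemma cint_cvg (F_ : nat -> X -> R[i]) (F : X -> R[i]) (G : X -> R) :
  (forall n, cmeas (F_ n)) -> cmeas F -> rintble mu G ->
  (forall n x, normc (F_ n x) <= G x) ->
  (forall x, ccvg (fun n => F_ n x) (F x)) ->
  cintble mu F /\ ccvg (fun n => cint mu (F_ n)) (cint mu F).
Proof.
move=> mF_ mF iG FG FF.
have nG x : normc (F x) <= G x.
  have h : (fun n => G x + normc (F_ n x - F x)) @ \oo --> G x.
    by rewrite -[X in _ --> X]addr0; apply: cvgD; [exact: cvg_cst|exact: FF].
  apply: (cvg_ge_cst h) => n; rewrite -{1}(subrK (F_ n x) (F x)).
  by rewrite (le_trans (le_normcD _ _))// addrC lerD// normcB_sym.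
have iF : cintble mu F by exact: (cintble_le mF nG iG).
have iF_ n : cintble mu (F_ n) by exact: (cintble_le (mF_ n) (FG n) iG).
split => //.
have iD n : cintble mu (fun x => F_ n x - F x) by exact: cintbleB.
have h : (fun n => rint mu (fun x => normc (F_ n x - F x))) @ \oo --> (0 : R).
  apply: (@rint_cvg0 _ (fun x => 2 * G x)).
  - by move=> n; apply: cmeas_normc; exact: cintble_meas (iD n).
  - exact: rintbleZ.
  - move=> n x; rewrite ger0_norm ?normc_ge0// mulr_natl mulr2n.
    by rewrite (le_trans (le_normcD _ _))// lerD// normcN.
  - exact: FF.
apply: (@squeeze_cvgr _ _ _ _ (cst 0) _ _ _ _ _ h) => //; last exact: cvg_cst.
apply: nearW => n; rewrite normc_ge0 andTb -cintB//.
by apply: normc_cint_le => //; exact: cintble_normc.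
Qed.
End DominatedConvergence.

(** * The Fourier transform of the Poisson kernel *)
Section PoissonKernel.
Context {R : realType}.
Local Notation leb := (@lebesgue_measure R).
Local Notation mR := (measurableTypeR R).

(** The summand 1 makes the integrand nonnegative, so that its primitive can be
    evaluated on the half-line. *)
Lemma integral_1Dcos_exp (t : R) :
  (\int[leb]_(y in `[0%R, +oo[) ((1 + cos (t * y)) * expR (- y))%:E =
   (1 + (1 + t ^+ 2)^-1)%:E)%E.
Proof.
pose F (y : R) := expR (- y) * (- 1 + (t * sin (t * y) - cos (t * y)) / (1 + t ^+ 2)).
have t0 : 1 + t ^+ 2 != 0 by rewrite gt_eqF// ltr_pwDl// sqr_ge0.
have dF (x : R) : is_derive x (1 : R) F ((1 + cos (t * x)) * expR (- x)).
  have h1 : is_derive x (1 : R) (fun y => t * y) t.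
    by apply: is_derive_eq; rewrite [_ *: _]mulr1.
  have h2 : is_derive x (1 : R) (fun y => sin (t * y)) (cos (t * x) * t).
    exact: (is_derive1_comp (is_derive_sin _) h1).
  have h3 : is_derive x (1 : R) (fun y => cos (t * y)) (- sin (t * x) * t).
    exact: (is_derive1_comp (is_derive_cos _) h1).
  have h4 : is_derive x (1 : R) (fun y => expR (- y)) (expR (- x) * (- 1)).
    exact: (is_derive1_comp (is_derive_expR _) (is_deriveNid _ _)).
  have h5 : is_derive x (1 : R)
     (fun y => - 1 + (t * sin (t * y) - cos (t * y)) / (1 + t ^+ 2))
     (0 + (1 + t ^+ 2)^-1 * (t * (cos (t * x) * t) - - sin (t * x) * t)).
    have h6 := is_deriveZ (1 + t ^+ 2)^-1 (is_deriveB (is_deriveZ t h2) h3).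
    apply: is_deriveD; move: h6; congr is_derive; apply/funext => y.
    by rewrite /= mulrC.
  apply: (is_derive_eq (is_deriveM h4 h5)).
  by rewrite /GRing.scale /=; field.
have F0 : F 0 = - (1 + (1 + t ^+ 2)^-1).
  by rewrite /F !mulr0 oppr0 expR0 sin0 cos0 mulr0 sub0r mulN1r mul1r opprD.
have cF : continuous F by move=> x; apply: differentiable_continuous; apply/derivable1_diffP; case: (dF x).
rewrite (@ge0_continuous_FTC2y _ _ F 0 0) ?F0.
- by rewrite -EFinB sub0r opprK.
- by move=> x _; rewrite mulr_ge0 ?expR_ge0// -lerBlDl sub0r cos_geN1.
- apply: continuous_subspaceT => x.
  have h1 : {for x, continuous (fun y : R => t * y)} by exact: mulrl_continuous.
  apply: cvgM.
    apply: cvgD; first exact: cvg_cst.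
    by apply: continuous_comp => //; exact: continuous_cos.
  by apply: continuous_comp; [exact: continuousN|exact: continuous_expR].
- apply: (@squeeze_cvgr _ _ _ _ (fun x => - ((2 + `|t|) * expR (- x))) (fun x => (2 + `|t|) * expR (- x))).
  + apply: nearW => x; rewrite -ler_norml /F normrM mulrC (ger0_norm (expR_ge0 (- x))).
    rewrite ler_wpM2r ?expR_ge0//.
    rewrite (le_trans (ler_normD _ _))// normrN1 -[2]/(1 + 1) -addrA lerD2l.
    rewrite normrM [X in _ * X <= _]ger0_norm ?invr_ge0 ?addr_ge0 ?sqr_ge0//.
    rewrite (@le_trans _ _ `|t * sin (t * x) - cos (t * x)|)//.
      by rewrite ler_piMr// invf_le1 ?ltr_pwDl ?sqr_ge0// lerDl sqr_ge0.
    rewrite (le_trans (ler_normB _ _))// addrC lerD ?cos_max//.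
    by rewrite normrM ler_piMr// sin_max.
  + rewrite -oppr0 -(mulr0 (2 + `|t|)); apply: cvgN; apply: cvgMr; exact: cvgr_expR.
  + rewrite -(mulr0 (2 + `|t|)); apply: cvgMr; exact: cvgr_expR.
- by move=> x _; case: (dF x).
- by rewrite -F0; apply: cvg_at_right_filter; exact: cF.
- by move=> x _; rewrite derive1E; exact: derive_val.
Qed.

Lemma continuous_abs_exp (t : R) (f : R -> R) : continuous f ->
  continuous (fun y : R => (1 + f (t * y)) * expR (- `|y|)).
Proof.
move=> cf x; have h1 : {for x, continuous (fun y : R => t * y)} by exact: mulrl_continuous.
apply: cvgM.
  apply: cvgD; first exact: cvg_cst.
  by apply: continuous_comp => //; exact: cf.
apply: continuous_comp; last exact: continuous_expR.
by apply: continuousN; exact: norm_continuous.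
Qed.

Lemma integralT_1Dcos_exp (t : R) :
  (\int[leb]_y ((1 + cos (t * y)) * expR (- `|y|))%:E =
   (2 + 2 / (1 + t ^+ 2))%:E)%E.
Proof.
rewrite (ge0_symfun_integralT (f := fun y => (1 + cos (t * y)) * expR (- `|y|))).
- rewrite -set_itvcy.
  under eq_integral => y.
    rewrite inE /= in_itv /= andbT => y0.
    rewrite (ger0_norm y0); over.
  by rewrite integral_1Dcos_exp -EFinM; congr (_%:E); rewrite mulrDr mulr1.
- by move=> y; rewrite mulr_ge0 ?expR_ge0// -lerBlDl sub0r cos_geN1.
- by apply: continuous_abs_exp; exact: continuous_cos.
- by move=> y /=; rewrite mulrN cosN normrN.
Qed.

Lemma rintble_1Dcos_exp (t : R) :
  rintble leb (fun y : mR => (1 + cos (t * y)) * expR (- `|y|)) /\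
  rint leb (fun y : mR => (1 + cos (t * y)) * expR (- `|y|)) = 2 + 2 / (1 + t ^+ 2).
Proof.
have h : rintble leb (fun y : mR => (1 + cos (t * y)) * expR (- `|y|)).
  apply/integrableP; split.
    apply/measurable_EFinP; apply: continuous_measurable_fun.
    by apply: continuous_abs_exp; exact: continuous_cos.
  under eq_integral => y _ do
    rewrite /= ger0_norm ?mulr_ge0 ?expR_ge0 -?lerBlDl ?sub0r ?cos_geN1//.
  by rewrite integralT_1Dcos_exp ltry.
by split => //; apply: EFin_inj; rewrite rintE// integralT_1Dcos_exp.
Qed.

Lemma rintble_exp_abs : rintble leb (fun y : mR => expR (- `|y|)) /\
  rint leb (fun y : mR => expR (- `|y|)) = 2.
Proof.
have [h1 h2] := rintble_1Dcos_exp 0.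
have e : (fun y : mR => expR (- `|y|)) =
   (fun y : mR => 2^-1 * ((1 + cos (0 * y)) * expR (- `|y|))).
  by apply/funext => y; rewrite mul0r cos0 mulrA mulVf ?mul1r.
split; rewrite e; first exact: rintbleZ.
by rewrite rintZ// h2 expr0n addr0 divr1; field.
Qed.

Lemma rint_cos_exp (t : R) :
  rintble leb (fun y : mR => cos (t * y) * expR (- `|y|)) /\
  rint leb (fun y : mR => cos (t * y) * expR (- `|y|)) = 2 / (1 + t ^+ 2).
Proof.
have [h1 h2] := rintble_1Dcos_exp t; have [h3 h4] := rintble_exp_abs.
have e : (fun y : mR => cos (t * y) * expR (- `|y|)) =
  (fun y : mR => (1 + cos (t * y)) * expR (- `|y|) - expR (- `|y|)).
  by apply/funext => y; rewrite mulrDl mul1r addrC addKr.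
split; rewrite e; first exact: rintbleB.
by rewrite rintB// h2 h4 addrC addKr.
Qed.

Lemma rint_sin_exp (t : R) :
  rintble leb (fun y : mR => sin (t * y) * expR (- `|y|)) /\
  rint leb (fun y : mR => sin (t * y) * expR (- `|y|)) = 0.
Proof.
have [h3 h4] := rintble_exp_abs.
have ms : measurable_fun setT (fun y : mR => (1 + sin (t * y)) * expR (- `|y|)).
  apply: continuous_measurable_fun.
  by apply: continuous_abs_exp; exact: continuous_sin.
have h1 : rintble leb (fun y : mR => (1 + sin (t * y)) * expR (- `|y|)).
  apply: (@rintble_le _ _ _ leb _ (fun y => 2 * expR (- `|y|))) => //; last exact: rintbleZ.
  move=> y; rewrite normrM [X in _ * X]ger0_norm ?expR_ge0// ler_wpM2r ?expR_ge0//.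
  by rewrite (le_trans (ler_normD _ _))// normr1 -[2]/(1 + 1) lerD2l sin_max.
have e : (fun y : mR => sin (t * y) * expR (- `|y|)) =
  (fun y : mR => (1 + sin (t * y)) * expR (- `|y|) - expR (- `|y|)).
  by apply/funext => y; rewrite mulrDl mul1r addrC addKr.
have h : rintble leb (fun y : mR => sin (t * y) * expR (- `|y|)).
  by rewrite e; exact: rintbleB.
split => //.
have e2 : (fun y : mR => (1 + sin (t * aff1 (-1) 0 y)) * expR (- `|aff1 (-1) 0 y|)) =
   (fun y : mR => expR (- `|y|) - sin (t * y) * expR (- `|y|)).
  by apply/funext => y; rewrite /aff1 mulN1r addr0 mulrN sinN normrN mulrDl mul1r mulNr.
have : rint leb (fun y : mR => (1 + sin (t * y)) * expR (- `|y|)) =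
   rint leb (fun y : mR => expR (- `|y|) - sin (t * y) * expR (- `|y|)).
  apply: EFin_inj; rewrite !rintE//; last exact: rintbleB.
  rewrite (@ge0_integral_aff1 R (-1) 0 (fun y => ((1 + sin (t * y)) * expR (- `|y|))%:E)).
  - rewrite normrN1 mul1e; apply: eq_integral => y _; congr (_%:E).
    exact: (congr1 (fun f => f y) e2).
  - by rewrite oppr_eq0 oner_eq0.
  - exact/measurable_EFinP.
  - by move=> y; rewrite lee_fin mulr_ge0 ?expR_ge0// -lerBlDl sub0r sin_geN1.
rewrite rintB// h4.
have -> : (fun y : mR => (1 + sin (t * y)) * expR (- `|y|)) =
   (fun y : mR => expR (- `|y|) + sin (t * y) * expR (- `|y|)).
  by apply/funext => y; rewrite mulrDl mul1r.
by rewrite rintD// h4; lra.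
Qed.

Lemma cint_cis_exp (t : R) :
  cintble leb (fun y : mR => cis (y * t) * (expR (- `|y|))%:C) /\
  cint leb (fun y : mR => cis (y * t) * (expR (- `|y|))%:C) = (2 / (1 + t ^+ 2))%:C.
Proof.
have [h1 h2] := rint_cos_exp t; have [h3 h4] := rint_sin_exp t.
have e : (fun y : mR => cis (y * t) * (expR (- `|y|))%:C) =
 (fun y : mR => (cos (t * y) * expR (- `|y|)) +i* (sin (t * y) * expR (- `|y|))).
  apply/funext => y; apply: complex_ext; rewrite ?cReM ?cImM /= mulr0 mulrC.
    by rewrite subr0 mulrC (mulrC y).
  by rewrite add0r mulrC (mulrC y).
by rewrite e /cint/= h2 h4.
Qed.

Context {d : nat}.
Implicit Types (x y z : 'rV[R]_d).
Local Notation mu := (@lebesgue_tuple R d).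
Local Notation row := (@row_of_tuple R d).

Lemma cis_sum (I : Type) (s : seq I) (f : I -> R) :
  cis (\sum_(i <- s) f i) = \prod_(i <- s) cis (f i).
Proof.
elim: s => [|i s IH]; first by rewrite !big_nil cis0.
by rewrite !big_cons cisD IH.
Qed.

(** A tensor product, so that its Fourier transform is a product of
    one-dimensional ones. *)
Definition exp_l1 y : R := \prod_i expR (- `|y 0 i|).

Lemma exp_l1_ge0 y : 0 <= exp_l1 y.
Proof. by apply: prodr_ge0 => i _; exact: expR_ge0. Qed.

Lemma exp_l1_le1 y : exp_l1 y <= 1.
Proof.
suff /andP[] : 0 <= exp_l1 y <= 1 by [].
rewrite /exp_l1; elim/big_rec : _ => [|i u _ /andP[u0 u1]]; first by rewrite ler01 lexx.
have e0 := expR_ge0 (- `|y 0 i|).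
have e1 : expR (- `|y 0 i|) <= 1 by rewrite expR_le1 oppr_le0.
by rewrite mulr_ge0//= mulr_ile1.
Qed.

Lemma fourier_exp_l1 z :
  cintegrable (fun y => cis (dotv y z) * (exp_l1 y)%:C) /\
  cintegral (fun y => cis (dotv y z) * (exp_l1 y)%:C) = (2 ^+ d * wt z)%:C.
Proof.
have [h1 h2] := @cint_prodE R d
  (fun i (y : R) => cis (y * z 0 i) * (expR (- `|y|))%:C)
  (fun i => proj1 (cint_cis_exp (z 0 i))).
have e t : \prod_i (cis (tnth t i * z 0 i) * (expR (- `|tnth t i|))%:C) =
    cis (dotv (row t) z) * (exp_l1 (row t))%:C.
  rewrite big_split /= /dotv cis_sum /exp_l1 rmorph_prod.
  by congr (_ * _); apply: eq_bigr => i _; rewrite mxE.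
rewrite cintegrableE cintegralE; move: h1 h2; under eq_fun do rewrite e.
move=> h1 h2; split => //; rewrite h2.
under eq_bigr => i _ do rewrite (proj2 (cint_cis_exp (z 0 i))).
by rewrite -rmorph_prod big_split/= prodr_const card_ord.
Qed.

End PoissonKernel.

#[local] Arguments Normc.normc : simpl never.

(** * Fourier inversion *)
Section ComplexLimits.
Context {R : realType}.

Lemma real_complexM (a b : R) : (a * b)%:C = a%:C * b%:C :> R[i].
Proof. by apply: complex_ext; rewrite ?cReM ?cImM /= ?mul0r ?mulr0 ?subr0 ?addr0. Qed.

Lemma cancel_real (a b : R) (z : R[i]) : a != 0 -> b%:C = a%:C * z ->
  z = (a^-1 * b)%:C.
Proof.
by move=> a0 e; rewrite real_complexM e mulrA -real_complexM mulVf// mul1r.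
Qed.

Lemma ccvgZ (c : R[i]) u z : ccvg u z -> ccvg (fun n => c * u n) (c * z).
Proof.
move=> h; rewrite /ccvg; under eq_fun do rewrite -mulrBr Normc.normcM.
by rewrite -(mulr0 (normc c)); apply: cvgMr.
Qed.

Lemma ccvg_harmonic u z (K : R) :
  (forall n, normc (u n - z) <= K * n.+1%:R^-1) -> ccvg u z.
Proof.
move=> h.
have hK : (fun n => K * harmonic n) @ \oo --> (0 : R).
  by rewrite -(mulr0 K); apply: cvgMr; exact: cvg_harmonic.
apply: (@squeeze_cvgr _ _ _ _ (cst 0) _ _ _ _ _ hK) => //; last exact: cvg_cst.
by apply: nearW => n; rewrite normc_ge0 /=; exact: h.
Qed.

End ComplexLimits.

Section FourierInversion.
Context {R : realType} {d : nat}.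
Implicit Types (x y z xi : 'rV[R]_d) (g h : 'rV[R]_d -> R[i]) (i j : 'I_d).
Local Notation mu := (@lebesgue_tuple R d).
Local Notation row := (@row_of_tuple R d).
Local Notation fcR := (fc (R := R) (d := d)).

Lemma schwartz_lipschitz g : schwartz g -> exists C, 0 <= C /\
  forall x y, normc (g (x + y) - g x) <= C * \sum_i `|y 0 i|.
Proof.
move=> sg; have [B sB] := schwartz_sbound 1 sg.
exists (2 * B); split; first by rewrite mulr_ge0// (sbound_ge0 sB).
move=> x y; apply: (clipschitz_box (fun i => schwartz_cder i sg)) => i z _.
apply: le_trans (sB [:: i] z isT).
by rewrite ler_peMl ?normc_ge0// brX_ge1.
Qed.

Lemma exp_l1E y : exp_l1 y = expR (- \sum_i `|y 0 i|).
Proof. by rewrite -sumrN expR_sum. Qed.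

Lemma exp_l1_ge y : 1 - \sum_i `|y 0 i| <= exp_l1 y.
Proof. by rewrite exp_l1E; exact: expR_ge1Dx. Qed.

Lemma measurable_exp_l1 dX (X : measurableType dX) (v : X -> 'rV[R]_d) :
  coordmeas v -> measurable_fun setT (fun t => exp_l1 (v t)).
Proof.
move=> mv; have e t : exp_l1 (v t) = expR (1 - br (v t)).
  by rewrite exp_l1E /br opprD addrA subrr add0r.
under eq_fun do rewrite e.
have m : measurable_fun setT (fun t => 1 - br (v t)).
  by apply: measurable_funB => //; exact: measurable_br.
exact: (measurableT_comp (@measurable_expR R) m).
Qed.

Lemma cmeas_cis dX (X : measurableType dX) (f : X -> R) :
  measurable_fun setT f -> cmeas (fun t => cis (f t)).
Proof.
move=> mf; split => /=.
  by apply: (measurableT_comp _ mf); apply: continuous_measurable_fun; exact: continuous_cos.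
by apply: (measurableT_comp _ mf); apply: continuous_measurable_fun; exact: continuous_sin.
Qed.

Lemma measurable_dotv dX (X : measurableType dX) (v w : X -> 'rV[R]_d) :
  coordmeas v -> coordmeas w -> measurable_fun setT (fun t => dotv (v t) (w t)).
Proof.
by move=> mv mw; apply: measurable_sum => i; apply: measurable_funM.
Qed.

Lemma fc2 : fcR ^+ 2 * (2 * pi) ^+ d = 1.
Proof.
have p0 : 0 < 2 * pi :> R by rewrite mulr_gt0// pi_gt0.
rewrite expr2 /fc -powRD; last by rewrite (gt_eqF p0) implybT.
rewrite -powR_mulrn ?ltW// -powRD; last by rewrite (gt_eqF p0) implybT.
rewrite (_ : _ + _ + _ = 0) ?powRr0//.
by field.
Qed.

Lemma wt_scaled_vintble (e : R) xi : e != 0 ->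
  vintble (fun x => wt (e *: x + xi)).
Proof. by move=> e0; exact: vintble_aff e0 vintble_wt. Qed.

(** Abel summation: inserting the factor [exp_l1 (e *: y)] makes the double
    integral absolutely convergent, and its Fourier transform is an approximate
    identity as [e] tends to [0]. *)
Lemma fourier_abel_mean h x0 (e : R) : schwartz h -> 0 < e ->
  cintegral (fun y => (exp_l1 (e *: y))%:C * (cis (- dotv y x0) * fourier_inv h y)) =
  fcR%:C * ((2 ^+ d)%:C * cintegral (fun z => h (e *: z + x0) * (wt z)%:C)).
Proof.
move=> sh e0; have ne0 : e != 0 by rewrite gt_eqF.
pose F (p : d.-tuple (measurableTypeR R) * d.-tuple (measurableTypeR R)) :=
  (fcR%:C * (exp_l1 (e *: row p.1))%:C * cis (- dotv (row p.1) x0)) *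
  (cis (dotv (row p.1) (row p.2)) * h (row p.2)).
have c1 : coordmeas (fun p : d.-tuple (measurableTypeR R) * d.-tuple (measurableTypeR R) => row p.1).
  exact: (coordmeas_comp coordmeas_row (@measurable_fst _ _ _ _)).
have c2 : coordmeas (fun p : d.-tuple (measurableTypeR R) * d.-tuple (measurableTypeR R) => row p.2).
  exact: (coordmeas_comp coordmeas_row (@measurable_snd _ _ _ _)).
have mF : cmeas F.
  apply: cmeasM; last first.
    apply: cmeasM; first by apply: cmeas_cis; exact: measurable_dotv.
    by apply: cmeas_ccontinuous => //; exact: schwartz_ccontinuous.
  apply: cmeasM.
    apply: cmeasM; first exact: cmeas_cst.
    by apply: cmeas_real; apply: measurable_exp_l1; exact: coordmeasZ.
  apply: cmeas_cis; apply: measurable_funN; apply: measurable_dotv => //.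
have i1 : rintble mu (fun t => exp_l1 (e *: row t)).
  have [h1 _] := @fourier_exp_l1 R d 0.
  have : vintble (@exp_l1 R d).
    have := cintble_normc h1; congr (integrable _ _); apply/funext => t /=.
    congr (_%:E); rewrite Normc.normcM normc_cis mul1r normc_real.
    by rewrite ger0_norm ?exp_l1_ge0.
  move=> /(vintble_aff 0 ne0); congr (integrable _ _); apply/funext => t /=.
  by rewrite addr0.
have i2 : rintble mu (fun t => normc (h (row t))).
  by apply: cintble_normc; exact: schwartz_cintegrable.
have {}i1 := rintbleZ fcR i1.
have Fab t u : normc (F (t, u)) <= (fcR * exp_l1 (e *: row t)) * normc (h (row u)).
  rewrite /F /= !Normc.normcM !normc_cis !normc_real mul1r mulr1.
  by rewrite !ger0_norm ?exp_l1_ge0 ?fc_ge0.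
have a0 t : 0 <= fcR * exp_l1 (e *: row t) by rewrite mulr_ge0 ?exp_l1_ge0 ?fc_ge0.
have fub := cFubini mF i1 i2 Fab a0 (fun u => normc_ge0 _).
have perm (a b c I : R[i]) : a * (b * (c * I)) = (c * a * b) * I by ring.
transitivity (cint mu (fun t => cint mu (fun u => F (t, u)))).
  rewrite cintegralE; apply: eq_cint => t.
  rewrite /fourier_inv perm; apply: esym.
  exact: (cintZ (fcR%:C * (exp_l1 (e *: row t))%:C *
    cis (- dotv (row t) x0)) (cis_integrable (row t) sh)).
rewrite fub => {fub Fab a0 i1 i2 mF c1 c2}.
pose Q xi := h xi * ((e ^+ d)^-1 * (2 ^+ d * wt (e^-1 *: xi + - (e^-1 *: x0))))%:C.
transitivity (cint mu (fun u => fcR%:C * Q (row u))).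
  apply: eq_cint => u; rewrite /Q /F /=.
  set xi := row u; pose z := e^-1 *: xi + - (e^-1 *: x0).
  have [g1 g2] := fourier_exp_l1 z.
  have g3 := cintegral_aff 0 ne0 g1; have g4 := cintegrable_aff 0 ne0 g1.
  have dz y : dotv (e *: y + 0) z = dotv y xi - dotv y x0.
    rewrite addr0 dotvZl (dotvC y z) /z dotvDl dotvNl !dotvZl !(dotvC _ y).
    by field.
  transitivity (fcR%:C * h xi *
      cintegral (fun y => cis (dotv (e *: y + 0) z) * (exp_l1 (e *: y + 0))%:C)).
    apply: (eq_trans _ (cintZ (fcR%:C * h xi) g4)).
    apply: eq_cint => t; rewrite dz cisD addr0.
    have perm2 (a b c y w : R[i]) : (a * b * c) * (y * w) = (a * w) * ((y * c) * b) by ring.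
    exact: perm2.
  have g5 := etrans (esym g2) g3; rewrite (gtr0_norm e0) in g5.
  rewrite -mulrA; congr (_ * (_ * _)).
  exact: cancel_real (expf_neq0 d ne0) g5.
have W0 y : 0 <= (e ^+ d)^-1 * (2 ^+ d * wt (e^-1 *: y + - (e^-1 *: x0))).
  apply: mulr_ge0; first by rewrite invr_ge0 exprn_ge0// ltW.
  by apply: mulr_ge0; [exact: exprn_ge0|exact: wt_ge0].
have iQ : cintegrable Q.
  have [C hC] := rapid_bounded (schwartz_rapid sh).
  apply: (@cintble_le _ _ _ mu _ (fun t => C * ((e ^+ d)^-1 * (2 ^+ d * wt (e^-1 *: row t + - (e^-1 *: x0)))))).
  - apply: cmeasM; first exact: schwartz_cvmeas.
    apply: cmeas_real; apply: rintble_meas; do 2 apply: rintbleZ.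
    by apply: wt_scaled_vintble; rewrite invr_neq0.
  - move=> t; rewrite Normc.normcM normc_real (ger0_norm (W0 _)).
    exact: (ler_wpM2r (W0 _) (hC _)).
  - do 3 apply: rintbleZ.
    by apply: wt_scaled_vintble; rewrite invr_neq0.
rewrite cintZ//; congr (_ * _).
rewrite -cintegralE (cintegral_aff x0 ne0 iQ) gtr0_norm//.
have iH : cintegrable (fun z => h (e *: z + x0) * (wt z)%:C).
  have [C hC] := rapid_bounded (schwartz_rapid sh).
  apply: (@cintble_le _ _ _ mu _ (fun t => C * wt (row t))).
  - apply: cmeasM; first exact: (schwartz_cvmeas (schwartz_aff x0 ne0 sh)).
    by apply: cmeas_real; apply: rintble_meas; exact: vintble_wt.
  - move=> t; rewrite Normc.normcM normc_real ger0_norm ?wt_ge0//.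
    by rewrite ler_wpM2r ?hC ?wt_ge0.
  - by apply: rintbleZ; exact: vintble_wt.
rewrite !cintegralE -!cintZ//; last exact: (cintegrable_aff x0 ne0 iQ).
apply: eq_cint => t; rewrite /Q.
have -> : e^-1 *: (e *: row t + x0) + - (e^-1 *: x0) = row t.
  by rewrite scalerDr scalerA mulVf// scale1r addrK.
have alg (a b c k w : R[i]) : a * b = 1 -> a * (k * (b * (c * w))) = c * (k * w).
  by move=> ab; transitivity ((a * b) * (c * (k * w))); [ring|rewrite ab mul1r].
rewrite !real_complexM; apply: alg; rewrite -real_complexM mulfV//.
by rewrite expf_neq0.
Qed.

(** Both sides of [fourier_abel_mean] converge as [e] tends to 0, by dominated
    convergence; the constants match because [vint wt = pi ^+ d]. *)
Theorem fourier_inversion h x0 : schwartz h -> fourier (fourier_inv h) x0 = h x0.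
Proof.
move=> sh; have sH := schwartz_fourier_inv sh.
pose e n : R := n.+1%:R^-1.
have e0 n : 0 < e n by rewrite invr_gt0.
pose A n := cintegral (fun y => (exp_l1 (e n *: y))%:C * (cis (- dotv y x0) * fourier_inv h y)).
pose B n := cintegral (fun z => h (e n *: z + x0) * (wt z)%:C).
have mH : cvmeas (fun y => cis (- dotv y x0) * fourier_inv h y).
  apply: cmeasM; last exact: schwartz_cvmeas.
  apply: cmeas_cis; apply: measurable_funN; apply: measurable_dotv.
    exact: coordmeas_row.
  exact: coordmeas_cst.
have cA : ccvg A (cintegral (fun y => cis (- dotv y x0) * fourier_inv h y)).
  apply: (proj2 (cint_cvg (G := fun t => normc (fourier_inv h (row t))) _ _ _ _ _)).
  - move=> n; apply: cmeasM => //; apply: cmeas_real; apply: measurable_exp_l1.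
    by apply: coordmeasZ; exact: coordmeas_row.
  - exact: mH.
  - by apply: cintble_normc; exact: schwartz_cintegrable.
  - move=> n t; rewrite !Normc.normcM normc_cis mul1r normc_real ger0_norm ?exp_l1_ge0//.
    by rewrite ler_piMl ?exp_l1_le1 ?mulr_ge0 ?normc_ge0.
  - move=> t; set z := cis _ * _.
    apply: (@ccvg_harmonic _ _ _ ((\sum_i `|row t 0 i|) * normc z)) => n.
    rewrite -[X in _ - X]mul1r -mulrBl Normc.normcM mulrAC ler_wpM2r ?normc_ge0//.
    have -> : (exp_l1 (e n *: row t))%:C - 1 = (exp_l1 (e n *: row t) - 1)%:C :> R[i].
      by rewrite rmorphB rmorph1.
    rewrite normc_real.
    rewrite distrC ger0_norm ?subr_ge0 ?exp_l1_le1//.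
    have := exp_l1_ge (e n *: row t).
    under eq_bigr do rewrite mxE normrM (ger0_norm (ltW (e0 n))).
    by rewrite -mulr_sumr -/(e n) (mulrC (e n)); lra.
have cB : ccvg B (h x0 * (pi ^+ d)%:C).
  have [C [C0 hC]] := schwartz_lipschitz sh.
  have [C' hC'] := rapid_bounded (schwartz_rapid sh).
  have -> : h x0 * (pi ^+ d)%:C = cintegral (fun z => h x0 * (wt z)%:C).
    rewrite cintegralE cintZ; last by split; [exact: vintble_wt|exact: integrable0].
    by congr (_ * _); apply: complex_ext => /=; rewrite -?vint_wt ?rint0.
  apply: (proj2 (cint_cvg (G := fun t => C' * wt (row t)) _ _ _ _ _)).
  - move=> n; apply: cmeasM.
      have ne : e n != 0 by rewrite gt_eqF.
      exact: (schwartz_cvmeas (schwartz_aff x0 ne sh)).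
    by apply: cmeas_real; apply: rintble_meas; exact: vintble_wt.
  - apply: cmeasM; first exact: cmeas_cst.
    by apply: cmeas_real; apply: rintble_meas; exact: vintble_wt.
  - by apply: rintbleZ; exact: vintble_wt.
  - move=> n t; rewrite Normc.normcM normc_real ger0_norm ?wt_ge0//.
    by rewrite ler_wpM2r ?wt_ge0 ?hC'.
  - move=> t; apply: (@ccvg_harmonic _ _ _ (C * (\sum_i `|row t 0 i|) * wt (row t))) => n.
    rewrite -mulrBl Normc.normcM normc_real ger0_norm ?wt_ge0// mulrAC.
    rewrite ler_wpM2r ?wt_ge0// (addrC (e n *: _)).
    apply: le_trans (hC _ _) _.
    under eq_bigr do rewrite mxE normrM (ger0_norm (ltW (e0 n))).
    by rewrite -mulr_sumr -mulrA ler_wpM2l// mulrC.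
have cA' := ccvgZ fcR%:C cA.
have cB' := ccvgZ ((fcR ^+ 2) * 2 ^+ d)%:C cB.
have AB : (fun n => fcR%:C * A n) =
          (fun n => ((fcR ^+ 2) * 2 ^+ d)%:C * B n).
  apply/funext => n; rewrite /A fourier_abel_mean// -/(B n).
  by rewrite !rmorphM /= !mulrA.
rewrite AB in cA'; rewrite /fourier; rewrite -/fcR.
rewrite (ccvg_unique cA' cB') mulrCA -rmorphM /= -mulrA -exprMn fc2 mulr1//.
Qed.

End FourierInversion.

(** * Kernels of Fourier multipliers *)
Section Kernels.
Context {R : realType} {d : nat}.
Implicit Types (x y z xi : 'rV[R]_d) (g h m : 'rV[R]_d -> R[i]).
Local Notation mu := (@lebesgue_tuple R d).
Local Notation row := (@row_of_tuple R d).
Local Notation fcR := (fc (R := R) (d := d)).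

Lemma cintegral_reflect b g : cintegrable g ->
  cintegral g = cintegral (fun x => g (b - x)).
Proof.
move=> ig; have n10 : (-1 : R) != 0 by rewrite oppr_eq0 oner_eq0.
rewrite (cintegral_aff b n10 ig) normrN1 expr1n mul1r.
by congr cintegral; apply/funext => x; rewrite scaleN1r addrC.
Qed.

(** The convolution kernel of the Fourier multiplier [m]. *)
Definition kern m : 'rV[R]_d -> R[i] := fun z => fcR%:C * fourier_inv m z.

Lemma schwartz_kern m : schwartz m -> schwartz (kern m).
Proof. by move=> sm; apply: schwartzZ; exact: schwartz_fourier_inv. Qed.

Lemma dotvBr x y xi : dotv xi (x - y) = dotv xi x - dotv xi y.
Proof. by rewrite !(dotvC xi) dotvDl dotvNl. Qed.

Lemma cisN_integrable xi g : schwartz g ->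
  cintegrable (fun x => cis (- dotv x xi) * g x).
Proof.
move=> sg; have := schwartz_cintegrable (schwartz_cisM (- xi) sg).
congr cintegrable; apply/funext => x.
by rewrite mulrC dotvC dotvNl dotvC.
Qed.

(** By Fubini the multiplier acts as convolution with its kernel. *)
Lemma fourier_multiplier m g y : schwartz m -> schwartz g ->
  fourier (fun xi => m xi * fourier_inv g xi) y =
  cintegral (fun x => g x * kern m (x - y)).
Proof.
move=> sm sg.
pose F (p : d.-tuple (measurableTypeR R) * d.-tuple (measurableTypeR R)) :=
  (fcR%:C * fcR%:C * cis (- dotv (row p.1) y) * m (row p.1)) *
  (cis (dotv (row p.1) (row p.2)) * g (row p.2)).
have mF : cmeas F.
  have c1 : coordmeas (fun p : d.-tuple (measurableTypeR R) * d.-tuple (measurableTypeR R) => row p.1).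
    exact: (coordmeas_comp coordmeas_row (@measurable_fst _ _ _ _)).
  have c2 : coordmeas (fun p : d.-tuple (measurableTypeR R) * d.-tuple (measurableTypeR R) => row p.2).
    exact: (coordmeas_comp coordmeas_row (@measurable_snd _ _ _ _)).
  apply: cmeasM; last first.
    apply: cmeasM; first by apply: cmeas_cis; exact: measurable_dotv.
    exact: (cmeas_ccontinuous c2 (schwartz_ccontinuous sg)).
  apply: cmeasM; last exact: (cmeas_ccontinuous c1 (schwartz_ccontinuous sm)).
  apply: cmeasM; first exact: cmeas_cst.
  by apply: cmeas_cis; apply: measurable_funN; apply: measurable_dotv.
have i1 : rintble mu (fun t => (fcR * fcR) * normc (m (row t))).
  by apply: rintbleZ; apply: cintble_normc; exact: schwartz_cintegrable.
have i2 : rintble mu (fun t => normc (g (row t))).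
  by apply: cintble_normc; exact: schwartz_cintegrable.
have Fab t u : normc (F (t, u)) <= ((fcR * fcR) * normc (m (row t))) * normc (g (row u)).
  by rewrite /F /= !Normc.normcM !normc_cis !normc_real mul1r mulr1 (ger0_norm fc_ge0).
have a0 t : 0 <= (fcR * fcR) * normc (m (row t)).
  by apply: mulr_ge0; [apply: mulr_ge0; exact: fc_ge0|exact: normc_ge0].
have fub := cFubini mF i1 i2 Fab a0 (fun u => normc_ge0 _).
move: fub => {Fab a0 i1 i2 mF} fub.
have ic x : cintegrable (fun xi => cis (dotv x xi) * g xi) by exact: cis_integrable.
have imy := cisN_integrable y (schwartzM sm (schwartz_fourier_inv sg)).
transitivity (cint mu (fun t => cint mu (fun u => F (t, u)))).
  rewrite /fourier; apply: (eq_trans (esym (cintZ _ imy))).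
  apply: eq_cint => t.
  apply: (eq_trans _ (esym (cintZ (fcR%:C * fcR%:C * cis (- dotv (row t) y) * m (row t)) (ic (row t))))).
  rewrite /fourier_inv -/fcR.
  have perm (a b e I : R[i]) : a * (b * (e * (a * I))) = a * a * b * e * I by ring.
  exact: perm.
rewrite fub cintegralE; apply: eq_cint => u.
have im := cis_integrable (row u - y) sm.
transitivity (g (row u) * fcR%:C * fcR%:C * cint mu (fun t => cis (dotv (row u - y) (row t)) * m (row t))).
  apply: (eq_trans _ (cintZ (g (row u) * fcR%:C * fcR%:C) im)).
  apply: eq_cint => t; rewrite /F /= (dotvC (row u - y)) dotvBr cisD.
  have perm (a b e k w : R[i]) : a * a * b * k * (e * w) = w * a * a * (e * b * k) by ring.
  exact: perm.
by rewrite /kern /fourier_inv -/fcR cintegralE !mulrA.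
Qed.

Lemma fourier_oppE g y : fourier g (- y) = fourier_inv g y.
Proof.
rewrite /fourier /fourier_inv; congr (_ * cintegral _); apply/funext => x.
by rewrite dotvC dotvNl opprK.
Qed.

Lemma fourier_inv_opp g xi : schwartz g ->
  fourier_inv (fun x => g (- x)) xi = fourier_inv g (- xi).
Proof.
move=> sg; rewrite /fourier_inv; congr (_ * _).
have n10 : (-1 : R) != 0 by rewrite oppr_eq0 oner_eq0.
rewrite (cintegral_aff 0 n10 (cis_integrable (- xi) sg)) normrN1 expr1n mul1r.
congr cintegral; apply/funext => x.
by rewrite scaleN1r addr0 dotvNl (dotvC xi) (dotvC xi) dotvNl opprK.
Qed.

(** By the inversion theorem the inverse Fourier transform of the reflected
    kernel of [m2] is a multiple of [m2], so that [fourier_multiplier] applies. *)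
Lemma convol_kern m1 m2 y : schwartz m1 -> schwartz m2 ->
  convol (kern m1) (kern m2) y = kern (fun xi => m1 xi * m2 xi) y.
Proof.
move=> s1 s2; have sk2 := schwartz_kern s2; have sk1 := schwartz_kern s1.
have h xi : fourier_inv (fun x => kern m2 (- x)) xi = fcR%:C * m2 xi.
  rewrite fourier_inv_opp// -fourier_oppE opprK -(fourier_inversion xi s2) /fourier.
  set I := cintegral (fun x => _ * fourier_inv m2 x).
  have e : cintegral (fun x => cis (- dotv x xi) * kern m2 x) = fcR%:C * I.
    apply: (eq_trans _ (cintZ fcR%:C _)).
      by apply: eq_cint => t; rewrite /kern mulrCA.
    exact: (cisN_integrable xi (schwartz_fourier_inv s2)).
  by rewrite e -/fcR mulrCA.
have e := fourier_multiplier (- y) s1 (schwartz_opp sk2).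
transitivity (cintegral (fun x => kern m2 (- x) * kern m1 (x - - y))).
  have ic := convol_integrable y sk1 (schwartz_cvmeas sk2) (schwartz_rapid sk2).
  apply: (eq_trans (cintegral_reflect 0 ic)).
  apply: eq_cint => t; rewrite sub0r.
  by congr (_ * kern m1 _); rewrite !opprK addrC.
rewrite -e; have -> : (fun xi => m1 xi * fourier_inv (fun x => kern m2 (- x)) xi) =
    (fun xi => fcR%:C * (m1 xi * m2 xi)).
  by apply/funext => xi; rewrite h mulrCA.
rewrite fourier_oppE /kern /fourier_inv mulrCA; congr (_ * _).
apply: (eq_trans _ (cintZ fcR%:C (cis_integrable y (schwartzM s1 s2)))).
by apply: eq_cint => t; rewrite mulrCA.
Qed.

(** The inversion theorem at the origin. *)
Lemma cintegral_kern m : schwartz m -> cintegral (kern m) = m 0.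
Proof.
move=> sm; rewrite -(fourier_inversion 0 sm) /fourier.
have sf := schwartz_cintegrable (schwartz_fourier_inv sm).
transitivity (fcR%:C * cintegral (fourier_inv m)); first exact: (cintZ fcR%:C sf).
congr (_ * cintegral _); apply/funext => x.
by rewrite dotvC -(scale0r (0 : 'rV[R]_d)) dotvZl mul0r oppr0 cis0 mul1r.
Qed.

Lemma kern_dilation m (a : R) z : schwartz m -> 0 < a ->
  kern (fun xi => m (a^-1 *: xi)) z = (a ^+ d)%:C * kern m (a *: z).
Proof.
move=> sm a0; have na0 : a != 0 by rewrite gt_eqF.
have nv0 : a^-1 != 0 by rewrite invr_eq0.
rewrite /kern /fourier_inv -/fcR.
have ic := cis_integrable (a *: z) sm.
rewrite (cintegral_aff 0 nv0 ic) ger0_norm ?invr_ge0 ?ltW//.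
have -> : (fun x => cis (dotv (a *: z) (a^-1 *: x + 0)) * m (a^-1 *: x + 0)) =
          (fun x => cis (dotv z x) * m (a^-1 *: x)).
  apply/funext => x; rewrite addr0 dotvZl (dotvC z) dotvZl mulrA mulfV// mul1r.
  by rewrite dotvC.
have alg (b c k I : R[i]) : b * c = 1 -> k * (k * I) = b * (k * (k * (c * I))).
  by move=> bc; transitivity ((b * c) * (k * (k * I))); [rewrite bc mul1r|ring].
apply: alg; rewrite -real_complexM exprVn mulfV// expf_neq0//.
Qed.

End Kernels.

(** * Pairing a tempered distribution with a convolution *)
Section Cut.
Context {R : realType} {d : nat}.
Implicit Types (x y h : 'rV[R]_d) (g : 'rV[R]_d -> R[i]) (P : pred 'rV[int]_d).
Local Notation mu := (@lebesgue_tuple R d).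
Local Notation row := (@row_of_tuple R d).

Definition cut (e : R) P g : 'rV[R]_d -> R[i] :=
  fun x => if P (floorv e x) then g x else 0.

Lemma cutE e P g x : cut e P g x = (P (floorv e x))%:R%:C * g x.
Proof. by rewrite /cut; case: (P _); rewrite /= ?mul1r// mul0r. Qed.

Lemma normc_cut_le e P g x : normc (cut e P g x) <= normc (g x).
Proof. by rewrite /cut; case: (P _); rewrite ?Normc.normc0// normc_ge0. Qed.

Lemma cvmeas_cut e P g : cvmeas g -> cvmeas (cut e P g).
Proof.
move=> mg; rewrite /cvmeas; under eq_fun do rewrite cutE.
apply: cmeasM => //; apply: cmeas_real.
exact: (@measurable_fun_floorv _ _ _ _ e row _ _ (fun k => (P k)%:R : R) coordmeas_row).
Qed.

Lemma rapid_cut e P g : rapid g -> rapid (cut e P g).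
Proof.
move=> rg N; have [B hB] := rg N; exists B => x; apply: le_trans (hB x).
by rewrite ler_wpM2l ?brX_ge0 ?normc_cut_le.
Qed.

Lemma floorv_close (e : R) x i : 0 < e ->
  `|x 0 i - e * (floorv e x 0 i)%:~R| <= e.
Proof.
move=> e0; rewrite mxE; have /andP[h1 h2] := floor_itv (x 0 i / e).
move: h1 h2; rewrite intrD ler_pdivlMr// ltr_pdivrMr// mulrDl mul1r => h1 h2.
by rewrite mulrC ger0_norm ?subr_ge0// lerBlDl ltW.
Qed.

End Cut.

Section Pairing.
Context {R : realType} {d : nat}.
Implicit Types (x y z h : 'rV[R]_d) (g : 'rV[R]_d -> R[i]) (l : seq 'I_d).
Local Notation mu := (@lebesgue_tuple R d).
Local Notation row := (@row_of_tuple R d).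
Variables (T : @functional R d) (k : 'rV[R]_d -> R[i]).
Hypotheses (hT : tempered T) (sk : schwartz k).

Definition pairing : 'rV[R]_d -> R[i] := fun x => T (fun y => k (y - x)).

Lemma shift_diff_bound N B l x y h : sbound N.+1 k B -> (size l <= N)%N ->
  \sum_i `|h 0 i| <= 1 ->
  br y ^+ N * normc (partials l k (y - (x + h)) - partials l k (y - x)) <=
  2 * 2 ^+ N * B * br x ^+ N * \sum_i `|h 0 i|.
Proof.
move=> kB lN h1; have B0 := sbound_ge0 kB.
have yN0 : 0 < br y ^+ N by exact: brX_gt0.
rewrite mulrC -ler_pdivlMr//.
have -> : 2 * 2 ^+ N * B * br x ^+ N * (\sum_i `|h 0 i|) / br y ^+ N =
  2 * ((2 ^+ N * B * br x ^+ N) / br y ^+ N) * (\sum_i `|h 0 i|) by ring.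
have e : y - (x + h) = (y - x) + (- h) by rewrite opprD addrA.
have sN : \sum_i `|(- h) 0 i| = \sum_i `|h 0 i|.
  by apply: eq_bigr => i _; rewrite mxE normrN.
rewrite e -sN; apply: (clipschitz_box (fun i => schwartz_cder i (schwartz_partials l sk))).
move=> i z hz; rewrite ler_pdivlMr//.
have zB := kB (i :: l) z lN.
have yz : br y <= br x * (2 * br z).
  have -> : y = x + ((y - x - z) + z) by rewrite subrK addrC subrK.
  apply: le_trans (brD _ _) _; rewrite ler_wpM2l ?br_ge0//.
  apply: le_trans (brD _ _) _; rewrite ler_wpM2r ?br_ge0//.
  rewrite -[2]/(1 + 1) lerD2l (le_trans _ h1)//.
  apply: ler_sum => j _; have := hz j; rewrite !mxE normrN => /(le_trans _); apply.
  by rewrite -normrN opprB.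
have yzN : br y ^+ N <= br x ^+ N * (2 ^+ N * br z ^+ N).
  by rewrite -!exprMn lerXn2r ?nnegrE ?br_ge0// !mulr_ge0 ?br_ge0.
rewrite mulrC (le_trans (ler_wpM2r (normc_ge0 _) yzN))//.
have -> : br x ^+ N * (2 ^+ N * br z ^+ N) * normc (partial i (partials l k) z) =
  (br x ^+ N * 2 ^+ N) * (br z ^+ N * normc (partial i (partials l k) z)) by ring.
have -> : 2 ^+ N * B * br x ^+ N = (br x ^+ N * 2 ^+ N) * B by ring.
rewrite ler_wpM2l ?mulr_ge0 ?brX_ge0 ?exprn_ge0//.
apply: le_trans zB; rewrite ler_wpM2r ?normc_ge0//.
by rewrite exprSr ler_peMr ?brX_ge0 ?br_ge1.
Qed.

Lemma schwartz_shiftB x : schwartz (fun y => k (y - x)).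
Proof. exact: schwartz_shift. Qed.

Lemma tempered0 : T (fun=> 0) = 0.
Proof.
have := tempered_lin (-1) hT (@schwartz0 R d) (@schwartz0 R d).
under eq_fun do rewrite mulr0 addr0.
by rewrite mulN1r addNr.
Qed.

Lemma temperedB g1 g2 : schwartz g1 -> schwartz g2 ->
  T (fun x => g1 x - g2 x) = T g1 - T g2.
Proof.
move=> s1 s2; have := tempered_lin (-1) hT s2 s1.
rewrite mulN1r addrC => <-; congr T; apply/funext => x.
by rewrite mulN1r addrC.
Qed.

Lemma temperedZ (a : R[i]) g : schwartz g -> T (fun x => a * g x) = a * T g.
Proof.
move=> sg; have := tempered_lin a hT sg (@schwartz0 R d).
by rewrite tempered0 addr0 => <-; congr T; apply/funext => x; rewrite addr0.
Qed.

Definition l1w N g : R := vint (fun x => br x ^+ N * normc (g x)).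

(** Each quantity is the value of [T] at a Schwartz function, a seminorm of which
    is estimated.  The last bound says that [g] concentrated near [x0] acts like
    a point mass. *)
Lemma pairing_bounds : exists N K, [/\ 0 <= K,
  forall x, normc (pairing x) <= K * br x ^+ N,
  forall x h, \sum_i `|h 0 i| <= 1 ->
    normc (pairing (x + h) - pairing x) <= K * br x ^+ N * \sum_i `|h 0 i|,
  forall g, cvmeas g -> rapid g -> normc (T (convol k g)) <= K * l1w N g &
  forall g x0 de, cvmeas g -> rapid g -> de <= 1 ->
    (forall x, g x != 0 -> \sum_i `|(x0 - x) 0 i| <= de) ->
    normc (T (convol k g) - cintegral g * pairing x0) <= K * de * l1w N g].
Proof.
have [N [C [C0 hC]]] := tempered_bound hT.
have [B kB] := schwartz_sbound N.+1 sk; have B0 := sbound_ge0 kB.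
have B1 : B <= 2 * 2 ^+ N * B.
  by rewrite ler_peMl// -exprS exprn_ege1// ler1n.
have kB' l z : (size l <= N)%N -> br z ^+ N * normc (partials l k z) <= 2 * 2 ^+ N * B.
  move=> lN; apply: le_trans B1; apply: le_trans (kB l z (leqW lN)).
  by rewrite ler_wpM2r ?normc_ge0// exprSr ler_peMr ?brX_ge0 ?br_ge1.
exists N, (C * (2 * 2 ^+ N * B)); split.
- by rewrite !mulr_ge0 ?exprn_ge0.
- move=> x; rewrite -mulrA; apply: hC; first exact: schwartz_shiftB.
  move=> l y lN; rewrite partials_shift//.
  have h : br y ^+ N <= br x ^+ N * br (y - x) ^+ N.
    rewrite -exprMn lerXn2r ?nnegrE ?mulr_ge0 ?br_ge0//.
    by rewrite -{1}(subrK x y) mulrC brD.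
  apply: le_trans (ler_wpM2r (normc_ge0 _) h) _.
  by rewrite -[leLHS]mulrA [leRHS]mulrC ler_wpM2l ?brX_ge0// kB'.
- move=> x h h1; rewrite /pairing -temperedB; try exact: schwartz_shiftB.
  rewrite -!mulrA; apply: hC.
    by apply: schwartzB; exact: schwartz_shiftB.
  move=> l y lN; rewrite partialsB; try exact: schwartz_shiftB.
  rewrite !partials_shift//; have := shift_diff_bound x y kB lN h1.
  by rewrite -!mulrA.
- move=> g mg rg; rewrite -mulrA; apply: hC; first exact: schwartz_convol.
  move=> l y lN; rewrite partials_convol//.
  by apply: normc_convol_le => //; [exact: schwartz_partials|move=> z; exact: kB'].
move=> g x0 de mg rg de1 supp.
have sc : schwartz (convol k g) by exact: schwartz_convol.
have ss := schwartzZ (cintegral g) (schwartz_shiftB x0).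
rewrite /pairing -temperedZ; last exact: schwartz_shiftB.
rewrite -temperedB//.
have -> : C * (2 * 2 ^+ N * B) * de * l1w N g =
  C * (2 * 2 ^+ N * B * de * l1w N g) by ring.
apply: hC; first exact: schwartzB.
move=> l y lN; rewrite partialsB// partials_convol//.
have -> : partials l (fun x => cintegral g * k (x - x0)) =
          fun x => cintegral g * partials l k (x - x0).
  by rewrite partialsZ ?partials_shift//; exact: schwartz_shiftB.
have sl := schwartz_partials l sk.
have ig := rapid_cintegrable mg rg.
have i1 := convol_integrable y sl mg rg.
have e : convol (partials l k) g y - cintegral g * partials l k (y - x0) =
   cintegral (fun x => g x * (partials l k (y - x) - partials l k (y - x0))).
  rewrite mulrC.
  have := cintB i1 (cintbleZ (partials l k (y - x0)) ig).
  rewrite cintZ// => <-; apply: eq_cint => t.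
  by rewrite mulrBr [X in _ - X]mulrC.
rewrite e -{1}[br y ^+ N]ger0_norm ?brX_ge0// -normc_real -Normc.normcM.
have i2 : cintegrable (fun x => g x * (partials l k (y - x) - partials l k (y - x0))).
  have := cintbleB i1 (cintbleZ (partials l k (y - x0)) ig).
  congr cintble; apply/funext => t.
  by rewrite mulrBr [X in _ - X]mulrC.
have i3 := rapid_vintble N mg rg.
rewrite cintegralE -cintZ// /l1w -rintZ//.
apply: normc_cint_le; [exact: cintbleZ|exact: rintbleZ|].
move=> t; set x := row t; rewrite !Normc.normcM normc_real ger0_norm ?brX_ge0//.
have [->|gx] := eqVneq (g x) 0; first by rewrite Normc.normc0 mul0r !mulr0.
have sx := supp _ gx; have := shift_diff_bound x y kB lN (le_trans sx de1).
rewrite (addrC x) subrK normcB_sym => hb.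
rewrite mulrCA mulrC (le_trans (ler_wpM2r (normc_ge0 _) hb))//.
have -> : 2 * 2 ^+ N * B * br x ^+ N * (\sum_i `|(x0 - x) 0 i|) * normc (g x) =
  (2 * 2 ^+ N * B) * (br x ^+ N * normc (g x)) * \sum_i `|(x0 - x) 0 i| by ring.
rewrite [leRHS]mulrAC; apply: ler_wpM2l => //.
apply: mulr_ge0; last by rewrite mulr_ge0 ?brX_ge0 ?normc_ge0.
by rewrite !mulr_ge0 ?exprn_ge0.
Qed.

Lemma temperedD g1 g2 : schwartz g1 -> schwartz g2 ->
  T (fun x => g1 x + g2 x) = T g1 + T g2.
Proof.
move=> s1 s2; have := tempered_lin 1 hT s1 s2; rewrite mul1r => <-.
by congr T; apply/funext => x; rewrite mul1r.
Qed.

Lemma pairing_ccontinuous : ccontinuous pairing.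
Proof.
have [N [K [K0 _ GL _ _]]] := pairing_bounds.
by apply: clipschitz_continuous => x; exists (K * br x ^+ N) => h; exact: GL.
Qed.

Lemma pairing_growth : exists N K, forall x, normc (pairing x) <= K * br x ^+ N.
Proof. by have [N [K [_ h _ _ _]]] := pairing_bounds; exists N, K. Qed.

Lemma pairing_cintegrable g : cvmeas g -> rapid g ->
  cintegrable (fun x => g x * pairing x).
Proof.
move=> mg rg; have [N [K h]] := pairing_growth.
have ig := rapid_vintble N mg rg.
apply: (@cintble_le _ _ _ mu _ (fun t => K * (br (row t) ^+ N * normc (g (row t))))).
- apply: cmeasM => //.
  exact: (cmeas_ccontinuous coordmeas_row pairing_ccontinuous).
- move=> t; rewrite Normc.normcM mulrC mulrA.
  by apply: ler_wpM2r; [exact: normc_ge0|exact: h].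
- exact: rintbleZ.
Qed.

(** The failure of [T] to commute with the integral defining the convolution. *)
Definition defect g : R[i] := T (convol k g) - cintegral (fun x => g x * pairing x).

Lemma defectD g1 g2 : cvmeas g1 -> rapid g1 -> cvmeas g2 -> rapid g2 ->
  defect (fun x => g1 x + g2 x) = defect g1 + defect g2.
Proof.
move=> m1 r1 m2 r2; rewrite /defect.
have -> : convol k (fun x => g1 x + g2 x) = fun y => convol k g1 y + convol k g2 y.
  apply/funext => y; rewrite /convol.
  apply: (eq_trans _ (cintD (convol_integrable y sk m1 r1) (convol_integrable y sk m2 r2))).
  by apply: eq_cint => t; rewrite mulrDl.
have -> : cintegral (fun x => (g1 x + g2 x) * pairing x) =
  cintegral (fun x => g1 x * pairing x) + cintegral (fun x => g2 x * pairing x).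
  apply: (eq_trans _ (cintD (pairing_cintegrable m1 r1) (pairing_cintegrable m2 r2))).
  by apply: eq_cint => t; rewrite mulrDl.
rewrite temperedD; [|exact: schwartz_convol..].
by rewrite opprD addrACA.
Qed.

Lemma defect_bounds : exists N K, [/\ 0 <= K,
  forall g, cvmeas g -> rapid g -> normc (defect g) <= K * l1w N g &
  forall g x0 de, cvmeas g -> rapid g -> de <= 1 ->
    (forall x, g x != 0 -> \sum_i `|(x0 - x) 0 i| <= de) ->
    normc (defect g) <= K * de * l1w N g].
Proof.
have [N [K [K0 Gg GL b1 b2]]] := pairing_bounds.
exists N, (2 * K); split; first by rewrite mulr_ge0.
  move=> g mg rg; have ig := rapid_vintble N mg rg.
  rewrite -mulrA mulr_natl mulr2n /defect (le_trans (le_normcD _ _))// normcN.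
  rewrite lerD ?b1// -rintZ//; apply: normc_cint_le.
  - exact: pairing_cintegrable.
  - exact: rintbleZ.
  - move=> t; rewrite Normc.normcM mulrC mulrA.
    by apply: ler_wpM2r; [exact: normc_ge0|exact: Gg].
move=> g x0 de mg rg de1 supp; have ig := rapid_vintble N mg rg.
have i1 := rapid_cintegrable mg rg; have i2 := pairing_cintegrable mg rg.
have e : defect g = (T (convol k g) - cintegral g * pairing x0) -
    cintegral (fun x => g x * (pairing x - pairing x0)).
  have -> : cintegral (fun x => g x * (pairing x - pairing x0)) =
      cintegral (fun x => g x * pairing x) - pairing x0 * cintegral g.
    transitivity (cintegral (fun x => g x * pairing x) -
        cint mu (fun t => pairing x0 * g (row t))).
      apply: (eq_trans _ (cintB i2 (cintbleZ (pairing x0) i1))).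
      by apply: eq_cint => t; rewrite mulrBr [X in _ - X]mulrC.
    by congr (_ - _); exact: (cintZ (pairing x0) i1).
  by rewrite /defect opprB addrA (mulrC (cintegral g)) subrK.
have i3 : cintegrable (fun x => g x * (pairing x - pairing x0)).
  have := cintbleB i2 (cintbleZ (pairing x0) i1); congr cintble; apply/funext => t.
  by rewrite mulrBr [X in _ - X]mulrC.
have -> : 2 * K * de * l1w N g = K * de * l1w N g + K * de * l1w N g by ring.
rewrite e (le_trans (le_normcD _ _))// normcN lerD//; first exact: b2.
rewrite -rintZ//; apply: normc_cint_le => //; first exact: rintbleZ.
move=> t; set x := row t; rewrite Normc.normcM.
have [->|gx] := eqVneq (g x) 0; first by rewrite Normc.normc0 mul0r !mulr0.
have sx := supp _ gx; have := GL x (x0 - x) (le_trans sx de1).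
rewrite (addrC x) subrK normcB_sym => h; rewrite mulrC.
apply: le_trans (ler_wpM2r (normc_ge0 _) h) _.
have -> : K * br x ^+ N * (\sum_i `|(x0 - x) 0 i|) * normc (g x) =
   (K * (br x ^+ N * normc (g x))) * \sum_i `|(x0 - x) 0 i| by ring.
have -> : K * de * (br x ^+ N * normc (g x)) = (K * (br x ^+ N * normc (g x))) * de by ring.
by apply: ler_wpM2l => //; rewrite !mulr_ge0 ?brX_ge0 ?normc_ge0.
Qed.

Lemma l1w_cut_le N e P g : cvmeas g -> rapid g -> l1w N (cut e P g) <= l1w N g.
Proof.
move=> mg rg; apply: rint_le.
- by apply: (rapid_vintble N); [exact: cvmeas_cut|exact: rapid_cut].
- exact: (rapid_vintble N).
- by move=> t; rewrite ler_wpM2l ?brX_ge0 ?normc_cut_le.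
Qed.

(** As a function of the set to which [g] is restricted, the defect is additive
    and bounded by a finite measure, and on cubes of side [e] by a multiple of
    [e] times this measure.  Summing over all cubes and letting [e] tend to 0
    shows that it vanishes. *)
Lemma defect0 g : cvmeas g -> rapid g -> defect g = 0.
Proof.
move=> mg rg; have [N [K [K0 b1 b2]]] := defect_bounds.
have q0 : 0 <= l1w N g.
  by apply: rint_ge0 => t; rewrite mulr_ge0 ?brX_ge0 ?normc_ge0.
suff small e : 0 < e -> d%:R * e <= 1 -> normc (defect g) <= K * (d%:R * e) * l1w N g.
  apply: Normc.eq0_normc; apply/eqP; rewrite eq_le normc_ge0 andbT.
  have h : (fun m => (K * l1w N g) * harmonic m) @ \oo --> (0 : R).
    by rewrite -(mulr0 (K * l1w N g)); apply: cvgMr; exact: cvg_harmonic.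
  apply: (cvg_ge_cst h) => m.
  pose e : R := (d.+1%:R)^-1 * harmonic m.
  have h1 : 0 < harmonic m :> R by exact: harmonic_gt0.
  have h2 : d%:R * e <= harmonic m.
    rewrite /e mulrA; apply: ler_piMl; first exact: ltW.
    by rewrite ler_pdivrMr// mul1r ler_nat.
  have h3 : harmonic m <= 1 :> R by rewrite /= invf_le1// ler1n.
  apply: le_trans (small e _ (le_trans h2 h3)) _; first by rewrite mulr_gt0.
  by rewrite -mulrA (mulrC _ (l1w N g)) mulrA ler_wpM2l// mulr_ge0.
move=> e0 de1.
(* the cubes are exhausted along the enumeration of their indices; [P3] is the
   remainder, whose measure tends to 0 *)
pose P1 (n : nat) : pred 'rV[int]_d := fun m => (pickle m < n)%N.
pose P2 (n : nat) : pred 'rV[int]_d := fun m => (pickle m == n)%N.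
pose P3 (n : nat) : pred 'rV[int]_d := fun m => ~~ (pickle m < n)%N.
have mc P : cvmeas (cut e P g) by exact: cvmeas_cut.
have rc P : rapid (cut e P g) by exact: rapid_cut.
have iw P := rapid_vintble N (mc P) (rc P).
have c0 n : normc (defect (cut e (P2 n) g)) <= K * (d%:R * e) * l1w N (cut e (P2 n) g).
  pose x0 : 'rV[R]_d := if unpickle n is Some m then e *: map_mx (fun z : int => z%:~R) m else 0.
  apply: (b2 _ x0) => // x; rewrite /cut /P2.
  case: (pickle (floorv e x) =P n) => [xn _|_]; last by rewrite eqxx.
  have x0E : x0 = e *: map_mx (fun z : int => z%:~R) (floorv e x).
    by rewrite /x0 -xn pickleK.
  have -> : d%:R * e = \sum_(i < d) e by rewrite sumr_const card_ord mulr_natl.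
  apply: ler_sum => i _; rewrite x0E -normrN !mxE opprB.
  by have := @floorv_close R d e x i e0; rewrite mxE.
have cS n : cut e (P1 n.+1) g = fun x => cut e (P1 n) g x + cut e (P2 n) g x.
  apply/funext => x; rewrite /cut /P1 /P2 ltnS leq_eqVlt.
  by case: ltngtP => //=; rewrite ?addr0 ?add0r.
have c1 n : normc (defect (cut e (P1 n) g)) <= K * (d%:R * e) * l1w N (cut e (P1 n) g).
  elim: n => [|n IH].
    have z0 : cut e (P1 0%N) g = fun=> 0 by apply/funext => x.
    apply: le_trans (b1 _ (mc _) (rc _)) _; rewrite z0.
    have -> : l1w N (fun=> 0) = 0.
      rewrite /l1w /vint; under eq_fun do rewrite Normc.normc0 mulr0.
      exact: rint0.
    by rewrite !mulr0.
  have -> : l1w N (cut e (P1 n.+1) g) = l1w N (cut e (P1 n) g) + l1w N (cut e (P2 n) g).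
    rewrite -rintD; [|exact: iw..]; congr rint; apply/funext => t.
    rewrite -mulrDr; congr (_ * _); rewrite cS /cut /P1 /P2.
    by case: ltngtP; rewrite ?Normc.normc0 ?addr0 ?add0r ?Normc.normc0.
  rewrite {1}cS defectD// (le_trans (le_normcD _ _))// mulrDr lerD//.
have c2 n : normc (defect g) <= K * (d%:R * e) * l1w N g + K * l1w N (cut e (P3 n) g).
  have gE : g = fun x => cut e (P1 n) g x + cut e (P3 n) g x.
    by apply/funext => x; rewrite /cut /P3 /P1; case: ltnP => _ /=; rewrite ?addr0 ?add0r.
  rewrite [in leLHS]gE defectD// (le_trans (le_normcD _ _))// lerD//; last exact: b1.
  apply: le_trans (c1 n) _; apply: ler_wpM2l; last exact: l1w_cut_le.
  by apply: mulr_ge0 => //; apply: mulr_ge0 => //; exact: ltW.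
have h : (fun n => K * (d%:R * e) * l1w N g + K * l1w N (cut e (P3 n) g)) @ \oo -->
    K * (d%:R * e) * l1w N g.
  rewrite -[X in _ --> X]addr0; apply: cvgD; first exact: cvg_cst.
  rewrite -(mulr0 K); apply: cvgMr.
  apply: (@rint_cvg0 _ _ _ mu _ (fun t => br (row t) ^+ N * normc (g (row t)))).
  - by move=> n; exact: rintble_meas (iw _).
  - exact: rapid_vintble.
  - move=> n t; rewrite ger0_norm ?mulr_ge0 ?brX_ge0 ?normc_ge0//.
    by rewrite ler_wpM2l ?brX_ge0 ?normc_cut_le.
  - move=> t; apply: cvg_near_cst; near=> n.
    have : (pickle (floorv e (row t)) < n)%N by near: n; exact: nbhs_infty_gt.
    by rewrite /cut /P3 => -> /=; rewrite Normc.normc0 mulr0.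
exact: (cvg_ge_cst h).
Unshelve. all: by end_near. Qed.

Lemma pairing_integral g : cvmeas g -> rapid g ->
  T (convol k g) = cintegral (fun x => g x * pairing x).
Proof. by move=> mg rg; apply/eqP; rewrite -subr_eq0; apply/eqP; exact: defect0. Qed.

End Pairing.

(** * Uniqueness of the representing function *)
Section Uniqueness.
Context {R : realType} {d : nat}.
Implicit Types (x y z : 'rV[R]_d) (g f : 'rV[R]_d -> R[i]).
Local Notation mu := (@lebesgue_tuple R d).
Local Notation row := (@row_of_tuple R d).

Definition boxf (e : R) x : R := \prod_i \1_`[0, e[%classic (x 0 i).

Lemma boxf_int (e : R) : 0 <= e -> vintble (boxf e) /\ vint (boxf e) = e ^+ d.
Proof.
move=> e0.
have i1 : rintble (@lebesgue_measure R) (\1_`[0, e[%classic : R -> R).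
  exact: (@integrable_indic_itv R 0 e true true).
have i2 : rint (@lebesgue_measure R) (\1_`[0, e[%classic : R -> R) = e.
  apply: EFin_inj; rewrite rintE//.
  transitivity (@lebesgue_measure R `[0, e[%classic); first by rewrite integral_indic// setIT.
  rewrite lebesgue_measure_itv/=.
  by rewrite lte_fin; case: ltP => [_|/(conj e0)/andP/le_anti <-//]; rewrite -EFinB subr0.
have [h1 h2] := @rint_prodE R d (fun=> \1_`[0, e[%classic) (fun=> i1).
rewrite /vintble /vint /boxf; under eq_fun do under eq_bigr do rewrite mxE.
split; first exact: h1.
by rewrite h2 i2 prodr_const card_ord.
Qed.

Lemma mxnorm_le_eucl x : `|x| <= eucl x.
Proof.
rewrite [leLHS]/Num.norm/= mx_normrE; apply: bigmax_le => [|[i j] _].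
  exact: eucl_ge0.
by rewrite ord1 coord_le_eucl.
Qed.

(** If [r x0] were nonzero, [r] would be close to it on the support of a
    sufficiently narrow bump around [x0], and the integral could not vanish. *)
Lemma bump_separates (r b : 'rV[R]_d -> R) x0 :
  continuous r -> (forall x, 0 <= b x) -> vintble b -> 0 < vint b ->
  (forall x, 3 / 2 <= eucl x -> b x = 0) ->
  (forall n : nat, vintble (fun x => r x * b (n.+1%:R *: x + - (n.+1%:R *: x0))) /\
    vint (fun x => r x * b (n.+1%:R *: x + - (n.+1%:R *: x0))) = 0) ->
  r x0 = 0.
Proof.
move=> cr b0 ib vb bs h; apply/eqP; apply: contraT => c0.
set c := r x0 in c0 *.
have FF : Filter (nbhs x0) by exact: nbhs_filter.
have c20 : 0 < `|c| / 2 by rewrite divr_gt0// normr_gt0.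
have := (@cvgrPdist_le _ _ _ (nbhs x0) FF r (r x0)).1 (cr x0) _ c20.
move=> /nbhs_ballP[e /= e0 he].
have [n hn] : exists n : nat, 3 / 2 / e < n.+1%:R.
  exists (Num.trunc (3 / 2 / e)); have : 0 <= 3 / 2 / e by rewrite divr_ge0// ltW.
  by move=> /truncn_itv/andP[].
have [h1 h2] := h n.
have n0 : n.+1%:R != 0 :> R by [].
pose bn x := b (n.+1%:R *: x + - (n.+1%:R *: x0)).
have ibn : vintble bn by exact: vintble_aff.
have vbn : 0 < vint bn.
  have := vint_aff (- (n.+1%:R *: x0)) n0 ib; rewrite -/bn => eb.
  move: vb; rewrite eb pmulr_rgt0// exprn_gt0// normr_gt0//.
have : vint (fun x => c ^+ 2 / 2 * bn x) <= vint (fun x => c * (r x * bn x)).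
  apply: rint_le; [exact: rintbleZ|exact: rintbleZ|move=> t].
  set x := row t; rewrite mulrA /bn.
  have [hx|hx] := leP (3 / 2) (eucl (n.+1%:R *: x + - (n.+1%:R *: x0))).
    by rewrite bs// !mulr0.
  apply: ler_wpM2r; first exact: b0.
  have xe : `|x0 - x| < e.
    rewrite distrC (le_lt_trans (mxnorm_le_eucl _))//.
    move: hx; rewrite -scalerBr euclZ ger0_norm// => hx.
    rewrite -(ltr_pM2l (_ : 0 < n.+1%:R))// (lt_trans hx)//.
    by move: hn; rewrite ltr_pdivrMr.
  have xb : ball x0 e x by rewrite -ball_normE.
  have := he x xb; rewrite /= -/c.
  have [cp|cn] := leP 0 c.
    by rewrite (ger0_norm cp) ler_norml => /andP[? ?]; nra.
  by rewrite (ltr0_norm cn) ler_norml => /andP[? ?]; nra.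
have -> : vint (fun x => c ^+ 2 / 2 * bn x) = c ^+ 2 / 2 * vint bn by exact: rintZ.
have -> : vint (fun x => c * (r x * bn x)) = 0.
  transitivity (c * vint (fun x => r x * bn x)); first exact: rintZ.
  by rewrite h2 mulr0.
move=> hle.
have : 0 < c ^+ 2 / 2 * vint bn.
  by rewrite mulr_gt0// divr_gt0// exprn_even_gt0.
by rewrite ltNge hle.
Qed.

Lemma represents_unique (theta0 : 'rV[R]_d -> R[i]) (T : @functional R d) f1 f2 :
  resolution theta0 ->
  represents T f1 -> represents T f2 -> f1 = f2.
Proof.
move=> [s0 th1 th0] [c1 r1] [c2 r2].
(* [|theta0|^2] is a nonnegative Schwartz bump which is 1 near the origin *)
pose g x := theta0 x * (theta0 x)^*.
have sg : schwartz g by apply: schwartzM => //; exact: schwartz_conj.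
have gE x : g x = (normc (theta0 x) ^+ 2)%:C.
  rewrite /g; case: (theta0 x) => a b; apply: complex_ext; rewrite ?cReM ?cImM /=.
    by rewrite /Normc.normc sqr_sqrtr ?addr_ge0 ?sqr_ge0// mulrN opprK -!expr2.
  by rewrite mulrN mulrC addrC subrr.
pose b x := normc (theta0 x) ^+ 2.
have b0 x : 0 <= b x by exact: sqr_ge0.
have ib : vintble b.
  have [h _] := schwartz_cintegrable sg; move: h; congr integrable.
  by apply/funext => t /=; rewrite gE.
have bs x : 3 / 2 <= eucl x -> b x = 0.
  by move=> hx; rewrite /b th0// Normc.normc0 expr0n.
have vb : 0 < vint b.
  pose e : R := d.+1%:R^-1; have e0 : 0 < e by rewrite invr_gt0.
  have [i1 i2] := boxf_int (ltW e0).
  apply: (@lt_le_trans _ _ (vint (boxf e))); first by rewrite i2 exprn_gt0.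
  apply: rint_le => // t; set x := row t.
  have bx0 : 0 <= boxf e x <= 1.
    rewrite /boxf; elim/big_rec : _ => [|i u _ /andP[u0 u1]]; first by rewrite ler01 lexx.
    by rewrite indicE; case: (_ \in _); rewrite ?mul1r ?u0 ?u1// mul0r lexx ler01.
  have [in_box|] := pselect (forall i, x 0 i \in `[0, e[).
    suff -> : b x = 1 by case/andP: bx0.
    rewrite /b th1 ?Normc.normc1 ?expr1n// (le_trans (eucl_le_sum _))//.
    apply: (@le_trans _ _ (\sum_(i < d) e)).
      apply: ler_sum => i _; have := in_box i; rewrite in_itv/= => /andP[x0 xe].
      by rewrite ger0_norm// ltW.
    rewrite sumr_const card_ord -mulr_natl /e ler_pdivrMr// mul1r ler_nat//.
  move=> /existsNP[i /negP hi]; rewrite /boxf (bigD1 i)//= indicE memNset//.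
    by rewrite mul0r.
  by move=> /= h; rewrite h in hi.
apply/funext => x0.
have key (n : nat) : let gn x := g (n.+1%:R *: x + - (n.+1%:R *: x0)) in
   cintegrable (fun x => (f1 x - f2 x) * gn x) /\
   cintegral (fun x => (f1 x - f2 x) * gn x) = 0.
  move=> gn; have n0 : n.+1%:R != 0 :> R by [].
  have sgn : schwartz gn by exact: schwartz_aff.
  have [i1 e1] := r1 _ sgn; have [i2 e2] := r2 _ sgn.
  have eF : (fun x => (f1 x - f2 x) * gn x) = (fun x => f1 x * gn x - f2 x * gn x).
    by apply/funext => x; rewrite mulrBl.
  rewrite eF; split; first exact: (cintbleB i1 i2).
  rewrite cintegralE (cintB i1 i2); apply/eqP; rewrite subr_eq0; apply/eqP.
  exact: etrans (esym e1) e2.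
have cB (u v : 'rV[R]_d -> R) : continuous u -> continuous v ->
    continuous (fun x => u x - v x).
  by move=> cu cv x; exact: (continuousB (cu x) (cv x)).
have contRe : continuous (fun x => Re (f1 x - f2 x)).
  under eq_fun do rewrite cReD cReN.
  by apply: cB; [exact: (proj1 c1)|exact: (proj1 c2)].
have contIm : continuous (fun x => Im (f1 x - f2 x)).
  under eq_fun do rewrite cImD cImN.
  by apply: cB; [exact: (proj2 c1)|exact: (proj2 c2)].
apply/eqP; rewrite -subr_eq0; apply/eqP; apply: complex_ext.
  apply: (@bump_separates _ b x0 contRe b0 ib vb bs) => n.
  have [[h1 _] h2] := key n.
  have e x : Re (f1 x - f2 x) * b (n.+1%:R *: x + - (n.+1%:R *: x0)) =
     Re ((f1 x - f2 x) * g (n.+1%:R *: x + - (n.+1%:R *: x0))).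
    by rewrite gE cReM /= mulr0 subr0.
  rewrite /vintble /vint; under eq_fun do rewrite e; split; first exact: h1.
  exact: (congr1 (@complex.Re R) h2).
apply: (@bump_separates _ b x0 contIm b0 ib vb bs) => n.
have [[_ h1] h2] := key n.
have e x : Im (f1 x - f2 x) * b (n.+1%:R *: x + - (n.+1%:R *: x0)) =
   Im ((f1 x - f2 x) * g (n.+1%:R *: x + - (n.+1%:R *: x0))).
  by rewrite gE cImM /= mulr0 add0r.
rewrite /vintble /vint; under eq_fun do rewrite e; split; first exact: h1.
exact: (congr1 (@complex.Im R) h2).
Qed.

End Uniqueness.

(** * Littlewood-Paley blocks and their reproducing formula *)
Section Blocks.
Context {R : realType} {d : nat}.
Implicit Types (x y z : 'rV[R]_d) (g f m : 'rV[R]_d -> R[i]) (T : @functional R d).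
Local Notation mu := (@lebesgue_tuple R d).
Local Notation row := (@row_of_tuple R d).

Definition multiplied m T := dist_fourier_inv (dist_mul m (dist_fourier T)).

Definition filtered T m : 'rV[R]_d -> R[i] := pairing T (fun z => kern m (- z)).

Lemma multiplied_convol T m g : schwartz m -> schwartz g ->
  multiplied m T g = T (convol (fun z => kern m (- z)) g).
Proof.
move=> sm sg; rewrite /multiplied /dist_fourier_inv /dist_mul /dist_fourier.
congr T; apply/funext => y; rewrite (fourier_multiplier y sm sg).
by congr cintegral; apply/funext => x; rewrite opprB.
Qed.

(** The multiplied distribution is [T] composed with a convolution, and
    [pairing_integral] moves [T] under the integral.  This is the part of the
    Paley-Wiener-Schwartz theorem that identifies the representing function. *)
Lemma represents_filtered T m : tempered T -> schwartz m ->
  represents (multiplied m T) (filtered T m).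
Proof.
move=> hT sm; have sk := schwartz_opp (schwartz_kern sm).
split; first exact: pairing_ccontinuous.
move=> g sg; have mg := schwartz_cvmeas sg; have rg := schwartz_rapid sg.
have e : (fun x => filtered T m x * g x) = (fun x => g x * filtered T m x).
  by apply/funext => x; rewrite mulrC.
rewrite e multiplied_convol//; split; first exact: pairing_cintegrable.
exact: pairing_integral.
Qed.

Lemma dist_fun_filtered (theta0 : 'rV[R]_d -> R[i]) T m : resolution theta0 -> tempered T -> schwartz m ->
  dist_fun (multiplied m T) = filtered T m.
Proof.
move=> res hT sm; have h := represents_filtered hT sm.
by apply: xget_unique => // f hf; exact: (represents_unique res hf h).
Qed.

(** Convolution with [kern h] fixes [kern m] by [convol_kern], and [T] may be
    moved under the integral by [pairing_integral]. *)
Lemma filtered_reproducing T m h x : tempered T -> schwartz m -> schwartz h ->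
  (forall xi, h xi * m xi = m xi) ->
  cintegrable (fun y => kern h (x - y) * filtered T m y) /\
  filtered T m x = cintegral (fun y => kern h (x - y) * filtered T m y).
Proof.
move=> hT sm sh hm; have sk := schwartz_opp (schwartz_kern sm).
have sg : schwartz (fun y => kern h (x - y)).
  have n10 : (-1 : R) != 0 by rewrite oppr_eq0 oner_eq0.
  have := schwartz_aff x n10 (schwartz_kern sh); congr schwartz.
  by apply/funext => y; rewrite scaleN1r addrC.
have mg := schwartz_cvmeas sg; have rg := schwartz_rapid sg.
split; first exact: pairing_cintegrable.
rewrite -(pairing_integral hT sk mg rg) {1}/filtered /pairing; congr T.
apply/funext => w; rewrite opprB.
have -> : kern m (x - w) = convol (kern h) (kern m) (x - w).
  have hmE : (fun xi => h xi * m xi) = m by apply/funext.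
  by rewrite (convol_kern (x - w) sh sm) hmE.
have skm := schwartz_kern sm.
have ic := convol_integrable (x - w) (schwartz_kern sh) (schwartz_cvmeas skm) (schwartz_rapid skm).
rewrite /convol (cintegral_aff (- w) (oner_neq0 R) ic) normr1 expr1n mul1r.
congr cintegral; apply/funext => y.
have -> : x - w - (1 *: y - w) = x - y by rewrite scale1r opprB addrA subrK.
by rewrite scale1r opprB mulrC.
Qed.

Variable theta0 : 'rV[R]_d -> R[i].
Hypothesis res : resolution theta0.

Definition dilated (n : nat) : 'rV[R]_d -> R[i] := fun x => theta0 (2 ^- n *: x).

Lemma twoX_gt0 n : 0 < 2 ^+ n :> R. Proof. by rewrite exprn_gt0. Qed.

Lemma schwartz_dilated n : schwartz (dilated n).
Proof.
have [s0 _ _] := res.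
have n0 : 2 ^- n != 0 :> R by rewrite invr_eq0 gt_eqF// twoX_gt0.
have := schwartz_aff 0 n0 s0; congr schwartz.
by apply/funext => x; rewrite addr0.
Qed.

Lemma thetaE j x : theta theta0 j x =
  dilated j x - (if j is j'.+1 then dilated j' x else 0).
Proof. by case: j => [|j] //=; rewrite /dilated expr0 invr1 scale1r subr0. Qed.

Lemma schwartz_theta j : schwartz (theta theta0 j).
Proof.
have [s0 _ _] := res; case: j => [//|j].
by apply: schwartzB; exact: schwartz_dilated.
Qed.

(** Where [eucl (2 ^- j.+1 *: xi)] exceeds 1, both dilates in [theta theta0 j]
    vanish; elsewhere [dilated j.+1] is 1. *)
Lemma dilated_theta j xi : dilated j.+1 xi * theta theta0 j xi = theta theta0 j xi.
Proof.
have [_ th1 th0] := res.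
have ge0 n : 0 <= 2 ^- n :> R by rewrite invr_ge0 ltW// twoX_gt0.
have eS n : eucl (2 ^- n *: xi) = 2 * eucl (2 ^- n.+1 *: xi).
  by rewrite !euclZ !ger0_norm// exprS invfM mulrA mulrA mulfV// mul1r.
have [h|h] := leP (eucl (2 ^- j.+1 *: xi)) 1; first by rewrite /dilated th1// mul1r.
have d0 : dilated j xi = 0 by apply: th0; rewrite eS; lra.
rewrite thetaE d0 sub0r; case: j eS h d0 => [|j] eS h d0; first by rewrite oppr0 mulr0.
have -> : dilated j xi = 0 by apply: th0; rewrite eS eS; lra.
by rewrite oppr0 mulr0.
Qed.

Lemma block_filtered j T : tempered T -> block theta0 j T = filtered T (theta theta0 j).
Proof. by move=> hT; exact: (dist_fun_filtered res hT (schwartz_theta j)). Qed.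

(** At unit scale this one kernel reproduces the blocks of all indices. *)
Definition unit_kernel : 'rV[R]_d -> R[i] := kern (dilated 1).

Lemma schwartz_unit_kernel : schwartz unit_kernel.
Proof. by apply: schwartz_kern; exact: schwartz_dilated. Qed.

Lemma kern_dilated n k z :
  kern (dilated (n + k)) z = (2 ^+ (k * d))%:C * kern (dilated n) (2 ^+ k *: z).
Proof.
have e : dilated (n + k) = (fun xi => dilated n ((2 ^+ k)^-1 *: xi)).
  by apply/funext => xi; rewrite /dilated scalerA exprD invfM.
by rewrite e (kern_dilation z (schwartz_dilated n) (twoX_gt0 k)) -exprM.
Qed.

Definition unit_block j T : 'rV[R]_d -> R[i] := fun x => block theta0 j T (2 ^- j *: x).

(** The reproducing formula with multiplier [dilated j.+1], rescaled by [2^-j]: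
    the Jacobian cancels the factor in [kern_dilated]. *)
Lemma unit_block_reproducing j T x : tempered T ->
  cintegrable (fun y => unit_kernel (x - y) * unit_block j T y) /\
  unit_block j T x = cintegral (fun y => unit_kernel (x - y) * unit_block j T y).
Proof.
move=> hT.
have n0 : 2 ^- j != 0 :> R by rewrite invr_eq0 gt_eqF// twoX_gt0.
have [i1 e1] := filtered_reproducing (2 ^- j *: x) hT (schwartz_theta j)
  (schwartz_dilated j.+1) (dilated_theta j).
have i2 := cintegrable_aff 0 n0 i1; have e2 := cintegral_aff 0 n0 i1.
have c0 : (2 ^+ (j * d))%:C != 0 :> R[i].
  by rewrite (inj_eq (@complexI R)) gt_eqF// twoX_gt0.
have eF y : kern (dilated j.+1) (2 ^- j *: x - (2 ^- j *: y + 0)) *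
     filtered T (theta theta0 j) (2 ^- j *: y + 0) =
   (2 ^+ (j * d))%:C * (unit_kernel (x - y) * unit_block j T y).
  rewrite addr0 -scalerBr -add1n kern_dilated scalerA mulfV ?gt_eqF ?twoX_gt0//.
  by rewrite scale1r -mulrA /unit_block block_filtered.
have i3 : cintegrable (fun y => unit_kernel (x - y) * unit_block j T y).
  have eF' := funext eF; rewrite eF' in i2.
  have cancel_mul (w : R[i]) : ((2 ^+ (j * d))%:C)^-1 * ((2 ^+ (j * d))%:C * w) = w.
    by rewrite mulKf.
  have := cintbleZ ((2 ^+ (j * d))%:C)^-1 i2; congr cintble; apply/funext => t.
  exact: cancel_mul.
split => //; rewrite {1}/unit_block block_filtered// e1 e2.
have -> : cintegral (fun y => kern (dilated j.+1) (2 ^- j *: x - (2 ^- j *: y + 0)) *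
     filtered T (theta theta0 j) (2 ^- j *: y + 0)) =
  (2 ^+ (j * d))%:C * cintegral (fun y => unit_kernel (x - y) * unit_block j T y).
  apply: (eq_trans _ (cintZ (2 ^+ (j * d))%:C i3)).
  by apply: eq_cint => t; exact: eF.
rewrite mulrA -real_complexM ger0_norm ?invr_ge0 ?ltW ?twoX_gt0//.
by rewrite exprM exprVn mulVf ?mul1r// expf_neq0// gt_eqF// twoX_gt0.
Qed.

Lemma block_ccontinuous j T : tempered T -> ccontinuous (block theta0 j T).
Proof.
move=> hT; rewrite block_filtered//; apply: pairing_ccontinuous => //.
by apply: schwartz_opp; apply: schwartz_kern; exact: schwartz_theta.
Qed.

Lemma block_growth j T : tempered T ->
  exists N K, forall x, normc (block theta0 j T x) <= K * br x ^+ N.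
Proof.
move=> hT; rewrite block_filtered//; apply: pairing_growth => //.
by apply: schwartz_opp; apply: schwartz_kern; exact: schwartz_theta.
Qed.

End Blocks.

(** * A Plancherel-Polya-Nikolskii inequality *)
Section LocalAverages.
Context {R : realType} {d : nat}.
Implicit Types (x y z : 'rV[R]_d) (g u : 'rV[R]_d -> R[i]) (w : 'rV[R]_d -> R).
Local Notation mu := (@lebesgue_tuple R d).
Local Notation row := (@row_of_tuple R d).

Definition unit_cube (k : 'rV[int]_d) y : R := (floorv 1 y == k)%:R.

Lemma unit_cube_ge0 k y : 0 <= unit_cube k y. Proof. exact: ler0n. Qed.

Lemma measurable_unit_cube dX (X : measurableType dX) (v w : X -> 'rV[R]_d) :
  coordmeas v -> coordmeas w ->
  measurable_fun setT (fun t => unit_cube (floorv 1 (v t)) (w t)).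
Proof.
move=> mv mw.
have -> : (fun t => unit_cube (floorv 1 (v t)) (w t)) =
    \1_[set t | floorv 1 (w t) = floorv 1 (v t)].
  apply/funext => t; rewrite indicE /unit_cube; case: eqP => [e|e].
    by rewrite mem_set.
  by rewrite memNset.
apply: measurable_indic.
have -> : [set t | floorv 1 (w t) = floorv 1 (v t)] =
  \bigcup_n (if @unpickle 'rV[int]_d n is Some k then
    [set t | floorv 1 (w t) = k] `&` [set t | floorv 1 (v t) = k] else set0).
  apply/seteqP; split => t /=.
    by move=> e; exists (pickle (floorv 1 (v t))) => //; rewrite pickleK.
  by move=> [n _]; case: unpickle => [k|//] [/= -> ->].
apply: bigcup_measurable => n _; case: unpickle => [k|]; last exact: measurable0.
by apply: measurableI; exact: measurable_floorv.
Qed.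

Lemma measurable_unit_cube1 k : vmeas (unit_cube k).
Proof.
exact: (@measurable_fun_floorv _ _ _ _ 1 row _ _ (fun m => (m == k)%:R : R) coordmeas_row).
Qed.

(** The unit cubes are translates of the box [boxf 1]. *)
Lemma unit_cube_int k : (\int[mu]_t (unit_cube k (row t))%:E = 1)%E.
Proof.
pose b : 'rV[R]_d := map_mx (fun z : int => z%:~R) k.
have e y : unit_cube k y = boxf 1 (1 *: y + - b).
  have ei i : \1_(`[0, 1[%classic : set R) ((1 *: y - b) 0 i) = (floorv 1 y 0 i == k 0 i)%:R :> R.
    rewrite indicE; congr (nat_of_bool _)%:R; rewrite !mxE mul1r divr1.
    apply/idP/eqP => [/set_mem/=|<-].
      rewrite in_itv/= => /andP[h1 h2]; apply/eqP; rewrite floor_eq.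
      by apply/andP; split; rewrite ?intrD; lra.
    apply/mem_set; rewrite /= in_itv/=.
    have /andP[h1 h2] := floor_itv (y 0 i).
    by move: h1 h2; rewrite intrD => h1 h2; apply/andP; split; lra.
  rewrite /boxf; under eq_bigr do rewrite ei.
  rewrite /unit_cube; case: eqP => [->|ne].
    by rewrite big1// => i _; rewrite eqxx.
  have [i hi] : exists i, floorv 1 y 0 i != k 0 i.
    apply: contrapT => /forallNP h; apply: ne; apply/rowP => i.
    by apply/eqP; move/negP : (h i); rewrite negbK.
  by rewrite (bigD1 i)//= (negbTE hi) mul0r.
have [h1 h2] := @boxf_int R d 1 ler01.
have h3 := vintble_aff (- b) (oner_neq0 R) h1.
have h4 := vint_aff (- b) (oner_neq0 R) h1.
under eq_integral do rewrite e.
transitivity (vint (fun y => boxf 1 (1 *: y + - b)))%:E; first by rewrite [RHS]rintE.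
by move: h4; rewrite h2 normr1 !expr1n mul1r => <-.
Qed.

(** Averaging over the unit cube that contains [y]: a weight that is nearly
    constant on unit cubes only sees the local averages of [w]. *)
Lemma wt_local_le w (B : R) x : vmeas w -> (forall y, 0 <= w y) -> 0 <= B ->
  (forall k, (\int[mu]_t (unit_cube k (row t) * w (row t))%:E <= B%:E)%E) ->
  (\int[mu]_t (wt (x - row t) * w (row t))%:E <= (3 ^+ d * pi ^+ d * B)%:E)%E.
Proof.
move=> mw w0 B0 hB.
have mwt := rintble_meas (vintble_wtB x).
pose f (t : d.-tuple (measurableTypeR R) * d.-tuple (measurableTypeR R)) : \bar R :=
  (3 ^+ d * (wt (x - row t.2) * (unit_cube (floorv 1 (row t.2)) (row t.1) * w (row t.1))))%:E.
have m1 : coordmeas (fun t : d.-tuple (measurableTypeR R) * d.-tuple (measurableTypeR R) => row t.1).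
  exact: (coordmeas_comp coordmeas_row measurable_fst).
have m2 : coordmeas (fun t : d.-tuple (measurableTypeR R) * d.-tuple (measurableTypeR R) => row t.2).
  exact: (coordmeas_comp coordmeas_row measurable_snd).
have mf : measurable_fun setT f.
  apply/measurable_EFinP; apply: measurable_funM => //; apply: measurable_funM.
    exact: (measurableT_comp mwt measurable_snd).
  apply: measurable_funM; first exact: measurable_unit_cube.
  exact: (measurableT_comp mw measurable_fst).
have f0 t : (0 <= f t)%E.
  by rewrite lee_fin !mulr_ge0 ?exprn_ge0 ?wt_ge0 ?unit_cube_ge0.
apply: (@le_trans _ _ (\int[mu]_s \int[mu]_t f (s, t))%E).
  apply: ge0_le_integral => //=.
  - by move=> t _; rewrite lee_fin mulr_ge0 ?wt_ge0.
  - by apply/measurable_EFinP; exact: measurable_funM.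
  - exact: (measurable_fun_fubini_tonelli_F f mf f0).
  move=> s _.
  have -> : (wt (x - row s) * w (row s))%:E =
      (\int[mu]_t ((wt (x - row s) * w (row s))%:E * (unit_cube (floorv 1 (row s)) (row t))%:E))%E.
    rewrite ge0_integralZl//.
    - by rewrite unit_cube_int mule1.
    - by apply/measurable_EFinP; exact: measurable_unit_cube1.
    - by move=> t _; rewrite lee_fin unit_cube_ge0.
    - by rewrite lee_fin mulr_ge0 ?wt_ge0.
  apply: ge0_le_integral => //=.
  - by move=> t _; rewrite -EFinM lee_fin !mulr_ge0 ?wt_ge0 ?unit_cube_ge0.
  - apply/measurable_EFinP; apply: measurable_funM => //; exact: measurable_unit_cube1.
  - exact: (measurableT_comp mf (measurable_pair1 s)).
  move=> t _; rewrite /f /= -EFinM lee_fin /unit_cube eq_sym.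
  case: eqP => [e|_]; last by rewrite !mulr0 mul0r !mulr0.
  rewrite mulr1 mul1r mulrA ler_wpM2r//.
  have -> : x - row s = (x - row t) + (row t - row s) by rewrite addrA subrK.
  apply: wt_shift => i; rewrite !mxE.
  have := floor_itv (tnth t i / 1); have := floor_itv (tnth s i / 1).
  have ei : Num.floor (tnth s i / 1) = Num.floor (tnth t i / 1).
    by move/rowP : e => /(_ i); rewrite !mxE.
  by rewrite ei !divr1 intrD => /andP[? ?] /andP[? ?]; rewrite ler_norml; apply/andP; split; lra.
rewrite (fubini_tonelli f mf f0).
have -> : (3 ^+ d * pi ^+ d * B)%:E = (\int[mu]_t ((3 ^+ d * B)%:E * (wt (x - row t))%:E))%E.
  rewrite ge0_integralZl//.
  - rewrite -(rintE (vintble_wtB x)) -[rint _ _]/(vint (fun y => wt (x - y))) vint_wtB.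
    by rewrite -EFinM mulrAC.
  - by apply/measurable_EFinP.
  - by move=> t _; rewrite lee_fin wt_ge0.
  - by rewrite lee_fin mulr_ge0// exprn_ge0.
apply: ge0_le_integral => //=.
- by move=> t _; apply: integral_ge0.
- exact: (measurable_fun_fubini_tonelli_G f mf f0).
- apply/measurable_EFinP; exact: measurable_funM.
move=> t _.
have -> : (\int[mu]_s f (s, t) = \int[mu]_s ((3 ^+ d * wt (x - row t))%:E *
    (unit_cube (floorv 1 (row t)) (row s) * w (row s))%:E))%E.
  by apply: eq_integral => s _; rewrite /f -EFinM /= mulrA.
rewrite ge0_integralZl//.
- apply: le_trans (lee_wpmul2l _ (hB _)) _.
    by rewrite lee_fin mulr_ge0 ?wt_ge0// exprn_ge0.
  by rewrite -!EFinM mulrAC.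
- by apply/measurable_EFinP; apply: measurable_funM => //; exact: measurable_unit_cube1.
- by move=> s _; rewrite lee_fin mulr_ge0 ?unit_cube_ge0.
- by rewrite lee_fin mulr_ge0 ?wt_ge0// exprn_ge0.
Qed.

Definition reproduced (L u : 'rV[R]_d -> R[i]) := forall x,
  cintegrable (fun y => L (x - y) * u y) /\ u x = cintegral (fun y => L (x - y) * u y).

(** Where [a] exceeds [M], [a^r = a^p a^(r-p)] with a nonpositive last
    exponent. *)
Lemma powR_split (a M r p : R) : 0 < M -> 0 <= a -> 0 < r -> r <= p ->
  a `^ r <= M `^ r + M `^ (r - p) * a `^ p.
Proof.
move=> M0 a0 r0 rp; have [aM|Ma] := leP a M.
  apply: (@le_trans _ _ (M `^ r)); first by apply: ge0_ler_powR; rewrite ?nnegrE// ltW.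
  by rewrite lerDl mulr_ge0 ?powR_ge0.
apply: (@le_trans _ _ (M `^ (r - p) * a `^ p)); last by rewrite lerDr powR_ge0.
have ap : 0 < a by exact: lt_trans Ma.
have -> : a `^ r = a `^ (r - p) * a `^ p.
  by rewrite -powRD ?subrK// (gt_eqF ap) implybT.
rewrite ler_wpM2r ?powR_ge0//.
have -> : r - p = - (p - r) by rewrite opprB.
rewrite !powRN lef_pV2 ?posrE ?powR_gt0//.
by apply: ge0_ler_powR; rewrite ?nnegrE ?subr_ge0// ltW.
Qed.

Lemma vmeas_normc_powR u (r : R) : ccontinuous u -> vmeas (fun y => normc (u y) `^ r).
Proof.
move=> cu; apply: (measurableT_comp (@measurable_powR R r)).
exact: (cmeas_normc (cmeas_ccontinuous coordmeas_row cu)).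
Qed.

Lemma local_powR_le u (M r p : R) k : ccontinuous u -> 0 < M -> 0 < r -> r <= p ->
  (\int[mu]_t (unit_cube k (row t) * normc (u (row t)) `^ p)%:E <= (M `^ p)%:E)%E ->
  (\int[mu]_t (unit_cube k (row t) * normc (u (row t)) `^ r)%:E <= (2 * M `^ r)%:E)%E.
Proof.
move=> cu M0 r0 rp h.
have mp (s : R) : measurable_fun setT (fun t => unit_cube k (row t) * normc (u (row t)) `^ s).
  by apply: measurable_funM; [exact: measurable_unit_cube1|exact: vmeas_normc_powR].
have h0 (s : R) t : (0 <= (unit_cube k (row t) * normc (u (row t)) `^ s)%:E)%E.
  by rewrite lee_fin mulr_ge0 ?unit_cube_ge0 ?powR_ge0.
have mc := measurable_unit_cube1 k.
apply: (@le_trans _ _ (\int[mu]_t ((M `^ r)%:E * (unit_cube k (row t))%:E +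
   (M `^ (r - p))%:E * (unit_cube k (row t) * normc (u (row t)) `^ p)%:E))%E).
  apply: ge0_le_integral => //=.
  - by apply/measurable_EFinP.
  - apply: emeasurable_funD; apply/measurable_EFinP; apply: measurable_funM => //.
  move=> t _; rewrite -!EFinM -EFinD lee_fin mulrCA -[X in X + _]mulrC -mulrDr.
  by rewrite ler_wpM2l ?unit_cube_ge0// powR_split ?normc_ge0.
rewrite ge0_integralD//=.
- rewrite ge0_integralZl_EFin ?powR_ge0//=; last 2 first.
  - by move=> t _; rewrite lee_fin unit_cube_ge0.
  - by apply/measurable_EFinP.
  rewrite ge0_integralZl_EFin ?powR_ge0//=; last by apply/measurable_EFinP.
  rewrite unit_cube_int mule1 mulr_natl mulr2n EFinD leeD2l//.
  have -> : M `^ r = M `^ (r - p) * M `^ p.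
    by rewrite -powRD ?subrK// (gt_eqF M0) implybT.
  by rewrite EFinM lee_wpmul2l// lee_fin powR_ge0.
- by move=> t _; rewrite -EFinM lee_fin mulr_ge0 ?powR_ge0 ?unit_cube_ge0.
- by apply/measurable_EFinP; exact: measurable_funM.
- by move=> t _; rewrite mule_ge0// lee_fin powR_ge0.
- by apply/measurable_EFinP; exact: measurable_funM.
Qed.


Lemma normc_powR_split (a S r : R) (t : R) : 0 < r -> r < 1 -> 0 <= S -> 1 <= t -> 0 <= a ->
  a <= S * t -> a <= S `^ (1 - r) * t * a `^ r.
Proof.
move=> r0 r1 S0 t1 a0 aSt.
have r10 : 0 <= 1 - r by lra.
have t0 : 0 <= t by lra.
have e : a = a `^ (1 - r) * a `^ r.
  rewrite -powRD; last by rewrite subrK oner_eq0.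
  by rewrite subrK powRr1.
rewrite {1}e; apply: ler_wpM2r; first exact: powR_ge0.
apply: le_trans (_ : (S * t) `^ (1 - r) <= _).
  by apply: ge0_ler_powR; rewrite ?nnegrE// mulr_ge0.
rewrite powRM// ler_wpM2l ?powR_ge0// ler1_powR//; lra.
Qed.

(** The a priori bound [normc (u x) <= S * br (x - x0) ^+ m] is substituted into
    the reproducing formula only for the power [1 - r] of [u]; the remaining
    power [r] is integrated by [wt_local_le].  So the best [S] is bounded by a
    multiple of its own power [1 - r], hence [S ^ r] is bounded. *)
Lemma reproduced_powR_le L (r : R) m : schwartz L -> 0 < r -> r < 1 -> exists C : R, 0 <= C /\
  forall u (B : R), ccontinuous u -> reproduced L u ->
  (forall k, (\int[mu]_t (unit_cube k (row t) * normc (u (row t)) `^ r)%:E <= B%:E)%E) ->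
  (exists K, forall x, normc (u x) <= K * br x ^+ m) ->
  forall x0, normc (u x0) `^ r <= C * B.
Proof.
move=> sL r0 r1.
have [C [C0 hC]] := rapid_le_wt m (schwartz_rapid sL).
pose D : R := C * (3 ^+ d * pi ^+ d).
have D0 : 0 <= D by rewrite mulr_ge0// mulr_ge0// exprn_ge0// pi_ge0.
exists D; split=> // u B cu ru hB [K hK] x0.
have B0 : 0 <= B.
  rewrite -lee_fin; apply: le_trans (hB 0); apply: integral_ge0 => t _.
  by rewrite lee_fin mulr_ge0 ?unit_cube_ge0 ?powR_ge0.
have mur := vmeas_normc_powR r cu.
have K0 : 0 <= K.
  by have := le_trans (normc_ge0 _) (hK 0); rewrite pmulr_lge0// brX_gt0.
pose A := range (fun x => normc (u x) / br (x - x0) ^+ m).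
have A1 : A (normc (u x0) / br (x0 - x0) ^+ m) by exists x0.
have A2 : has_ubound A.
  exists (K * br x0 ^+ m) => _ [x _ <-]; rewrite ler_pdivrMr ?brX_gt0//.
  apply: le_trans (hK x) _; rewrite -mulrA ler_wpM2l// mulrC -exprMn.
  by rewrite lerXn2r ?nnegrE ?br_ge0 ?mulr_ge0 ?br_ge0// -{1}(subrK x0 x) brD.
set S := sup A.
have uS y : normc (u y) <= S * br (y - x0) ^+ m.
  by rewrite -ler_pdivrMr ?brX_gt0//; apply: ub_le_sup => //; exists y.
have S0 : 0 <= S.
  have := uS x0; rewrite subrr; move/(le_trans (normc_ge0 _)).
  by rewrite pmulr_lge0// brX_gt0.
have ux0 : normc (u x0) <= S.
  have := uS x0; rewrite subrr.
  have -> : br (0 : 'rV[R]_d) = 1.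
    by rewrite /br big1 ?addr0// => i _; rewrite mxE normr0.
  by rewrite expr1n mulr1.
have step x : normc (u x) <= S `^ (1 - r) * br (x - x0) ^+ m * (D * B).
  have [ig eu] := ru x.
  have wl := wt_local_le x mur (fun y => powR_ge0 (normc (u y)) r) B0 hB.
  have mw := rintble_meas (vintble_wtB x).
  have iw : rintble mu (fun t => wt (x - row t) * normc (u (row t)) `^ r).
    apply/integrableP; split; first by apply/measurable_EFinP; exact: measurable_funM.
    apply: le_lt_trans (ltry (3 ^+ d * pi ^+ d * B)); apply: le_trans wl.
    rewrite le_eqVlt; apply/orP; left; apply/eqP; apply: eq_integral => t _ /=.
    by rewrite ger0_norm// mulr_ge0 ?wt_ge0 ?powR_ge0.
  rewrite -rintE// lee_fin in wl.
  have -> : S `^ (1 - r) * br (x - x0) ^+ m * (D * B) =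
    S `^ (1 - r) * br (x - x0) ^+ m * C * (3 ^+ d * pi ^+ d * B).
    by rewrite /D; ring.
  have c0 : 0 <= S `^ (1 - r) * br (x - x0) ^+ m * C.
    by rewrite !mulr_ge0 ?powR_ge0 ?brX_ge0.
  apply: le_trans (ler_wpM2l c0 wl).
  rewrite -rintZ// eu; apply: normc_cint_le => //; first exact: rintbleZ.
  move=> t; set y := row t; rewrite Normc.normcM.
  have h1 : normc (u y) <= S `^ (1 - r) * br (y - x0) ^+ m * normc (u y) `^ r.
    by apply: normc_powR_split => //; [exact: brX_ge1|exact: normc_ge0].
  have h2 : br (y - x0) ^+ m <= br (x - x0) ^+ m * br (x - y) ^+ m.
    rewrite -exprMn lerXn2r ?nnegrE ?br_ge0 ?mulr_ge0 ?br_ge0//.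
    have -> : y - x0 = (x - x0) - (x - y) by rewrite opprB [RHS]addrC addrA subrK.
    exact: brB.
  have h3 := hC (x - y).
  set a := normc (L (x - y)) in h3 *; set b := normc (u y) in h1 *.
  set q := b `^ r in h1 *; have q0 : 0 <= q by exact: powR_ge0.
  have a0 : 0 <= a by exact: normc_ge0.
  set s := S `^ (1 - r) in h1 *; have s0 : 0 <= s by exact: powR_ge0.
  apply: le_trans (ler_wpM2l a0 h1) _.
  apply: (@le_trans _ _ (a * (s * (br (x - x0) ^+ m * br (x - y) ^+ m) * q))).
    by apply: ler_wpM2l => //; apply: ler_wpM2r => //; exact: ler_wpM2l.
  have -> : a * (s * (br (x - x0) ^+ m * br (x - y) ^+ m) * q) =
    (s * br (x - x0) ^+ m * q) * (br (x - y) ^+ m * a) by ring.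
  have -> : s * br (x - x0) ^+ m * C * (wt (x - y) * q) =
    (s * br (x - x0) ^+ m * q) * (C * wt (x - y)) by ring.
  by apply: ler_wpM2l => //; rewrite !mulr_ge0 ?brX_ge0.
apply: (@le_trans _ _ (S `^ r)).
  by apply: ge0_ler_powR; rewrite ?nnegrE ?normc_ge0// ltW.
have hS : S <= S `^ (1 - r) * (D * B).
  apply: ge_sup; first by exists (normc (u x0) / br (x0 - x0) ^+ m).
  move=> _ [x _ <-]; rewrite ler_pdivrMr ?brX_gt0//.
  by apply: le_trans (step x) _; rewrite mulrAC.
move: S0; rewrite le_eqVlt => /orP[/eqP <-|Sp].
  by rewrite powR0 ?gt_eqF// mulr_ge0.
have e : S = S `^ (1 - r) * S `^ r.
  rewrite -powRD; last by rewrite subrK oner_eq0.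
  by rewrite subrK powRr1// ltW.
by move: hS; rewrite {1}e ler_pM2l// powR_gt0.
Qed.

Lemma powR_inv_le (a b r : R) : 0 < r -> 0 <= a -> a `^ r <= b -> a <= b `^ r^-1.
Proof.
move=> r0 a0 h.
have -> : a = (a `^ r) `^ r^-1 by rewrite -powRrM mulfV ?gt_eqF// powRr1.
apply: ge0_ler_powR => //; rewrite ?nnegrE ?powR_ge0 ?invr_ge0 ?(ltW r0)//.
exact: le_trans (powR_ge0 _ _) h.
Qed.

(** [reproduced_powR_le] is applied twice: for the growth order of [u], where the
    constant depends on this order but the conclusion shows that [u] is bounded,
    and then for growth order 0, where the constant depends on [L] and [p]
    only. *)
Lemma reproduced_bounded L (p : R) : schwartz L -> 0 < p -> exists C : R, 0 <= C /\
  forall u (M : R), 0 < M -> ccontinuous u -> reproduced L u ->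
  (forall k, (\int[mu]_t (unit_cube k (row t) * normc (u (row t)) `^ p)%:E <= (M `^ p)%:E)%E) ->
  (exists N K, forall x, normc (u x) <= K * br x ^+ N) ->
  forall x, normc (u x) <= C * M.
Proof.
move=> sL p0; (* any exponent below 1 and at most [p] serves *)
pose r := Num.min p 2^-1.
have r0 : 0 < r by rewrite lt_min p0 /= invr_gt0 ltr0n.
have r1 : r < 1 by rewrite (@le_lt_trans _ _ 2^-1) ?ge_min ?lexx ?orbT// invf_lt1// ltr1n.
have rp : r <= p by rewrite ge_min lexx.
have [C [C0 hC]] := reproduced_powR_le 0 sL r0 r1.
exists ((C * 2) `^ r^-1); split; first exact: powR_ge0.
move=> u M M0 cu ru hM [N [K hK]] x.
have hr k := local_powR_le cu M0 r0 rp (hM k).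
have [C' [_ hC']] := reproduced_powR_le N sL r0 r1.
have b1 y : normc (u y) <= (C' * (2 * M `^ r)) `^ r^-1.
  apply: powR_inv_le => //; first exact: normc_ge0.
  by apply: hC' => //; exists K.
have b2 : normc (u x) `^ r <= C * (2 * M `^ r).
  apply: hC => //; exists ((C' * (2 * M `^ r)) `^ r^-1) => y.
  by rewrite expr0 mulr1.
have := powR_inv_le r0 (normc_ge0 _) b2.
rewrite mulrA powRM ?powR_ge0 ?mulr_ge0// -powRrM mulfV ?gt_eqF// powRr1//.
exact: ltW.
Qed.

End LocalAverages.

Local Notation fdiff := Defs.diff.

(** * Bernstein's inequality for differences *)
Section Bernstein.
Context {R : realType} {d : nat}.
Implicit Types (x y z h : 'rV[R]_d) (g u L : 'rV[R]_d -> R[i]).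
Local Notation mu := (@lebesgue_tuple R d).
Local Notation row := (@row_of_tuple R d).

Lemma schwartz_increment L : schwartz L -> exists C : R, 0 <= C /\ forall z h,
  \sum_i `|h 0 i| <= 1 -> normc (L (z + h) - L z) <= C * (\sum_i `|h 0 i|) * wt z.
Proof.
move=> sL.
have [B [B0 hB]] : exists B : R, 0 <= B /\
    forall i z, normc (partial i L z) <= B * wt z.
  apply: (@finite_bounds R d (fun i B => forall z, normc (partial i L z) <= B * wt z)).
    by move=> i B B' BB' h z; apply: le_trans (h z) _; rewrite ler_wpM2r ?wt_ge0.
  move=> i; have [B [_ hB]] := rapid_le_wt 0 (schwartz_rapid (schwartz_partial i sL)).
  by exists B => z; have := hB z; rewrite expr0 mul1r.
exists (2 * (B * 3 ^+ d)); split; first by rewrite !mulr_ge0 ?exprn_ge0.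
move=> z h h1.
have -> : 2 * (B * 3 ^+ d) * (\sum_i `|h 0 i|) * wt z =
  2 * (B * (3 ^+ d * wt z)) * \sum_i `|h 0 i| by ring.
apply: (clipschitz_box (fun i => schwartz_cder i sL)) => i y hy.
apply: le_trans (hB i y) _; rewrite ler_wpM2l//.
have -> : y = z + (y - z) by rewrite addrC subrK.
apply: wt_shift => j; rewrite (le_trans (hy j))// (le_trans _ h1)//.
by rewrite (bigD1 j)//= lerDl sumr_ge0.
Qed.

Lemma reproduced_diff L u h : reproduced L u -> reproduced L (fdiff h u).
Proof.
move=> ru x; have [i1 e1] := ru x; have [i2 e2] := ru (x + h).
have i3 := cintegrable_aff h (oner_neq0 R) i2; have e3 := cintegral_aff h (oner_neq0 R) i2.
have eF y : L (x + h - (1 *: y + h)) * u (1 *: y + h) - L (x - y) * u y =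
    L (x - y) * fdiff h u y.
  by rewrite scale1r /Defs.diff mulrBr opprD addrACA subrr addr0.
have eF' := funext eF; split; first by rewrite -eF'; exact: (cintbleB i3 i1).
rewrite -eF' {1}/Defs.diff e2 e1 e3 normr1 expr1n mul1r.
exact: (esym (cintB i3 i1)).
Qed.

(** For increments of length at most 1 the difference falls on the kernel; for
    larger ones the bound by [2 * B] suffices. *)
Lemma reproduced_diff_le L : schwartz L -> exists C : R, 0 <= C /\
  forall u (B : R) h, reproduced L u -> (forall x, normc (u x) <= B) ->
  forall x, normc (fdiff h u x) <= C * eucl h * B.
Proof.
move=> sL; have [C [C0 hC]] := schwartz_increment sL.
pose C' := C * pi ^+ d; have C'0 : 0 <= C' by rewrite mulr_ge0// exprn_ge0// pi_ge0.
exists ((C' + 2) * d%:R); split; first by rewrite mulr_ge0// addr_ge0.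
move=> u B h ru hB x.
have B0 : 0 <= B by exact: le_trans (normc_ge0 _) (hB x).
have hs := sum_le_eucl h; set s := \sum_i `|h 0 i| in hs *.
have s0 : 0 <= s by rewrite sumr_ge0.
apply: (@le_trans _ _ ((C' + 2) * s * B)); last first.
  by rewrite ler_wpM2r// -mulrA ler_wpM2l// addr_ge0.
have [s1|s1] := leP s 1; last first.
  apply: (@le_trans _ _ (2 * B)).
    apply: le_trans (le_normcD _ _) _; rewrite normcN mulr_natl mulr2n lerD//.
  rewrite ler_wpM2r//; apply: (@le_trans _ _ (C' + 2)); first by rewrite lerDr.
  by rewrite ler_peMr ?addr_ge0// ltW.
apply: (@le_trans _ _ (C' * s * B)); last first.
  by rewrite ler_wpM2r// ler_wpM2r// lerDl.
have [i1 e1] := ru x; have [i2 e2] := ru (x + h).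
have i3 := vintble_wtB x.
have -> : C' * s * B = (C * s * B) * pi ^+ d by rewrite /C'; ring.
rewrite -(vint_wtB x) /Defs.diff e1 e2.
have eI := cintB i2 i1; rewrite cintegralE cintegralE -eI /vint -rintZ//.
apply: normc_cint_le; [exact: cintbleB i2 i1|exact: rintbleZ|move=> t].
rewrite -mulrBl Normc.normcM.
have -> : C * s * B * wt (x - row t) = (C * s * wt (x - row t)) * B by ring.
apply: ler_pM; [exact: normc_ge0|exact: normc_ge0| |exact: hB].
have -> : x + h - row t = (x - row t) + h by rewrite addrAC.
exact: hC.
Qed.

(** Differences of a reproduced function are reproduced, so that the first-order
    estimate iterates. *)
Lemma reproduced_iter_diff_le L : schwartz L -> exists C : R, 0 <= C /\
  forall u (B : R) h M, reproduced L u -> (forall x, normc (u x) <= B) ->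
  forall x, normc (iter M (fdiff h) u x) <= (C * eucl h) ^+ M * B.
Proof.
move=> sL; have [C [C0 hC]] := reproduced_diff_le sL; exists C; split=> //.
move=> u B h M ru hB.
suff [] : reproduced L (iter M (fdiff h) u) /\
  forall x, normc (iter M (fdiff h) u x) <= (C * eucl h) ^+ M * B by [].
elim: M => [|M [r1 h1]]; first by split=> // x; rewrite expr0 mul1r.
split=> [|x]; first exact: reproduced_diff.
rewrite exprS -mulrA; exact: hC.
Qed.

Lemma iter_diff_le (M : nat) h g (B : R) : (forall x, normc (g x) <= B) ->
  forall x, normc (iter M (fdiff h) g x) <= 2 ^+ M * B.
Proof.
move=> hg; elim: M => [|M IH] x; first by rewrite expr0 mul1r.
rewrite exprS -mulrA [leRHS]mulr_natl mulr2n.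
by apply: le_trans (le_normcD _ _) _; rewrite normcN; exact: lerD (IH _) (IH _).
Qed.

Lemma iter_diff_comp_scale (M : nat) h (a : R) g x :
  iter M (fdiff h) (fun y => g (a *: y)) x = iter M (fdiff (a *: h)) g (a *: x).
Proof.
elim: M x => [//|M IH] x; rewrite !iterS /Defs.diff.
by rewrite -scalerDr -!IH.
Qed.

Lemma iter_diffB (M : nat) h g1 g2 x :
  iter M (fdiff h) (fun y => g1 y - g2 y) x = iter M (fdiff h) g1 x - iter M (fdiff h) g2 x.
Proof.
elim: M x => [//|M IH] x.
have step g : iter M.+1 (fdiff h) g x = iter M (fdiff h) g (x + h) - iter M (fdiff h) g x by [].
by rewrite !step !IH !opprD !opprK addrACA.
Qed.

End Bernstein.

(** * Bounds of the blocks by Morrey-type quasi-norms *)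
Section NormBounds.
Context {R : realType} {d : nat}.
Implicit Types (x y z h : 'rV[R]_d) (g u : 'rV[R]_d -> R[i]) (T : @functional R d).
Local Notation mu := (@lebesgue_tuple R d).
Local Notation row := (@row_of_tuple R d).
Local Open Scope ereal_scope.

Lemma Linfty_norm_le g (c : R) : (forall x, (normc (g x) <= c)%R) ->
  Linfty_norm g <= c%:E.
Proof.
move=> h; have c0 : (0 <= c)%R by exact: le_trans (normc_ge0 _) (h 0%R).
rewrite /Linfty_norm unlock /Lnorm/=; case: ifPn => // _.
apply/ess_supP; apply: aeW => t /=; rewrite lee_fin ger0_norm ?normc_ge0//.
Qed.

(** The integral of a nonnegative function is a supremum over simple functions
    below it, and this set grows with the function. *)
Lemma le_integral_ge0 dX (X : measurableType dX) (m : {measure set X -> \bar R})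
    (D : set X) (f1 f2 : X -> \bar R) :
  (forall t, 0 <= f1 t) -> (forall t, f1 t <= f2 t) ->
  \int[m]_(t in D) f1 t <= \int[m]_(t in D) f2 t.
Proof.
move=> f10 f12; have f20 t : 0 <= f2 t by exact: le_trans (f12 t).
rewrite integral_mkcond [leRHS]integral_mkcond.
rewrite !ge0_integralTE; last 2 first.
- by move=> t; rewrite patchE; case: ifP.
- by move=> t; rewrite patchE; case: ifP.
apply: le_ereal_sup => _ [k hk <-]; exists k => // t; apply: le_trans (hk t) _.
by rewrite !patchE; case: ifP.
Qed.

Lemma lq_norm_ge (q : \bar R) n (a : nat -> \bar R) : 0 < q ->
  (forall j, 0 <= a j) -> a n <= lq_norm q n a.
Proof.
move=> q0 a0; case: q q0 => [q|_|//]; last by apply: ereal_sup_ubound; exists n => /=.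
rewrite lte_fin => q0 /=.
have -> : a n = (a n `^ q) `^ q^-1.
  by rewrite -poweRrM ?mulfV ?gt_eqF// poweRe1.
apply: gt0_ler_poweR; first by rewrite invr_ge0 ltW.
- by rewrite in_itv/= leey andbT poweR_ge0.
- by rewrite in_itv/= leey andbT nneseries_ge0// => *; exact: poweR_ge0.
rewrite (nneseries_split n 1); last by move=> *; exact: poweR_ge0.
rewrite addn1 big_nat1 leeDl// nneseries_ge0// => *; exact: poweR_ge0.
Qed.


Lemma Lp_norm_le (p c : R) (A : set 'rV[R]_d) (f : 'rV[R]_d -> \bar R) : (0 < p)%R ->
  Lp_norm p A f <= c%:E -> integral_rV A (fun x => `|f x| `^ p) <= (c `^ p)%:E.
Proof.
move=> p0; rewrite /Lp_norm; set I := integral_rV _ _ => h.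
have I0 : 0 <= I by apply: integral_ge0 => t _; exact: poweR_ge0.
have -> : I = (I `^ p^-1) `^ p by rewrite -poweRrM mulVf ?gt_eqF// poweRe1.
rewrite -poweR_EFin; apply: gt0_ler_poweR => //; first exact: ltW.
- by rewrite in_itv/= leey andbT poweR_ge0.
- by rewrite in_itv/= leey andbT (le_trans _ h)// poweR_ge0.
Qed.

Variables (theta0 : 'rV[R]_d -> R[i]) (s p : R) (q : \bar R) (phi : R -> R) (A : scale).
Hypotheses (res : resolution theta0) (p0 : (0 < p)%R) (q0 : 0 < q) (hphi : classG d p phi).

Lemma side_nat j : side j%:Z = 2 ^- j :> R.
Proof. by rewrite /side -exprnN. Qed.

(** Over a cube of side [2^-j] the sums start at index [j], and in both scales
    only this first term is kept. *)
Lemma morrey_block_le T (n : R) (j : nat) k : morrey_norm A theta0 s p q phi T <= n%:E ->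
  Lp_norm p (dyadic_cube j%:Z k) (fun x => (wblock theta0 s j T x)%:E) <=
    (phi (2 ^- j) * n)%:E.
Proof.
have s0 : (0 < 2 ^- j :> R)%R by rewrite invr_gt0 exprn_gt0.
have f0 : (0 < phi (2 ^- j))%R by have [h _ _] := hphi; exact: h.
have e j' x : (wblock theta0 s j' T x)%:E = `|(wblock theta0 s j' T x)%:E| :> \bar R.
  by rewrite /= ger0_norm// normc_ge0.
have key (N : int -> 'rV[int]_d -> \bar R) : morrey_sup phi N <= n%:E ->
    N j%:Z k <= (phi (2 ^- j) * n)%:E.
  move=> h; have h1 : (phi (side j%:Z))^-1%:E * N j%:Z k <= n%:E.
    by apply: le_trans h; apply: ereal_sup_ubound; exists j%:Z => //; exists k.
  rewrite side_nat in h1.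
  have -> : N j%:Z k = (phi (2 ^- j))%:E * ((phi (2 ^- j))^-1%:E * N j%:Z k).
    by rewrite muleA -EFinM mulfV ?gt_eqF// mul1e.
  by rewrite EFinM lee_wpmul2l// lee_fin ltW.
case: A => /= /key; apply: le_trans.
  by apply: (@lq_norm_ge q j) => // i; exact: poweR_ge0.
have lq0 (a : nat -> \bar R) m : (forall i, 0 <= a i) -> 0 <= lq_norm q m a.
  by move=> a0; exact: le_trans (a0 m) (lq_norm_ge m q0 a0).
have In (z : \bar R) : 0 <= z -> z \in `[0, +oo] by move=> z0; rewrite in_itv/= leey andbT.
have I0 (f : 'rV[R]_d -> \bar R) : 0 <= integral_rV (dyadic_cube j%:Z k) (fun x => `|f x| `^ p).
  by apply: integral_ge0 => t _; exact: poweR_ge0.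
rewrite /Lp_norm; apply: gt0_ler_poweR; first by rewrite invr_ge0 ltW.
- by apply: In; exact: I0.
- by apply: In; exact: I0.
apply: le_integral_ge0 => t; first exact: poweR_ge0.
apply: gt0_ler_poweR; first exact: ltW.
- by rewrite in_itv/= leey andbT.
- by rewrite in_itv/= leey andbT.
apply: (le_trans _ (lee_abs _)).
rewrite -e; apply: (@lq_norm_ge q j) => // i.
by rewrite lee_fin normc_ge0.
Qed.

Lemma unit_cube_dyadic j k x :
  unit_cube k (2 ^+ j *: x) = (if x \in dyadic_cube j%:Z k then 1 else 0)%R :> R.
Proof.
rewrite /unit_cube; have two0 : (0 < 2 ^+ j :> R)%R by rewrite exprn_gt0.
have P : floorv 1 (2 ^+ j *: x) = k <-> dyadic_cube j%:Z k x.
  rewrite /dyadic_cube /= side_nat; split=> [<- i|h].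
    have := floor_itv (2 ^+ j * x 0%R i)%R; rewrite !mxE divr1 intrD => /andP[h1 h2].
    by rewrite !(mulrC (2 ^- j)%R) ler_pdivrMr// ltr_pdivlMr// (mulrC (x 0%R i)) h1.
  apply/rowP => i; rewrite !mxE divr1; apply/eqP; rewrite floor_eq intrD.
  have := h i; rewrite !(mulrC (2 ^- j)%R) ler_pdivrMr// ltr_pdivlMr//.
  by rewrite (mulrC (x 0%R i)).
case: eqP => [/P h|h]; first by rewrite mem_set.
by rewrite memNset// => /P.
Qed.

(** Under [x = 2^-j y] the dyadic cubes of side [2^-j] become the unit cubes. *)
Lemma unit_block_local T (n : R) (j : nat) k : tempered T -> (0 < n)%R ->
  morrey_norm A theta0 s p q phi T <= n%:E ->
  \int[mu]_t (unit_cube k (row t) * normc (unit_block theta0 j T (row t)) `^ p)%:E <=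
  (((2 `^ (j%:R * (s - d%:R / p)))^-1 * (phi 1 * n)) `^ p)%:E.
Proof.
move=> hT n0 hN.
have two0 : (0 < 2 ^- j :> R)%R by rewrite invr_gt0 exprn_gt0.
have two1 : (2 ^- j <= 1 :> R)%R by rewrite invf_le1 ?exprn_gt0// exprn_ege1// ler1n.
have [f0 fm _] := hphi.
have fn : (0 <= phi (2 ^- j) * n)%R by rewrite mulr_ge0 ?ltW// f0.
have h := Lp_norm_le p0 (@morrey_block_le T n j k hN).
set e := (2 `^ (j%:R * (s - d%:R / p)))%R.
have e0 : (0 < e)%R by exact: powR_gt0.
pose w x : R := ((unit_cube k (2 ^+ j *: x)) * wblock theta0 s j T x `^ p)%R.
have cb : ccontinuous (block theta0 j T) by exact: block_ccontinuous.
have wb x : wblock theta0 s j T x = (2 `^ (j%:R * s) * normc (block theta0 j T x))%R.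
  by rewrite /wblock Normc.normcM normc_real ger0_norm// powR_ge0.
have w0 x : (0 <= w x)%R by rewrite mulr_ge0 ?unit_cube_ge0 ?powR_ge0.
have mw : measurable_fun setT (fun t => (w (row t))%:E).
  apply/measurable_EFinP; apply: measurable_funM.
    exact: (@measurable_fun_floorv _ _ _ _ 1 _ _ _ (fun m => (m == k)%:R : R)
      (coordmeasZ (2 ^+ j)%R coordmeas_row)).
  apply: (measurableT_comp (@measurable_powR R p)).
  under eq_fun do rewrite wb; apply: measurable_funM => //.
  exact: (cmeas_normc (cmeas_ccontinuous coordmeas_row cb)).
have eI : integral_rV (dyadic_cube j%:Z k) (fun x => `|(wblock theta0 s j T x)%:E| `^ p) =
    \int[mu]_t (w (row t))%:E.
  rewrite /integral_rV integral_mkcond; apply: eq_integral => t _.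
  rewrite patchE /w unit_cube_dyadic.
  have -> : (t \in row @^-1` dyadic_cube j%:Z k) = (row t \in dyadic_cube j%:Z k).
    by apply/idP/idP => /set_mem ?; exact/mem_set.
  by case: ifP => _; rewrite ?mul0r// mul1r /= ger0_norm ?normc_ge0// poweR_EFin.
have nz : (2 ^- j != 0 :> R)%R by rewrite gt_eqF.
have eA := @ge0_vint_aff R d (2 ^- j)%R 0%R (fun x => (w x)%:E) nz mw (fun x => w0 x).
rewrite eI eA in h.
have ew t : (w (2 ^- j *: row t + 0))%:E = ((2 `^ (j%:R * s)) `^ p)%:E *
    (unit_cube k (row t) * normc (unit_block theta0 j T (row t)) `^ p)%:E.
  rewrite addr0 /w wb scalerA mulfV ?scale1r; last by rewrite gt_eqF// exprn_gt0.
  by rewrite powRM ?powR_ge0 ?normc_ge0// -EFinM mulrCA.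
move: h; under eq_integral do rewrite ew.
rewrite ge0_integralZl_EFin//=; last 2 first.
- by move=> t _; rewrite lee_fin mulr_ge0 ?unit_cube_ge0 ?powR_ge0.
- apply/measurable_EFinP; apply: measurable_funM; first exact: measurable_unit_cube1.
  apply: (measurableT_comp (@measurable_powR R p)).
  exact: (cmeas_normc (cmeas_ccontinuous (coordmeasZ (2 ^- j)%R coordmeas_row) cb)).
set I := \int[mu]_t _.
rewrite muleA -EFinM.
have -> : (`|2 ^- j| ^+ d * (2 `^ (j%:R * s)) `^ p = e `^ p)%R.
  have -> : (`|2 ^- j| ^+ d = 2 `^ (- (j * d)%:R) :> R)%R.
    by rewrite ger0_norm ?ltW// powRN powR_mulrn// exprM exprVn.
  rewrite /e -!powRrM -powRD; last by rewrite pnatr_eq0 implybT.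
  congr (_ `^ _)%R; rewrite natrM.
  by field; rewrite gt_eqF.
move=> h; have I0 : 0 <= I.
  by apply: integral_ge0 => t _; rewrite lee_fin mulr_ge0 ?unit_cube_ge0 ?powR_ge0.
have -> : I = ((e `^ p)^-1)%:E * ((e `^ p)%:E * I).
  by rewrite muleA -EFinM mulVf ?mul1e// gt_eqF// powR_gt0.
apply: le_trans (lee_wpmul2l _ h) _; first by rewrite lee_fin invr_ge0 powR_ge0.
have f1 : (phi (2 ^- j) * n <= phi 1 * n)%R by rewrite ler_wpM2r ?fm// ltW.
rewrite -EFinM lee_fin (@powRM _ e^-1 (phi 1 * n))%R; last 2 first.
- by rewrite invr_ge0 ltW.
- exact: le_trans fn f1.
have -> : (e^-1 `^ p = (e `^ p)^-1)%R.
  rewrite -powR_inv1 ?ltW// -powRrM mulN1r powRN//.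
rewrite ler_wpM2l ?invr_ge0 ?powR_ge0//.
by apply: ge0_ler_powR; rewrite ?nnegrE// ?(le_trans fn f1)// ltW.
Qed.

(** [reproduced_bounded] for the rescaled blocks.  The monotonicity of [phi]
    bounds [phi (2^-j)] by [phi 1], and the Jacobian [2^(-jd)] is what turns the
    smoothness [s] into [s - d/p]. *)
Lemma block_bounded : exists C : R, (0 <= C)%R /\ forall T (n : R), tempered T -> (0 < n)%R ->
  morrey_norm A theta0 s p q phi T <= n%:E ->
  forall j x, (2 `^ (j%:R * (s - d%:R / p)) * normc (block theta0 j T x) <= C * n)%R.
Proof.
have [C [C0 hC]] := reproduced_bounded (schwartz_unit_kernel res) p0.
have [f0 _ _] := hphi; have f1 := f0 1%R ltr01.
exists (C * phi 1)%R; split; first by rewrite mulr_ge0// ltW.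
move=> T n hT n0 hN j x.
have two0 : (0 < 2 ^+ j :> R)%R by rewrite exprn_gt0.
set e := (2 `^ _)%R; have e0 : (0 < e)%R by exact: powR_gt0.
have M0 : (0 < e^-1 * (phi 1 * n))%R by rewrite mulr_gt0 ?invr_gt0// mulr_gt0.
have cb : ccontinuous (unit_block theta0 j T).
  have [cr ci] := block_ccontinuous res j hT.
  have comp (f : 'rV[R]_d -> R) : continuous f -> continuous (fun y => f (2 ^- j *: y)%R).
    move=> cf y; apply: (@cvg_comp _ _ _ (fun z => 2 ^- j *: z)%R f _ (nbhs (2 ^- j *: y)%R)).
      exact: (@scaler_continuous _ _ (2 ^- j)%R y).
    exact: cf.
  by split; [exact: comp cr|exact: comp ci].
have ru : reproduced (unit_kernel theta0) (unit_block theta0 j T).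
  by move=> y; exact: unit_block_reproducing.
have gr : exists N K, forall y, (normc (unit_block theta0 j T y) <= K * br y ^+ N)%R.
  have [N [K hK]] := block_growth res j hT.
  have K0 : (0 <= K)%R.
    by have := le_trans (normc_ge0 _) (hK 0%R); rewrite pmulr_lge0// brX_gt0.
  exists N, (K * (1 + `|2 ^- j|) ^+ N)%R => y; apply: le_trans (hK _) _.
  rewrite -mulrA ler_wpM2l// -exprMn lerXn2r ?nnegrE ?mulr_ge0 ?br_ge0//.
  exact: brZ.
have := hC _ _ M0 cb ru (fun k => @unit_block_local T n j k hT n0 hN) gr (2 ^+ j *: x).
rewrite /unit_block scalerA mulVf ?scale1r; last by rewrite gt_eqF.
move=> h; have := ler_wpM2l (ltW e0) h.
have -> // : (e * (C * (e^-1 * (phi 1 * n))) = C * phi 1 * n)%R.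
by field; rewrite gt_eqF.
Qed.

End NormBounds.

(** * Limits with geometric rate *)
Section GeometricLimits.
Context {R : realType}.

Lemma ccvg_geometric (u : nat -> R[i]) z (K rho : R) : 0 <= rho -> rho < 1 ->
  (forall n, normc (u n - z) <= K * rho ^+ n) -> ccvg u z.
Proof.
move=> r0 r1 h.
have hK : (fun n => K * rho ^+ n) @ \oo --> (0 : R).
  by rewrite -(mulr0 K); apply: cvgMr; apply: cvg_expr; rewrite ger0_norm.
apply: (@squeeze_cvgr _ _ _ _ (cst 0) _ _ _ _ _ hK) => //; last exact: cvg_cst.
by apply: nearW => n; rewrite normc_ge0 /=; exact: h.
Qed.

(** The sequence [v n - K rho^n / (1 - rho)] is nondecreasing and
    [v n + K rho^n / (1 - rho)] is nonincreasing, so that the supremum of the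
    first lies between the two. *)
Lemma geometric_limit (v : nat -> R) (K rho : R) : 0 <= rho -> rho < 1 -> 0 <= K ->
  (forall n, `|v n.+1 - v n| <= K * rho ^+ n) ->
  exists l, forall n, `|l - v n| <= K / (1 - rho) * rho ^+ n.
Proof.
move=> r0 r1 K0 h; set c := K / (1 - rho).
have c0 : 0 <= c by rewrite divr_ge0// subr_ge0 ltW.
have eK : K = c * (1 - rho) by rewrite /c divfK// subr_eq0 gt_eqF.
pose lo n := v n - c * rho ^+ n; pose up n := v n + c * rho ^+ n.
have rX n : 0 <= rho ^+ n by rewrite exprn_ge0.
have loS n : lo n <= lo n.+1.
  have := h n; rewrite ler_norml /lo eK exprS => /andP[h1 _]; lra.
have upS n : up n.+1 <= up n.
  have := h n; rewrite ler_norml /up eK exprS => /andP[_ h1]; lra.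
have loD n m : lo n <= lo (n + m)%N.
  by elim: m => [|m IH]; rewrite ?addn0// addnS (le_trans IH).
have upD n m : up (n + m)%N <= up n.
  by elim: m => [|m IH]; rewrite ?addn0// addnS (le_trans _ IH).
have lu n : lo n <= up n.
  by have := mulr_ge0 c0 (rX n); rewrite /lo /up; lra.
have loup m n : lo m <= up n.
  by rewrite (le_trans (loD m n))// (le_trans (lu _))// addnC.
exists (sup (range lo)) => n.
have h1 : lo n <= sup (range lo).
  by apply: ub_le_sup; [exists (up 0%N) => _ [m _ <-]|exists n].
have h2 : sup (range lo) <= up n.
  by apply: ge_sup; [exists (lo n); exists n|move=> _ [m _ <-]].
by rewrite ler_norml; move: h1 h2; rewrite /lo /up => h1 h2; apply/andP; split; lra.
Qed.

Lemma cgeometric_limit (v : nat -> R[i]) (K rho : R) : 0 <= rho -> rho < 1 -> 0 <= K ->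
  (forall n, normc (v n.+1 - v n) <= K * rho ^+ n) ->
  exists z, forall n, normc (z - v n) <= 2 * (K / (1 - rho)) * rho ^+ n.
Proof.
move=> r0 r1 K0 h.
have [a ha] : exists l, forall n, `|l - Re (v n)| <= K / (1 - rho) * rho ^+ n.
  apply: geometric_limit => // n; apply: le_trans (h n).
  by rewrite -cReN -cReD; exact: Re_le_normc.
have [b hb] : exists l, forall n, `|l - Im (v n)| <= K / (1 - rho) * rho ^+ n.
  apply: geometric_limit => // n; apply: le_trans (h n).
  by rewrite -cImN -cImD; exact: Im_le_normc.
exists (a +i* b) => n; apply: le_trans (normc_le_ReIm _) _.
rewrite cReD cImD cReN cImN /= -mulrA mulr_natl mulr2n.
exact: lerD (ha n) (hb n).
Qed.

End GeometricLimits.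

(** * Approximate identities *)
Section ApproximateIdentity.
Context {R : realType} {d : nat}.
Implicit Types (x y z h : 'rV[R]_d) (g k m : 'rV[R]_d -> R[i]) (T : @functional R d).
Local Notation mu := (@lebesgue_tuple R d).
Local Notation row := (@row_of_tuple R d).

Lemma convolC k g y : schwartz k -> schwartz g -> convol k g y = convol g k y.
Proof.
move=> sk sg; have ig := convol_integrable y sk (schwartz_cvmeas sg) (schwartz_rapid sg).
rewrite /convol (cintegral_reflect y ig); congr cintegral; apply/funext => x.
have -> : y - (y - x) = x by rewrite opprB addrC subrK.
by rewrite mulrC.
Qed.

Lemma schwartz_weighted_increment N B g l y h : schwartz g -> sbound N.+1 g B ->
  (size l <= N)%N ->
  br y ^+ N * normc (partials l g (y + h) - partials l g y) <=
  2 * 2 ^+ N * B * br h ^+ N * \sum_i `|h 0 i|.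
Proof.
move=> sg gB lN; have B0 := sbound_ge0 gB.
set s := \sum_i _; have s0 : 0 <= s by rewrite sumr_ge0.
have gB' z : br z ^+ N * normc (partials l g z) <= B.
  apply: le_trans (gB l z (leqW lN)).
  by rewrite ler_wpM2r ?normc_ge0// exprSr ler_peMr ?brX_ge0 ?br_ge1.
have c0 : 0 <= 2 * 2 ^+ N * B by rewrite !mulr_ge0 ?exprn_ge0.
have [s1|s1] := leP s 1.
  have s1' : \sum_i `|(- h) 0 i| <= 1.
    by under eq_bigr do rewrite mxE normrN.
  have := shift_diff_bound sg 0 y gB lN s1'; rewrite sub0r opprK subr0.
  have -> : \sum_i `|(- h) 0 i| = s by apply: eq_bigr => i _; rewrite mxE normrN.
  have -> : br (0 : 'rV[R]_d) = 1.
    by rewrite /br big1 ?addr0// => i _; rewrite mxE normr0.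
  rewrite expr1n mulr1 => /le_trans; apply.
  by rewrite ler_wpM2r// ler_peMr// brX_ge1.
apply: (@le_trans _ _ (2 * B * br h ^+ N)).
  have h1 : br y ^+ N <= br (y + h) ^+ N * br h ^+ N.
    rewrite -exprMn lerXn2r ?nnegrE ?br_ge0 ?mulr_ge0 ?br_ge0//.
    by rewrite -{1}(addrK h y) brB.
  have h2 : br y ^+ N * normc (partials l g (y + h)) <= B * br h ^+ N.
    apply: le_trans (ler_wpM2r (normc_ge0 _) h1) _.
    by rewrite mulrAC ler_wpM2r ?brX_ge0.
  have h3 : br y ^+ N * normc (partials l g y) <= B * br h ^+ N.
    by apply: le_trans (gB' y) _; rewrite ler_peMr// brX_ge1.
  apply: le_trans (ler_wpM2l (brX_ge0 _ _) (le_normcD _ _)) _.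
  by rewrite normcN mulrDr -mulrA mulr_natl mulr2n lerD.
rewrite -[leLHS]mulr1; apply: ler_pM => //; last exact: ltW.
  by rewrite !mulr_ge0 ?brX_ge0.
by rewrite ler_wpM2r ?brX_ge0// ler_wpM2r// ler_peMr// exprn_ege1// ler1n.
Qed.

Variable theta0 : 'rV[R]_d -> R[i].
Hypothesis res : resolution theta0.
Local Notation k0 := (kern (dilated theta0 0)).
Local Notation kn n := (fun z => kern (dilated theta0 n) (- z)).

Lemma schwartz_kn n : schwartz (kn n).
Proof. by apply: schwartz_opp; apply: schwartz_kern; exact: schwartz_dilated. Qed.

(** The kernel of [dilated n] is a dilate of [k0], whose mass concentrates at the
    origin as [n] grows. *)
Lemma convol_dilated n g y : schwartz g ->
  cintegrable (fun w => k0 w * g (y + 2 ^- n *: w)) /\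
  convol (kn n) g y = cintegral (fun w => k0 w * g (y + 2 ^- n *: w)).
Proof.
move=> sg; have sk := schwartz_kn n.
have n0 : 2 ^- n != 0 :> R by rewrite invr_eq0 gt_eqF// twoX_gt0.
have nn0 : - 2 ^- n != 0 :> R by rewrite oppr_eq0.
have c0 : (2 ^+ (n * d))%:C != 0 :> R[i].
  by rewrite (inj_eq (@complexI R)) gt_eqF// twoX_gt0.
rewrite (convolC y sk sg).
have i1 := convol_integrable y sg (schwartz_cvmeas sk) (schwartz_rapid sk).
have i2 := cintegrable_aff 0 nn0 i1; have e2 := cintegral_aff 0 nn0 i1.
have eF w : kn n (- 2 ^- n *: w + 0) * g (y - (- 2 ^- n *: w + 0)) =
   (2 ^+ (n * d))%:C * (k0 w * g (y + 2 ^- n *: w)).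
  rewrite addr0 scaleNr opprK -[X in dilated theta0 X]add0n kern_dilated//.
  by rewrite scalerA mulfV ?scale1r ?mulrA// gt_eqF// twoX_gt0.
have eF' := funext eF; rewrite eF' in i2 e2.
have cancel_mul (w : R[i]) : ((2 ^+ (n * d))%:C)^-1 * ((2 ^+ (n * d))%:C * w) = w.
  by rewrite mulKf.
have i3 : cintegrable (fun w => k0 w * g (y + 2 ^- n *: w)).
  have := cintbleZ ((2 ^+ (n * d))%:C)^-1 i2; congr cintble; apply/funext => t.
  exact: cancel_mul.
split; first exact: i3.
rewrite /convol e2.
have -> : cintegral (fun w => (2 ^+ (n * d))%:C * (k0 w * g (y + 2 ^- n *: w))) =
  (2 ^+ (n * d))%:C * cintegral (fun w => k0 w * g (y + 2 ^- n *: w)).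
  exact: (cintZ (2 ^+ (n * d))%:C i3).
rewrite mulrA -real_complexM normrN ger0_norm ?invr_ge0 ?ltW ?twoX_gt0//.
by rewrite exprM exprVn mulVf ?mul1r// expf_neq0// gt_eqF// twoX_gt0.
Qed.

(** [k0] has integral [theta0 0 = 1], so the difference is an average of
    increments of [g] over steps of length of order [2^-n]. *)
Lemma approximate_identity N B g : schwartz g -> sbound N.+1 g B ->
  exists C, forall n, sbound N (fun x => convol (kn n) g x - g x) (C * 2^-1 ^+ n).
Proof.
move=> sg gB; have B0 := sbound_ge0 gB.
have [_ th1 _] := res.
have sk0 : schwartz k0 by apply: schwartz_kern; exact: schwartz_dilated.
have ik := rapid_vintble N.+1 (schwartz_cvmeas sk0) (schwartz_rapid sk0).
pose C1 := 2 * 2 ^+ N * B; have C10 : 0 <= C1 by rewrite !mulr_ge0 ?exprn_ge0.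
exists (C1 * vint (fun w => br w ^+ N.+1 * normc (k0 w))) => n l y lN.
have sk := schwartz_kn n; have mg := schwartz_cvmeas sg; have rg := schwartz_rapid sg.
have sl := schwartz_partials l sg.
have sc : schwartz (convol (kn n) g) by exact: schwartz_convol.
rewrite partialsB//.
have -> : partials l (convol (kn n) g) = convol (kn n) (partials l g).
  have -> : convol (kn n) g = convol g (kn n) by apply/funext => z; exact: convolC.
  rewrite partials_convol//; [|exact: schwartz_cvmeas|exact: schwartz_rapid].
  by apply/funext => z; apply: esym; exact: convolC.
have [i1 ->] := convol_dilated n y sl.
have i2 := schwartz_cintegrable sk0.
have e1 : partials l g y = cint mu (fun t => partials l g y * k0 (row t)).
  rewrite (cintZ (partials l g y) i2) -cintegralE cintegral_kern; last exact: schwartz_dilated.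
  rewrite /dilated scaler0 th1 ?mulr1//.
  by rewrite /eucl /dotv big1 ?sqrtr0// => i _; rewrite mxE mul0r.
have i4 := cintbleB i1 (cintbleZ (partials l g y) i2).
have -> : cintegral (fun w => k0 w * partials l g (y + 2 ^- n *: w)) - partials l g y =
   cint mu (fun t => k0 (row t) * partials l g (y + 2 ^- n *: row t) - partials l g y * k0 (row t)).
  rewrite [X in _ - X = _]e1; exact: (esym (cintB i1 (cintbleZ (partials l g y) i2))).
rewrite -{1}[br y ^+ N]ger0_norm ?brX_ge0// -normc_real -Normc.normcM.
rewrite -(cintZ _ i4) mulrAC /vint -(rintZ _ ik).
apply: normc_cint_le; [exact: cintbleZ|exact: rintbleZ|move=> t].
set w := row t.
have -> : k0 w * partials l g (y + 2 ^- n *: w) - partials l g y * k0 w =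
  k0 w * (partials l g (y + 2 ^- n *: w) - partials l g y).
  by rewrite mulrBr [X in _ - X]mulrC.
have h := schwartz_weighted_increment y (2 ^- n *: w) sg gB lN.
rewrite (Normc.normcM (br y ^+ N)%:C) (Normc.normcM (k0 w)).
rewrite normc_real ger0_norm ?brX_ge0//.
rewrite mulrCA; apply: le_trans (ler_wpM2l (normc_ge0 _) h) _.
have two0 : 0 <= 2 ^- n :> R by rewrite invr_ge0 exprn_ge0.
have two1 : 2 ^- n <= 1 :> R by rewrite invf_le1 ?twoX_gt0// exprn_ege1// ler1n.
have hs : \sum_i `|(2 ^- n *: w) 0 i| = 2 ^- n * \sum_i `|w 0 i|.
  by rewrite mulr_sumr; apply: eq_bigr => i _; rewrite mxE normrM ger0_norm.
have s0 : 0 <= \sum_i `|w 0 i| by rewrite sumr_ge0.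
have hb : br (2 ^- n *: w) ^+ N <= br w ^+ N.
  rewrite lerXn2r ?nnegrE ?br_ge0//; rewrite /br hs lerD2l.
  by rewrite ler_piMl.
have hs2 : \sum_i `|w 0 i| <= br w by rewrite /br lerDr.
rewrite hs exprVn.
have -> : C1 * 2 ^- n * (br w ^+ N.+1 * normc (k0 w)) =
  normc (k0 w) * (C1 * br w ^+ N * (2 ^- n * br w)) by rewrite exprSr; ring.
apply: ler_wpM2l; first exact: normc_ge0.
apply: ler_pM.
- by rewrite mulr_ge0 ?brX_ge0.
- by rewrite mulr_ge0.
- by rewrite -/C1 ler_wpM2l.
- by rewrite ler_wpM2l.
Qed.

Lemma tempered_approximation T g : tempered T -> schwartz g ->
  ccvg (fun n => T (convol (kn n) g)) (T g).
Proof.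
move=> hT sg; have [N [C [C0 hC]]] := tempered_bound hT.
have [B gB] := schwartz_sbound N.+1 sg.
have [C' hC'] := approximate_identity sg gB.
have half0 : 0 <= 2^-1 :> R by rewrite invr_ge0.
have half1 : 2^-1 < 1 :> R by rewrite invf_lt1// ltr1n.
apply: (@ccvg_geometric R _ _ (C * C') 2^-1 half0 half1) => n.
have sc : schwartz (convol (kn n) g).
  apply: schwartz_convol; [exact: schwartz_kn|exact: schwartz_cvmeas|exact: schwartz_rapid].
rewrite -(temperedB hT sc sg) -mulrA; apply: hC => //; first exact: schwartzB.
Qed.

End ApproximateIdentity.

(** * The series of blocks *)
Section BlockSeries.
Context {R : realType} {d : nat}.
Implicit Types (x y z h : 'rV[R]_d) (g k m : 'rV[R]_d -> R[i]) (T : @functional R d).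
Local Notation mu := (@lebesgue_tuple R d).
Local Notation row := (@row_of_tuple R d).

Lemma kernB m1 m2 z : schwartz m1 -> schwartz m2 ->
  kern (fun x => m1 x - m2 x) z = kern m1 z - kern m2 z.
Proof.
move=> s1 s2; have i1 := cis_integrable z s1; have i2 := cis_integrable z s2.
rewrite /kern /fourier_inv -!mulrBr; congr (_ * (_ * _)).
apply: (eq_trans _ (cintB i1 i2)); apply: eq_cint => t.
exact: mulrBr.
Qed.

Lemma filteredB T m1 m2 x : tempered T -> schwartz m1 -> schwartz m2 ->
  filtered T (fun x => m1 x - m2 x) x = filtered T m1 x - filtered T m2 x.
Proof.
move=> hT s1 s2; rewrite /filtered /pairing.
have sh m : schwartz m -> schwartz (fun y => kern m (- (y - x))).
  by move=> sm; exact: (schwartz_shift (- x) (schwartz_opp (schwartz_kern sm))).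
rewrite -(temperedB hT (sh _ s1) (sh _ s2)); congr T.
by apply/funext => y; exact: kernB.
Qed.

Lemma eucl_gt0 h : h != 0 -> 0 < eucl h.
Proof.
move=> h0; rewrite lt_neqAle eucl_ge0 andbT; apply: contra h0 => /eqP e.
apply/eqP/rowP => i; rewrite mxE; apply/eqP; rewrite -normr_eq0.
by rewrite eq_le normr_ge0 andbT [leRHS]e coord_le_eucl.
Qed.

Lemma dyadic_scale (t : R) : 0 < t -> t < 1 -> exists n : nat, 2 ^- n.+1 <= t <= 2 ^- n.
Proof.
move=> t0 t1.
have ex : exists n : nat, 2 ^- n.+1 <= t.
  exists (Num.bound t^-1); rewrite invf_ple ?posrE ?exprn_gt0//.
  apply: ltW; apply: (upper_nthrootP (leqnSn _)).
case: (ex_minnP ex) => n hn hmin; exists n; rewrite hn /=.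
case: n hn hmin => [|n] hn hmin; first by rewrite expr0 invr1 ltW.
have [//|h] := leP t (2 ^- n.+1).
by have := hmin n (ltW h); rewrite ltnn.
Qed.

Variable theta0 : 'rV[R]_d -> R[i].
Hypothesis res : resolution theta0.

(** The sum of the blocks of index at most [n], because the resolution of unity
    telescopes. *)
Definition partial_sum T n : 'rV[R]_d -> R[i] := filtered T (dilated theta0 n).

Lemma partial_sum0 T : tempered T -> partial_sum T 0 = block theta0 0 T.
Proof.
move=> hT; rewrite block_filtered// /partial_sum; congr filtered.
by apply/funext => x; rewrite thetaE subr0.
Qed.

Lemma partial_sumS T n x : tempered T ->
  partial_sum T n.+1 x - partial_sum T n x = block theta0 n.+1 T x.
Proof.
move=> hT; rewrite block_filtered// /partial_sum.
rewrite -(filteredB x hT (schwartz_dilated res n.+1) (schwartz_dilated res n)).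
by congr filtered; apply/funext => y; rewrite thetaE.
Qed.

Lemma partial_sum_ccontinuous T n : tempered T -> ccontinuous (partial_sum T n).
Proof.
move=> hT; apply: pairing_ccontinuous => //; apply: schwartz_opp.
by apply: schwartz_kern; exact: schwartz_dilated.
Qed.

Lemma uniform_limit_continuous (f : 'rV[R]_d -> R) (v : nat -> 'rV[R]_d -> R) (K rho : R) :
  0 <= rho -> rho < 1 -> (forall n, continuous (v n)) ->
  (forall n x, `|f x - v n x| <= K * rho ^+ n) -> continuous f.
Proof.
move=> r0 r1 cv h x.
have FF : Filter (nbhs x) by exact: nbhs_filter.
apply/(@cvgrPdist_le _ _ _ (nbhs x) FF f (f x)) => e e0.
have [n hn] : exists n, K * rho ^+ n <= e / 4.
  have hK : (fun n => K * rho ^+ n) @ \oo --> (0 : R).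
    by rewrite -(mulr0 K); apply: cvgMr; apply: cvg_expr; rewrite ger0_norm.
  have e4 : 0 < e / 4 by rewrite divr_gt0.
  move/cvgrPdist_le : hK => /(_ _ e4) [n _ /(_ n (leqnn n))] /=.
  by rewrite sub0r normrN => hn; exists n; exact: le_trans (ler_norm _) hn.
have e2 : 0 < e / 2 by rewrite divr_gt0.
have hv := (@cvgrPdist_le _ _ _ (nbhs x) FF (v n) (v n x)).1 (cv n x) _ e2.
apply: filterS hv => y hy.
have := h n x; have := h n y; move: hy; rewrite !ler_norml.
by move=> /andP[? ?] /andP[? ?] /andP[? ?]; apply/andP; split; lra.
Qed.

Section Sum.
Variables (T : @functional R d) (a rho : R).
Hypotheses (hT : tempered T) (a0 : 0 <= a) (r0 : 0 < rho) (r1 : rho < 1).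
Hypothesis hb : forall j x, normc (block theta0 j T x) <= a * rho ^+ j.

(** Twice a geometric series: the real and the imaginary parts are summed
    separately. *)
Definition tail_bound : R := 2 * (a / (1 - rho)).

Lemma block_series : exists F : 'rV[R]_d -> R[i],
  forall x n, normc (F x - partial_sum T n x) <= tail_bound * rho ^+ n.
Proof.
have h x : exists w : R[i], forall n, normc (w - partial_sum T n x) <= tail_bound * rho ^+ n.
  apply: (cgeometric_limit (ltW r0) r1 a0) => n; rewrite partial_sumS//.
  apply: le_trans (hb _ _) _; rewrite ler_wpM2l// exprS ler_piMl ?exprn_ge0// ltW//.
by have [F hF] := choice h; exists F.
Qed.

Variable F : 'rV[R]_d -> R[i].
Hypothesis hF : forall x n, normc (F x - partial_sum T n x) <= tail_bound * rho ^+ n.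

Lemma tail_bound_ge0 : 0 <= tail_bound.
Proof. by rewrite mulr_ge0// divr_ge0// subr_ge0 ltW. Qed.

Lemma sum_bounded x : normc (F x) <= tail_bound + a.
Proof.
have -> : F x = (F x - partial_sum T 0 x) + partial_sum T 0 x by rewrite subrK.
apply: le_trans (le_normcD _ _) _; apply: lerD.
  by have := hF x 0; rewrite expr0 mulr1.
by rewrite partial_sum0//; have := hb 0 x; rewrite expr0 mulr1.
Qed.

Lemma sum_ccontinuous : ccontinuous F.
Proof.
split.
  apply: (@uniform_limit_continuous _ (fun n x => Re (partial_sum T n x)) tail_bound rho).
  - exact: ltW.
  - exact: r1.
  - by move=> n; have [] := partial_sum_ccontinuous n hT.
  - move=> n x; apply: le_trans (hF x n); rewrite -cReN -cReD; exact: Re_le_normc.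
apply: (@uniform_limit_continuous _ (fun n x => Im (partial_sum T n x)) tail_bound rho).
- exact: ltW.
- exact: r1.
- by move=> n; have [] := partial_sum_ccontinuous n hT.
- move=> n x; apply: le_trans (hF x n); rewrite -cImN -cImD; exact: Im_le_normc.
Qed.

(** The partial sums represent [T] composed with an approximate identity, and
    converge uniformly to [F]. *)
Lemma sum_represents : represents T F.
Proof.
split; first exact: sum_ccontinuous.
move=> g sg; have ig := schwartz_cintegrable sg.
have ng := cintble_normc ig.
have mF := cmeas_ccontinuous coordmeas_row sum_ccontinuous.
have iF : cintegrable (fun x => F x * g x).
  apply: (@cintble_le _ _ _ mu _ (fun t => (tail_bound + a) * normc (g (row t)))).
  - by apply: cmeasM => //; exact: schwartz_cvmeas.
  - by move=> t; rewrite Normc.normcM ler_wpM2r ?normc_ge0// sum_bounded.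
  - exact: rintbleZ.
split; first exact: iF.
apply: (ccvg_unique (tempered_approximation res hT sg)).
pose I := vint (fun x => normc (g x)).
apply: (@ccvg_geometric R _ _ (tail_bound * I) rho (ltW r0) r1) => n.
have [_ /(_ g sg)[i1 e1]] := represents_filtered hT (schwartz_dilated res n).
rewrite -(multiplied_convol T (schwartz_dilated res n) sg) e1.
have eI := cintB i1 iF; rewrite cintegralE cintegralE -eI mulrAC /I /vint.
rewrite -(rintZ _ ng); apply: normc_cint_le; [exact: cintbleB i1 iF|exact: rintbleZ|].
move=> t; rewrite -mulrBl Normc.normcM ler_wpM2r ?normc_ge0// normcB_sym.
exact: hF.
Qed.

Variables (Cb : R) (M : nat).
Hypothesis Cb0 : 0 <= Cb.
Hypothesis bernstein : forall j h x,
  normc (iter M (fdiff h) (block theta0 j T) x) <= (Cb * (2 ^+ j * eucl h)) ^+ M * (a * rho ^+ j).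

Let tau : R := 2 ^+ M * rho.
Let gam : R := tau / (tau - 1).
Hypothesis tau1 : 1 < tau.

(** The bounds of the single blocks grow geometrically with ratio [tau > 1], so
    the last one dominates the sum up to the factor [gam]. *)
Lemma iter_diff_partial_sum n h x :
  normc (iter M (fdiff h) (partial_sum T n) x) <= (Cb * eucl h) ^+ M * a * (gam * tau ^+ n).
Proof.
have t0 : 0 < tau - 1 by rewrite subr_gt0.
have g1 : 1 <= gam by rewrite /gam ler_pdivlMr// mul1r gerBl.
have eg : gam = 1 + gam / tau by rewrite /gam; field; rewrite !gt_eqF// (lt_trans ltr01).
set c := (Cb * eucl h) ^+ M * a.
have c0 : 0 <= c by rewrite mulr_ge0 ?exprn_ge0 ?mulr_ge0 ?eucl_ge0.
have bB j : normc (iter M (fdiff h) (block theta0 j T) x) <= c * tau ^+ j.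
  apply: le_trans (bernstein j h x) _; rewrite le_eqVlt; apply/orP; left; apply/eqP.
  by rewrite /c /tau !exprMn -!exprM (mulnC j); ring.
elim: n => [|n IH].
  rewrite partial_sum0//; apply: le_trans (bB 0) _.
  by rewrite expr0 !mulr1 ler_peMr.
have e : iter M (fdiff h) (partial_sum T n.+1) x =
    iter M (fdiff h) (partial_sum T n) x + iter M (fdiff h) (block theta0 n.+1 T) x.
  have -> : block theta0 n.+1 T = fun y => partial_sum T n.+1 y - partial_sum T n y.
    by apply/funext => y; rewrite partial_sumS.
  by rewrite iter_diffB addrC subrK.
rewrite e; apply: le_trans (le_normcD _ _) _.
apply: le_trans (lerD IH (bB n.+1)) _; rewrite -mulrDr ler_wpM2l//.
rewrite {2}eg exprS le_eqVlt; apply/orP; left; apply/eqP; field.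
by rewrite gt_eqF// (lt_trans ltr01).
Qed.

(** With [2^-n] the dyadic scale of [h], the blocks of index at most [n] are
    estimated by Bernstein's inequality and the remaining ones by the size of the
    tail of the series; both contributions are of order [rho ^+ n], which is
    comparable to [eucl h `^ kappa]. *)
Lemma zygmund_sum_le (kappa : R) : 0 <= kappa -> rho = 2 `^ (- kappa) ->
  M = (Num.truncn kappa).+1 ->
  (zygmund_fun_norm kappa F <=
   ((tail_bound + a) + (2 ^+ M * (tail_bound + a) +
     (Cb ^+ M * a * gam + 2 ^+ M * tail_bound) / rho))%:E)%E.
Proof.
move=> k0 rE ME; rewrite /zygmund_fun_norm EFinD; apply: leeD.
  by apply: ge_ereal_sup => _ [x _ <-]; rewrite lee_fin sum_bounded.
have tb0 := tail_bound_ge0.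
have g0 : 0 <= gam by rewrite /gam divr_ge0 ?subr_ge0 ?ltW// (lt_trans ltr01).
have c1 : 0 <= 2 ^+ M * (tail_bound + a) by rewrite mulr_ge0 ?exprn_ge0 ?addr_ge0.
have c2 : 0 <= (Cb ^+ M * a * gam + 2 ^+ M * tail_bound) / rho.
  apply: divr_ge0; last exact: ltW.
  apply: addr_ge0; last by rewrite mulr_ge0 ?exprn_ge0.
  by apply: mulr_ge0 => //; apply: mulr_ge0 => //; exact: exprn_ge0.
rewrite -ME; apply: ge_ereal_sup => _ [h h0 [x _ <-]]; rewrite lee_fin.
have e0 : 0 < eucl h by exact: eucl_gt0.
have [e1|e1] := leP 1 (eucl h).
  apply: (@le_trans _ _ (2 ^+ M * (tail_bound + a))); last by rewrite lerDl.
  rewrite -[leRHS]mul1r; apply: ler_pM; rewrite ?powR_ge0 ?normc_ge0//.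
    have one : 1 `^ kappa = 1 :> R by rewrite powR1.
    rewrite powRN invf_le1 ?powR_gt0// -[leLHS]one.
    by apply: ge0_ler_powR; rewrite ?nnegrE ?ler01// ltW.
  by apply: iter_diff_le => y; exact: sum_bounded.
apply: (@le_trans _ _ ((Cb ^+ M * a * gam + 2 ^+ M * tail_bound) / rho)); last first.
  by rewrite lerDr.
have [n /andP[n1 n2]] := dyadic_scale e0 e1.
have kE : eucl h `^ (- kappa) <= (rho ^+ n.+1)^-1.
  rewrite powRN lef_pV2 ?posrE ?powR_gt0 ?exprn_gt0//.
  have -> : rho ^+ n.+1 = (2 ^- n.+1) `^ kappa.
    rewrite rE -powR_mulrn ?powR_ge0// -powRrM.
    have -> : 2 ^- n.+1 = 2 `^ (- n.+1%:R) :> R by rewrite powRN powR_mulrn.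
    by rewrite -powRrM mulNr mulrC -mulNr.
  by apply: ge0_ler_powR; rewrite ?nnegrE ?invr_ge0 ?exprn_ge0// ltW.
have nE : normc (iter M (fdiff h) F x) <=
    (Cb ^+ M * a * gam + 2 ^+ M * tail_bound) * rho ^+ n.
  have e : iter M (fdiff h) F x = iter M (fdiff h) (partial_sum T n) x +
     iter M (fdiff h) (fun y => F y - partial_sum T n y) x.
    by rewrite iter_diffB addrC subrK.
  rewrite e; apply: le_trans (le_normcD _ _) _; rewrite mulrDl; apply: lerD.
    apply: le_trans (iter_diff_partial_sum n h x) _.
    have -> : Cb ^+ M * a * gam * rho ^+ n = (Cb * 2 ^- n) ^+ M * a * (gam * tau ^+ n).
      rewrite /tau !exprMn exprVn -!exprM (mulnC M); field.
      by rewrite expf_neq0.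
    have t0 : 0 <= gam * tau ^+ n.
      by rewrite mulr_ge0// exprn_ge0// ltW// (lt_trans ltr01).
    rewrite ler_wpM2r// ler_wpM2r// lerXn2r ?nnegrE ?mulr_ge0 ?eucl_ge0 ?invr_ge0 ?exprn_ge0//.
    by rewrite ler_wpM2l.
  rewrite -mulrA; apply: iter_diff_le => y; exact: hF.
apply: le_trans (ler_pM (powR_ge0 _ _) (normc_ge0 _) kE nE) _.
rewrite le_eqVlt; apply/orP; left; apply/eqP; rewrite exprS; field.
by rewrite expf_neq0 ?gt_eqF.
Qed.

End Sum.
End BlockSeries.

(** * The embeddings *)
Section Embeddings.
Context {R : realType} {d : nat}.
Implicit Types (x y z h : 'rV[R]_d) (g k m : 'rV[R]_d -> R[i]) (T S : @functional R d).

Lemma schwartz_seminorm_ge0 N g : (0 <= schwartz_seminorm N g)%E.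
Proof.
apply: le_trans (seminorm_ub g (l := [::]) 0 (leq0n N)).
by rewrite lee_fin mulr_ge0 ?normc_ge0// exprn_ge0// addr_ge0// eucl_ge0.
Qed.

Lemma le_schwartz_seminorm N N' g : (N <= N')%N ->
  (schwartz_seminorm N g <= schwartz_seminorm N' g)%E.
Proof.
move=> NN'; apply: ge_ereal_sup => _ [x _ [l /= lN <-]].
apply: le_trans (seminorm_ub g x (leq_trans lN NN')).
rewrite lee_fin ler_wpM2r ?normc_ge0// ler_weXn2l// lerDl; exact: eucl_ge0.
Qed.

Lemma tempered_dist_sub S T : tempered S -> tempered T -> tempered (dist_sub S T).
Proof.
move=> [lS [N1 [C1 b1]]] [lT [N2 [C2 b2]]]; split=> [a g1 g2 s1 s2|].
  by rewrite /dist_sub lS// lT// mulrBr opprD addrACA.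
exists (maxn N1 N2), (`|C1| + `|C2|) => g sg.
have bound (U : @functional R d) N (C : R) : (N <= maxn N1 N2)%N ->
    ((normc (U g))%:E <= C%:E * schwartz_seminorm N g)%E ->
    ((normc (U g))%:E <= `|C|%:E * schwartz_seminorm (maxn N1 N2) g)%E.
  move=> hN /le_trans; apply; apply: le_trans (_ : (`|C|%:E * schwartz_seminorm N g <= _)%E).
    by rewrite lee_wpmul2r ?schwartz_seminorm_ge0// lee_fin ler_norm.
  by rewrite lee_wpmul2l ?le_schwartz_seminorm// lee_fin.
have h1 := bound _ _ _ (leq_maxl _ _) (b1 g sg).
have h2 := bound _ _ _ (leq_maxr _ _) (b2 g sg).
rewrite EFinD ge0_muleDl ?lee_fin//; apply: le_trans (leeD h1 h2).
by rewrite -EFinD lee_fin /dist_sub (le_trans (le_normcD _ _))// normcN.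
Qed.

(** The estimate is applied to differences of distributions, which are tempered
    again. *)
Lemma embeds_of_bound (N1 N2 : @functional R d -> \bar R) (C : R) : 0 <= C ->
  (forall T n, tempered T -> 0 < n -> (N1 T <= n%:E)%E -> (N2 T <= (C * n)%:E)%E) ->
  embeds N1 N2.
Proof.
move=> C0 h; split=> [T [hT fT]|T [hT fT] e e0].
  split=> //; pose n : R := `|fine (N1 T)| + 1.
  have n0 : 0 < n by rewrite ltr_wpDl.
  apply: le_lt_trans (ltry (C * n)); apply: h => //.
  case: (N1 T) fT @n n0 => [r _|//|_] n n0; last exact: leNye.
  by rewrite lee_fin /n /= (le_trans (ler_norm r))// lerDl.
have c0 : 0 < C + 1 by rewrite ltr_wpDl.
exists (e / (C + 1)); first by rewrite divr_gt0.
move=> S [hS fS] hST.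
have := h _ _ (tempered_dist_sub hS hT) (divr_gt0 e0 c0) (ltW hST).
move=> /le_lt_trans; apply; rewrite lte_fin mulrA ltr_pdivrMr// mulrC.
by rewrite ltr_pM2l// ltrDl.
Qed.

Variable theta0 : 'rV[R]_d -> R[i].
Hypothesis res : resolution theta0.

Lemma besov_infty_norm_le (sigma a : R) T :
  (forall j x, 2 `^ (j%:R * sigma) * normc (block theta0 j T x) <= a) ->
  (besov_infty_norm theta0 sigma T <= a%:E)%E.
Proof.
move=> h; apply: ge_ereal_sup => _ [j _ <-].
have e0 : 0 < 2 `^ (j%:R * sigma) :> R by exact: powR_gt0.
have -> : a = 2 `^ (j%:R * sigma) * ((2 `^ (j%:R * sigma))^-1 * a).
  by rewrite mulrA mulfV ?mul1r// gt_eqF.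
rewrite EFinM lee_wpmul2l ?lee_fin ?powR_ge0//; apply: Linfty_norm_le => x.
by rewrite mulrC ler_pdivlMr// mulrC.
Qed.

(** Bernstein's inequality at unit scale, with the step multiplied by [2^j]. *)
Lemma block_bernstein M : exists C : R, 0 <= C /\ forall T (B : R) j, tempered T ->
  (forall x, normc (block theta0 j T x) <= B) -> forall h x,
  normc (iter M (fdiff h) (block theta0 j T) x) <= (C * (2 ^+ j * eucl h)) ^+ M * B.
Proof.
have [C [C0 hC]] := reproduced_iter_diff_le (schwartz_unit_kernel res).
exists C; split=> // T B j hT hB h x.
have -> : block theta0 j T = fun y => unit_block theta0 j T (2 ^+ j *: y).
  apply/funext => y; rewrite /unit_block scalerA mulVf ?scale1r//.
rewrite iter_diff_comp_scale.
have -> : 2 ^+ j * eucl h = eucl (2 ^+ j *: h).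
  by rewrite euclZ ger0_norm// ltW// twoX_gt0.
apply: hC => y; [exact: unit_block_reproducing|exact: hB].
Qed.

(** The bound on the blocks reads [a * rho ^+ j] with [rho = 2^-sigma < 1], which
    makes the series of blocks converge; the order [M > sigma] of the differences
    makes [2^M * rho > 1]. *)
Lemma zygmund_norm_le (sigma : R) : 0 < sigma -> exists C : R, 0 <= C /\
  forall T a, tempered T -> 0 <= a ->
  (forall j x, 2 `^ (j%:R * sigma) * normc (block theta0 j T x) <= a) ->
  (zygmund_norm sigma T <= (C * a)%:E)%E.
Proof.
move=> s0; pose rho : R := 2 `^ (- sigma).
have r0 : 0 < rho by exact: powR_gt0.
have two_gt1 (c : R) : 0 < c -> 1 < 2 `^ c :> R.
  move=> c0; have one : 1 `^ c = 1 :> R by rewrite powR1.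
  rewrite -[ltLHS]one; apply: gt0_ltr_powR; rewrite ?nnegrE//.
  by rewrite ltr1n.
have r1 : rho < 1 by rewrite /rho powRN invf_lt1 ?powR_gt0// two_gt1.
pose M := (Num.truncn sigma).+1.
pose tau := 2 ^+ M * rho.
have t1 : 1 < tau.
  have -> : tau = 2 `^ (M%:R - sigma).
    by rewrite /tau /rho -powR_mulrn// -powRD// pnatr_eq0 implybT.
  by apply: two_gt1; rewrite subr_gt0; have /truncn_itv/andP[] := ltW s0.
have [Cb [Cb0 hCb]] := block_bernstein M.
pose gam := tau / (tau - 1).
have g0 : 0 <= gam by rewrite divr_ge0 ?subr_ge0 ?ltW// (lt_trans ltr01).
pose tb : R := 2 * (1 - rho)^-1.
have tb0 : 0 <= tb by rewrite mulr_ge0// invr_ge0 subr_ge0 ltW.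
exists ((tb + 1) + (2 ^+ M * (tb + 1) + (Cb ^+ M * gam + 2 ^+ M * tb) / rho)); split.
  have X0 (n : nat) (c : R) : 0 <= c -> 0 <= c ^+ n by exact: exprn_ge0.
  apply: addr_ge0; first exact: addr_ge0.
  apply: addr_ge0; first by apply: mulr_ge0; [exact: X0|exact: addr_ge0].
  apply: divr_ge0; last exact: ltW.
  by apply: addr_ge0; apply: mulr_ge0 => //; exact: X0.
move=> T a hT a0 h.
have rj j : (2 `^ (j%:R * sigma))^-1 = rho ^+ j.
  by rewrite /rho -powR_mulrn ?powR_ge0// -powRrM mulNr powRN mulrC.
have hb j x : normc (block theta0 j T x) <= a * rho ^+ j.
  by rewrite -rj ler_pdivlMr ?powR_gt0// mulrC.
have [F hF] := block_series res hT a0 r0 r1 hb.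
have bern j y x : normc (iter M (fdiff y) (block theta0 j T) x) <=
    (Cb * (2 ^+ j * eucl y)) ^+ M * (a * rho ^+ j).
  by apply: hCb => //; exact: hb.
apply: le_trans (_ : (zygmund_fun_norm sigma F <= _)%E).
  have hr := sum_represents res hT r0 r1 hb hF.
  by apply: ereal_inf_lbound; exists F.
apply: le_trans (zygmund_sum_le res hT a0 r0 r1 hb hF Cb0 bern t1 (ltW s0) erefl erefl) _.
rewrite lee_fin le_eqVlt; apply/orP; left; apply/eqP.
rewrite /tail_bound -/tau -/gam /tb; ring.
Qed.

End Embeddings.

Theorem proposition4p17 (R : realType) (d : nat) (hd : (0 < d)%N)
    (theta0 : 'rV[R]_d -> R[i]) (htheta0 : resolution theta0)
    (s p : R) (q : \bar R) (phi : R -> R) (A : scale)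
    (hp : 0 < p) (hq : (0 < q)%E) (hphi : classG d p phi)
    (hA : A = TriebelScale -> (q < +oo)%E ->
      exists eps0 c0 : R, [/\ 0 < eps0, 0 < c0 &
        forall r t : R, 0 < r -> r <= t ->
          t `^ (eps0 - d%:R / p) * phi t <=
            c0 * (r `^ (eps0 - d%:R / p) * phi r)]) :
  embeds (morrey_norm A theta0 s p q phi)
         (besov_infty_norm theta0 (s - d%:R / p)) /\
  (d%:R / p < s ->
    embeds (morrey_norm A theta0 s p q phi)
           (zygmund_norm (s - d%:R / p))).
Proof.
have [C [C0 hC]] := block_bounded s A htheta0 hp hq hphi.
split.
  apply: (embeds_of_bound C0) => T n hT n0 hN.
  by apply: besov_infty_norm_le; exact: hC.
move=> ps; have s0 : 0 < s - d%:R / p by rewrite subr_gt0.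
have [C' [C'0 hC']] := zygmund_norm_le htheta0 s0.
apply: (embeds_of_bound (mulr_ge0 C'0 C0)) => T n hT n0 hN.
rewrite -mulrA; apply: hC' => //; first by rewrite mulr_ge0// ltW.
exact: hC.
Qed.
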